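(* Let $T>0$ and $\gamma>\frac12$, let $u_0\in H^{\gamma+1}(\mathbb T)$ be real-valued with $\widehat{u_0}(0)=0$, and let $u$ be the solution on $[0,T]$ of the KdV equation $$\partial_t u+\partial_x^3u=\tfrac12\partial_x(u^2),\quad x\in\mathbb T,\qquad u(0,x)=u_0(x).$$ For a time step $\tau>0$ put $t_n=n\tau$, and let $u^0=u_0$, $u^{n+1}=\mathrm{ELRI1}(u^n)$ be the numerical solution produced by the first order embedded low-regularity integrator with step $\tau$ (the map $\mathrm{ELRI1}$ defined in the context). Then there exist constants $\tau_0,C>0$ such that for any $0<\tau\le\tau_0$, $$\|u(t_n,\cdot)-u^n\|_{H^\gamma}\le C\tau,\qquad n=0,1,\ldots,\frac T\tau,$$ where $\tau_0$ and $C$ depend only on $T$ and $\|u\|_{L^\infty((0,T);H^{\gamma+1})}$ (for the fixed $\gamma$).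
   Context: $\mathbb T=(0,2\pi)$ is the one-dimensional torus. Fourier coefficients: $\widehat f(\xi)=\frac1{2\pi}\int_{\mathbb T}\mathrm e^{-ix\xi}f(x)\,dx$, $\xi\in\mathbb Z$. $\|f\|_{H^{s}}=\|(1-\partial_{xx})^{s/2}f\|_{L^2(\mathbb T)}$. For $t\in\mathbb R$, $\mathrm e^{t\partial_x^3}$ is the Fourier multiplier with symbol $\mathrm e^{-it\xi^3}$. $\partial_x^{-1}$ is the Fourier multiplier with symbol $(i\xi)^{-1}$ for $\xi\neq0$ and $0$ for $\xi=0$. $\mathbb P f=f-\frac1{2\pi}\int_{\mathbb T}f\,dx$. The index $n$ ranges over integers with $0\le n\tau\le T$. The map $\mathrm{ELRI1}$ (with step $\tau$) is $$\begin{aligned} \mathrm{ELRI1}(w)=\;&\mathrm e^{-\tau\partial_x^3}w-\tfrac16\mathrm e^{-\tau\partial_x^3}\big(\partial_x^{-1}w\big)^2+\tfrac16\big(\mathrm e^{-\tau\partial_x^3}\partial_x^{-1}w\big)^2\\ &+\tfrac1{18}\mathbb P\Big[\mathrm e^{-\tau\partial_x^3}\partial_x^{-1}w\cdot\partial_x^{-1}\big(\mathrm e^{-\tau\partial_x^3}\partial_x^{-1}w\big)^2\Big] -\tfrac1{18}\mathbb P\Big[\mathrm e^{-\tau\partial_x^3}\partial_x^{-1}w\cdot\mathrm e^{-\tau\partial_x^3}\partial_x^{-1}\big(\partial_x^{-1}w\big)^2\Big]\\ &+\tfrac1{54}\mathrm e^{-\tau\partial_x^3}\partial_x^{-1}\big(\partial_x^{-1}w\big)^3-\tfrac1{54}\partial_x^{-1}\big(\mathrm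 e^{-\tau\partial_x^3}\partial_x^{-1}w\big)^3\\ &+\tfrac{\tau}{12\pi}\Big(\int_{\mathbb T}w^2\,dx\Big)\mathrm e^{-\tau\partial_x^3}\partial_x^{-1}w-\tfrac{\tau}{18}\partial_x^{-1}\mathrm e^{-\tau\partial_x^3}\big(w^3\big). \end{aligned}$$ *)

(* Defs.v *)
From mathcomp Require Import all_boot all_order all_algebra.
From mathcomp Require Import all_classical all_reals all_analysis.
From mathcomp Require Import ess_sup_inf.
From mathcomp Require Import complex.

Set Implicit Arguments.
Unset Strict Implicit.
Unset Printing Implicit Defensive.

Import Order.TTheory GRing.Theory Num.Theory.
Import numFieldNormedType.Exports.

Local Open Scope classical_set_scope.
Local Open Scope ring_scope.
Local Open Scope complex_scope.

(* A function on the torus is a function on the line of which only the values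
   on (0, 2pi) matter. *)
Section Torus.
Context {R : realType}.

Local Notation mu := (@lebesgue_measure R).
Local Notation C := R[i].

Definition torus : set R := `]0, 2 * pi[%classic.

Definition toC (f : R -> R) : R -> C := fun x => (f x)%:C.

Definition cint (f : R -> C) : C :=
  (\int[mu]_(x in torus) complex.Re (f x))
    +i* (\int[mu]_(x in torus) complex.Im (f x)).

Definition expi (a : R) : C := cos a +i* sin a.

Definition fourier (f : R -> C) (xi : int) : C :=
  ((2 * pi)^-1)%:C * cint (fun x => expi (- (x * xi%:~R)) * f x).

Definition L2norm (f : R -> C) : \bar R :=
  ((\int[mu]_(x in torus) ((Normc.normc (f x)) ^+ 2)%:E) `^ 2^-1)%E.

Definition inL2 (f : R -> C) : Prop :=
  [/\ measurable_fun torus (fun x => complex.Re (f x)),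
      measurable_fun torus (fun x => complex.Im (f x))
    & (L2norm f < +oo)%E].

(* [g] represents the image of [f] under the Fourier multiplier with symbol
   [m]; such a [g] is unique up to equality almost everywhere on the torus. *)
Definition is_multiplier (m : int -> C) (f g : R -> C) : Prop :=
  inL2 g /\ forall xi : int, fourier g xi = m xi * fourier f xi.

(* A chosen representative, with default value 0 outside the domain of the
   multiplier as an operator into L^2. *)
Definition multiplier (m : int -> C) (f : R -> C) : R -> C :=
  xget (fun=> 0) [set g | is_multiplier m f g].

Definition bessel (s : R) (xi : int) : C :=
  ((1 + xi%:~R ^+ 2) `^ (s / 2))%:C.

(* Meant for s >= 0, where elements of H^s are functions. *)
Definition inHs (s : R) (f : R -> C) : Prop :=
  inL2 f /\ exists g, is_multiplier (bessel s) f g.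

Definition Hnorm (s : R) (f : R -> C) : \bar R :=
  if `[< inHs s f >] then L2norm (multiplier (bessel s) f) else +oo%E.

Definition exp_dx3 (t : R) : (R -> C) -> (R -> C) :=
  multiplier (fun xi => expi (- (t * xi%:~R ^+ 3))).

Definition dx_inv : (R -> C) -> (R -> C) :=
  multiplier (fun xi => if xi == 0 then 0 else (0 +i* xi%:~R)^-1).

Definition proj_mean0 (f : R -> C) : R -> C :=
  fun x => f x - ((2 * pi)^-1)%:C * cint f.

Definition ELRI1 (tau : R) (w : R -> C) : R -> C :=
  let E := exp_dx3 (- tau) in
  let D := dx_inv in
  let P := proj_mean0 in
  fun x =>
    E w x
    - 6^-1 * E (fun y => D w y ^+ 2) x
    + 6^-1 * E (D w) x ^+ 2
    + 18^-1 * P (fun y => E (D w) y * D (fun z => E (D w) z ^+ 2) y) x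
    - 18^-1 * P (fun y => E (D w) y * E (D (fun z => D w z ^+ 2)) y) x
    + 54^-1 * E (D (fun y => D w y ^+ 3)) x
    - 54^-1 * D (fun y => E (D w) y ^+ 3) x
    + (tau / (12 * pi))%:C * cint (fun y => w y ^+ 2) * E (D w) x
    - (tau / 18)%:C * D (E (fun y => w y ^+ 3)) x.

Definition test_function (phi : R -> R) : Prop :=
  (forall (k : nat) (x : R), derivable (derive1n k phi) x 1) /\
  (forall x : R, phi (x + 2 * pi) = phi x).

Definition continuous_in_Hs (T s : R) (u : R -> R -> R) : Prop :=
  (forall t, 0 <= t <= T -> inHs s (toC (u t))) /\
  (forall t, 0 <= t <= T ->
     Hnorm s (fun x => toC (u r) x - toC (u t) x)
       @[r --> within `[0, T]%classic (nbhs t)] --> (0 : \bar R)%E).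

(* The solution in C([0, T]; H^s) of u_t + u_xxx = (u^2)_x / 2, u(0) = u0, the
   equation being understood in the sense of periodic distributions (the third
   derivative of u(t) need not be a function). *)
Definition KdV_solution (T s : R) (u0 : R -> R) (u : R -> R -> R) : Prop :=
  [/\ continuous_in_Hs T s u,
      {ae mu, forall x, torus x -> u 0 x = u0 x}
    & forall (phi : R -> R) (t : R), test_function phi -> 0 < t < T ->
        is_derive t (1 : R)
          (fun r => \int[mu]_(x in torus) (u r x * phi x))
          (\int[mu]_(x in torus) (u t x * derive1n 3 phi x)
           - 2^-1 * \int[mu]_(x in torus) (u t x ^+ 2 * derive1 phi x))].

Definition LinfHs (T s : R) (u : R -> R -> R) : \bar R :=
  ess_sup (mrestr mu (measurable_itv `]0, T[)) (fun t => Hnorm s (toC (u t))).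

End Torus.

(* Main.v *)
Require Import Defs.
From mathcomp Require Import all_boot all_order all_algebra.
From mathcomp Require Import all_classical all_reals all_analysis.
From mathcomp Require Import measurable_realfun ess_sup_inf.
From mathcomp Require Import complex.
From mathcomp Require Import ring lra zify.
Import Order.TTheory GRing.Theory Num.Theory.
Local Open Scope ring_scope.

(** Everything is read off Fourier coefficients. For an exponent above 1/2,
    sequences whose weighted square sum is finite are summable and form an
    algebra under convolution, so on such functions the operations of the scheme
    become convolutions with bounded symbols, and one step acts on coefficients
    as the map [fstep]: a twisted step [tstep] followed by the group of the Airy
    equation ([fourier_scheme]). This uses that an integrable function on the
    torus is determined by its coefficients ([fourier_uniq]). Testing the
    equation against cosines and sines shows that the coefficients of the
    solution are differentiable in time, and that after twisting by the Airy
    group they satisfy, with z = i xi,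

      v_xi' = z/2 * sum_(k + l = xi) exp (- 3 i s xi k l) v_k v_l.

    Consistency ([local_error]). Let D be the inverse derivative and let Q_s be
    the sum above with D v in place of v. The phase has derivative
    3 z z_k z_l, where z_k z_l is exactly undone by the two inverse derivatives;
    hence v - Q_s/6 has a cubic time derivative without loss of derivatives. In
    that cubic term the pairs k + l = 0 give the mass term of the scheme, and
    the remaining part, frozen at the initial time, is again a total time
    derivative up to the cube of v, whose integral is linear in time, and an
    oscillating remainder. One derivative of regularity makes that remainder of
    size s, and integration gives an error of order tau^2 per step.

    Stability ([stability], [nform_inv]). The step is not close to the identity
    on rough data: its quadratic part [quad] is bounded but not small at high
    frequencies. It is small after an inverse derivative, or below a fixed
    frequency K, and above K it is the increment of the twisted square of D w.
    The change of unknowns [nform] K, which sends w to w - Pi_(> K) (D w)^2 / 6,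
    absorbs this increment exactly, so in the new unknown one step has Lipschitz
    constant 1 + O(tau). The quadratic map being subtracted has a small Lipschitz
    constant for K large, hence differences of the new unknown control
    differences of the old one up to a factor 2.

    Adding local errors of order tau^2 over T/tau steps gives an error of order
    tau; for small tau this keeps the numerical solution in the ball in which
    the estimates hold ([fourier_convergence]). *)

Section FourierAnalysis.
Set Implicit Arguments.
Unset Strict Implicit.
Import numFieldNormedType.Exports.
Local Open Scope classical_set_scope.
Local Open Scope complex_scope.

(** * Unordered sums over arbitrary index sets *)
Section Sums.
Context {R : realType}.
Local Notation C := R[i].
Local Notation normc := Normc.normc.

Definition nsum (I : choiceType) (f : I -> R) : \bar R :=
  (\esum_(i in [set: I]) (f i)%:E)%E.

Lemma eq_nsum (I : choiceType) (f g : I -> R) : f =1 g -> nsum f = nsum g.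
Proof. by move=> fg; apply: eq_esum => i _; rewrite fg. Qed.

Lemma nsum_ge0 (I : choiceType) (f : I -> R) :
  (forall i, 0 <= f i) -> (0 <= nsum f)%E.
Proof. by move=> f0; apply: esum_ge0 => i _; rewrite lee_fin. Qed.

Lemma le_nsum (I : choiceType) (f g : I -> R) :
  (forall i, f i <= g i) -> (nsum f <= nsum g)%E.
Proof. by move=> fg; apply: le_esum => i _; rewrite lee_fin. Qed.

Lemma nsumD (I : choiceType) (f g : I -> R) :
  (forall i, 0 <= f i) -> (forall i, 0 <= g i) ->
  (nsum (fun i => f i + g i)%R = nsum f + nsum g)%E.
Proof.
move=> f0 g0; rewrite /nsum -esumD; first by apply: eq_esum => i _; rewrite EFinD.
- by move=> i _; rewrite lee_fin.
- by move=> i _; rewrite lee_fin.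
Qed.

Lemma seq_le_nsum (I : choiceType) (f : I -> R) (s : seq I) :
  (forall i, 0 <= f i) -> uniq s -> ((\sum_(i <- s) f i)%:E <= nsum f)%E.
Proof.
move=> f0 us; apply: esum_ge; exists [set` s].
  by split => //; exact: finite_seq.
by rewrite -sumEFin fsbig_seq.
Qed.

Lemma term_le_nsum (I : choiceType) (f : I -> R) (i : I) :
  (forall i, 0 <= f i) -> ((f i)%:E <= nsum f)%E.
Proof.
by move=> f0; have := @seq_le_nsum _ _ [:: i] f0 isT; rewrite big_seq1.
Qed.

Lemma nsum_le_seq (I : choiceType) (f : I -> R) (A : \bar R) :
  (forall s : seq I, uniq s -> ((\sum_(i <- s) f i)%:E <= A)%E) -> (nsum f <= A)%E.
Proof.
move=> h; apply: ge_ereal_sup => /= x [X [finX _]] <-.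
by rewrite fsbig_finite//= sumEFin; apply: h; exact: finmap.fset_uniq.
Qed.

Lemma nsum_fin (I : choiceType) (f : I -> R) (A : R) :
  (forall i, 0 <= f i) -> (nsum f <= A%:E)%E -> exists2 r, 0 <= r <= A & nsum f = r%:E.
Proof.
move=> f0; have := nsum_ge0 f0; case: (nsum f) => [r| |]//.
by rewrite !lee_fin => r0 rA; exists r; rewrite ?r0.
Qed.

Lemma nsum_finlt (I : choiceType) (f : I -> R) :
  (forall i, 0 <= f i) -> (nsum f < +oo)%E -> exists2 r, 0 <= r & nsum f = r%:E.
Proof.
move=> f0; have := nsum_ge0 f0; case: (nsum f) => [r| |]//.
by rewrite !lee_fin => r0 _; exists r.
Qed.

Lemma nsumZ (I : choiceType) (c : R) (f : I -> R) : 0 <= c ->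
  (forall i, 0 <= f i) -> nsum (fun i => c * f i) = (c%:E * nsum f)%E.
Proof.
have H (d : R) (g : I -> R) : 0 <= d -> (forall i, 0 <= g i) ->
    (nsum (fun i => d * g i)%R <= d%:E * nsum g)%E.
  move=> d0 g0; apply: nsum_le_seq => s us; rewrite -mulr_sumr EFinM.
  by apply: lee_wpmul2l => //; exact: seq_le_nsum.
move=> c0 f0; apply/eqP; rewrite eq_le H//=.
have [<-|c_gt0] := eqVneq 0 c; last have {}c0 : 0 < c by rewrite lt_neqAle c_gt0.
  by rewrite mul0e; apply: nsum_ge0 => i; rewrite mul0r.
rewrite -(@lee_pmul2l _ c^-1%:E)// ?lte_fin ?invr_gt0//.
rewrite muleA -EFinM mulVf ?gt_eqF// mul1e.
have := @H c^-1 (fun i => c * f i); rewrite invr_ge0 (ltW c0) => /(_ isT).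
rewrite (_ : (fun i => c^-1 * (c * f i)) = f).
  by apply => i; rewrite mulr_ge0// ltW.
by apply/funext => i; rewrite mulrA mulVf ?gt_eqF// mul1r.
Qed.

Lemma nsum_reindex (I J : choiceType) (e : I -> J) (f : J -> R) :
  bijective e -> nsum f = nsum (f \o e).
Proof.
move=> be; apply: (reindex_esum [set: I] [set: J] e (fun j => (f j)%:E)).
by rewrite setTT_bijective.
Qed.

Lemma nsum_swapE (I J : choiceType) (f : I -> J -> R) :
  (forall i j, 0 <= f i j) ->
  (\esum_(i in [set: I]) nsum (f i) = \esum_(j in [set: J]) nsum (f^~ j))%E.
Proof.
move=> f0; rewrite /nsum !esum_esum; [|by move=> *; rewrite lee_fin..].
rewrite (reindex_esum ([set: J] `*`` fun=> [set: I]) ([set: I] `*`` fun=> [set: J]) (fun k => (k.2, k.1)))//.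
by split => // [[a b] [c d] _ _ /= [-> ->]//|[a b] _]; exists (b, a).
Qed.

Lemma nsum_swap (I J : choiceType) (f : I -> J -> R) (g : I -> R) (h : J -> R) :
  (forall i j, 0 <= f i j) ->
  (forall i, nsum (f i) = (g i)%:E) -> (forall j, nsum (f^~ j) = (h j)%:E) ->
  nsum g = nsum h.
Proof.
move=> f0 fg fh; rewrite /nsum.
under eq_esum do rewrite -fg.
by rewrite (nsum_swapE f0); apply: eq_esum => j _; rewrite fh.
Qed.

Lemma nsum0 (I : choiceType) : nsum (fun _ : I => 0) = 0%E.
Proof. by rewrite /nsum esum1. Qed.

(** The tail of a family: it is set to zero on the finite list [s]. *)
Definition off (I : choiceType) (V : zmodType) (s : seq I) (f : I -> V) (i : I) : V :=
  if i \in s then 0 else f i.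

Lemma nsum_split (I : choiceType) (f : I -> R) (s : seq I) :
  (forall i, 0 <= f i) -> uniq s ->
  (nsum f = (\sum_(i <- s) f i)%:E + nsum (off s f))%E.
Proof.
move=> f0 us.
rewrite (@eq_nsum _ f (fun i => (if i \in s then f i else 0) + off s f i)); last first.
  by move=> i; rewrite /off; case: ifP => _; rewrite ?addr0 ?add0r.
rewrite nsumD; last 2 first.
- by move=> i; case: ifP.
- by move=> i; rewrite /off; case: ifP.
congr (_ + _)%E.
transitivity (\esum_(i in [set` s]) (f i)%:E)%E.
  rewrite esum_mkcond; apply: eq_esum => i _.
  by rewrite mem_setE; case: ifP.
rewrite -sumEFin fsbig_seq// -esum_fset.
- by congr esum; apply/seteqP; split => i /=; rewrite ?inE ?mem_setE.
- exact: finite_seq.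
- by move=> i _; rewrite lee_fin.
Qed.

(** Otherwise every finite partial sum would stay a fixed amount below the
    total. *)
Lemma nsum_tail (I : choiceType) (f : I -> R) (e : R) :
  (forall i, 0 <= f i) -> (nsum f < +oo)%E -> 0 < e ->
  exists2 s, uniq s & (nsum (off s f) <= e%:E)%E.
Proof.
move=> f0 fo e0; apply: contrapT => /forallPNP h.
have [r r0 fr] := nsum_finlt f0 fo.
suff : (nsum f <= (r - e)%:E)%E by rewrite fr lee_fin; lra.
apply: nsum_le_seq => s us; move/(_ s us)/negP: (h).
rewrite -ltNge => /ltW; move: fr; rewrite (nsum_split f0 us).
case: (nsum (off s f)) => [t| |] //=.
by case => fr; rewrite !lee_fin; lra.
Qed.

Local Opaque nsum.

(** A difference of two sums of nonnegative families, so that the theory of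
    [nsum] applies; the shift by [`|f i|] avoids positive and negative parts. *)
Definition rsum (I : choiceType) (f : I -> R) : R :=
  fine (nsum (fun i => `|f i| + f i)) - fine (nsum (fun i => `|f i|)%R).

Definition rsmb (I : choiceType) (f : I -> R) := (nsum (fun i => `|f i|)%R < +oo)%E.

Lemma eq_rsum (I : choiceType) (f g : I -> R) : f =1 g -> rsum f = rsum g.
Proof. by move=> /funext ->. Qed.

Lemma nsum_ltD (I : choiceType) (f g : I -> R) :
  (forall i, 0 <= f i) -> (forall i, 0 <= g i) ->
  (nsum f < +oo)%E -> (nsum g < +oo)%E -> (nsum (fun i => f i + g i)%R < +oo)%E.
Proof. by move=> f0 g0 fo go; rewrite nsumD// lte_add_pinfty. Qed.

Lemma addabs_ge0 (x : R) : 0 <= `|x| + x.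
Proof. by have := ler_norm (- x); rewrite normrN; lra. Qed.

(** Any decomposition into nonnegative summable families computes the sum; this
    gives linearity. *)
Lemma rsumE (I : choiceType) (f p q : I -> R) :
  (forall i, 0 <= p i) -> (forall i, 0 <= q i) ->
  (nsum p < +oo)%E -> (nsum q < +oo)%E -> (forall i, f i = p i - q i) ->
  rsum f = fine (nsum p) - fine (nsum q).
Proof.
move=> p0 q0 po qo fpq.
have pqo := nsum_ltD p0 q0 po qo.
have af0 i : 0 <= `|f i| by [].
have afo : (nsum (fun i => `|f i|)%R < +oo)%E.
  apply: le_lt_trans pqo; apply: le_nsum => i.
  by rewrite fpq (le_trans (ler_normB _ _))// !ger0_norm.
have bf0 i : 0 <= `|f i| + f i by exact: addabs_ge0.
have bfo : (nsum (fun i => `|f i| + f i)%R < +oo)%E.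
  apply: le_lt_trans (nsum_ltD af0 af0 afo afo); apply: le_nsum => i.
  by rewrite lerD2l ler_norm.
have : (nsum (fun i => `|f i| + f i)%R + nsum q = nsum (fun i => `|f i|)%R + nsum p)%E.
  by rewrite -!nsumD//; apply: eq_nsum => i; rewrite fpq; ring.
rewrite /rsum.
have [a _ ->] := nsum_finlt bf0 bfo; have [b _ ->] := nsum_finlt af0 afo.
have [c _ ->] := nsum_finlt p0 po; have [d _ ->] := nsum_finlt q0 qo.
by move=> [] /=; lra.
Qed.

Lemma rsmb_pos (I : choiceType) (f : I -> R) : rsmb f ->
  (nsum (fun i => `|f i| + f i)%R < +oo)%E.
Proof.
move=> sf; have sf2 := nsum_ltD (fun i => normr_ge0 (f i)) (fun i => normr_ge0 (f i)) sf sf.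
by apply: le_lt_trans sf2; apply: le_nsum => i; rewrite lerD2l ler_norm.
Qed.

Lemma rsmbZ (I : choiceType) c (f : I -> R) : rsmb f -> rsmb (fun i => c * f i).
Proof.
move=> sf; rewrite /rsmb (@eq_nsum _ _ (fun i => `|c| * `|f i|)); last first.
  by move=> i; rewrite normrM.
rewrite nsumZ//; have [r r0 ->] := nsum_finlt (fun i => normr_ge0 (f i)) sf.
by rewrite -EFinM ltry.
Qed.

Lemma rsumD (I : choiceType) (f g : I -> R) : rsmb f -> rsmb g ->
  rsum (fun i => f i + g i) = rsum f + rsum g.
Proof.
move=> sf sg; rewrite (@rsumE _ _ (fun i => (`|f i| + f i) + (`|g i| + g i))
  (fun i => `|f i| + `|g i|)).
- have -> := @nsumD _ (fun i => `|f i| + f i) (fun i => `|g i| + g i)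
    (fun i => addabs_ge0 _) (fun i => addabs_ge0 _).
  have -> := @nsumD _ (fun i => `|f i|) (fun i => `|g i|)
    (fun i => normr_ge0 _) (fun i => normr_ge0 _).
  rewrite /rsum; have [a _ ->] := nsum_finlt (fun i => addabs_ge0 (f i)) (rsmb_pos sf).
  have [b _ ->] := nsum_finlt (fun i => addabs_ge0 (g i)) (rsmb_pos sg).
  have [c _ ->] := nsum_finlt (fun i => normr_ge0 (f i)) sf.
  have [d _ ->] := nsum_finlt (fun i => normr_ge0 (g i)) sg.
  by rewrite /=; ring.
- by move=> i; rewrite addr_ge0// addabs_ge0.
- by move=> i; rewrite addr_ge0.
- by apply: nsum_ltD => [i|i||]; rewrite ?addabs_ge0//; apply: rsmb_pos.
- by apply: nsum_ltD => [i|i||].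
- by move=> i; ring.
Qed.

Lemma rsumZ (I : choiceType) c (f : I -> R) : rsmb f ->
  rsum (fun i => c * f i) = c * rsum f.
Proof.
move=> sf.
have [a a0 Ea] := nsum_finlt (fun i => addabs_ge0 (f i)) (rsmb_pos sf).
have [b b0 Eb] := nsum_finlt (fun i => normr_ge0 (f i)) sf.
have [c0|/ltW c0] := leP 0 c.
  rewrite (@rsumE _ _ (fun i => c * (`|f i| + f i)) (fun i => c * `|f i|)).
  - rewrite !nsumZ//; last by move=> i; exact: addabs_ge0.
    by rewrite /rsum Ea Eb /=; ring.
  - by move=> i; rewrite mulr_ge0 ?addabs_ge0.
  - by move=> i; rewrite mulr_ge0.
  - by rewrite nsumZ// ?Ea -?EFinM ?ltry// => i; exact: addabs_ge0.
  - by rewrite nsumZ// Eb -EFinM ltry.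
  - by move=> i; ring.
have c0' : 0 <= - c by rewrite oppr_ge0.
rewrite (@rsumE _ _ (fun i => - c * `|f i|) (fun i => - c * (`|f i| + f i))).
- rewrite !nsumZ//; last by move=> i; exact: addabs_ge0.
  by rewrite /rsum Ea Eb /=; ring.
- by move=> i; rewrite mulr_ge0.
- by move=> i; rewrite mulr_ge0 ?addabs_ge0.
- by rewrite nsumZ// Eb -EFinM ltry.
- by rewrite nsumZ// ?Ea -?EFinM ?ltry// => i; exact: addabs_ge0.
- by move=> i; ring.
Qed.

Lemma rsum_le (I : choiceType) (f : I -> R) (A : R) :
  (nsum (fun i => `|f i|)%R <= A%:E)%E -> `|rsum f| <= A.
Proof.
move=> fA; have sf : rsmb f by apply: le_lt_trans fA _; rewrite ltry.
have [a a0 Ea] := nsum_finlt (fun i => addabs_ge0 (f i)) (rsmb_pos sf).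
have [b b0 Eb] := nsum_finlt (fun i => normr_ge0 (f i)) sf.
have : (nsum (fun i => `|f i| + f i)%R <= nsum (fun i => `|f i|)%R + nsum (fun i => `|f i|)%R)%E.
  by rewrite -nsumD//; apply: le_nsum => i; rewrite lerD2l ler_norm.
rewrite /rsum Ea; move: fA; rewrite Eb -EFinD !lee_fin /= => bA ab.
by rewrite ler_norml; apply/andP; split; lra.
Qed.

Lemma rsum_reindex (I J : choiceType) (e : I -> J) (f : J -> R) :
  bijective e -> rsum f = rsum (f \o e).
Proof. by move=> be; rewrite /rsum !(nsum_reindex _ be). Qed.

Lemma fine_nsum_ge0 (I : choiceType) (f : I -> R) : (forall i, 0 <= f i) ->
  0 <= fine (nsum f).
Proof. by move=> f0; apply: fine_ge0; exact: nsum_ge0. Qed.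

Lemma nsum_fineK (I : choiceType) (f : I -> R) : (forall i, 0 <= f i) ->
  (nsum f < +oo)%E -> nsum f = (fine (nsum f))%:E.
Proof. by move=> f0 /(nsum_finlt f0)[r _ ->]. Qed.

Lemma nsum_swap_lt (I J : choiceType) (f : I -> J -> R) (g : I -> R) :
  (forall i j, 0 <= f i j) ->
  (forall i, (nsum (f i) <= (g i)%:E)%E) -> (nsum g < +oo)%E ->
  (forall j, (nsum (f^~ j) < +oo)%E) /\
  nsum (fun i => fine (nsum (f i))) = nsum (fun j => fine (nsum (f^~ j))) /\
  (nsum (fun i => fine (nsum (f i))) < +oo)%E.
Proof.
move=> f0 fg go.
have fi i : nsum (f i) = (fine (nsum (f i)))%:E.
  by apply: nsum_fineK => //; apply: le_lt_trans (fg i) _; rewrite ltry.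
have h1 : (nsum (fun i => fine (nsum (f i))) < +oo)%E.
  by apply: le_lt_trans go; apply: le_nsum => i; rewrite -lee_fin -fi.
have h2 j : (nsum (f^~ j) < +oo)%E.
  apply: le_lt_trans h1; apply: le_nsum => i; rewrite -lee_fin -fi.
  exact: term_le_nsum.
split=> //; split=> //; apply: (nsum_swap f0 fi) => j.
exact: nsum_fineK.
Qed.

Lemma rsum_swap (I J : choiceType) (f : I -> J -> R) (g : I -> R) :
  (forall i, (nsum (fun j => `|f i j|)%R <= (g i)%:E)%E) -> (nsum g < +oo)%E ->
  rsum (fun i => rsum (f i)) = rsum (fun j => rsum (f^~ j)).
Proof.
move=> fg go.
have b0 i j : 0 <= `|f i j| + f i j := addabs_ge0 _.
have g0 i : 0 <= g i by rewrite -lee_fin; apply: le_trans (fg i); exact: nsum_ge0.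
have [q1 [q2 q3]] := nsum_swap_lt (fun i j => normr_ge0 (f i j)) fg go.
have [p1 [p2 p3]] : (forall j, (nsum (fun i => `|f i j| + f i j)%R < +oo)%E) /\
   nsum (fun i => fine (nsum (fun j => `|f i j| + f i j))) =
   nsum (fun j => fine (nsum (fun i => `|f i j| + f i j))) /\
   (nsum (fun i => fine (nsum (fun j => `|f i j| + f i j)%R)) < +oo)%E.
  apply: (@nsum_swap_lt _ _ (fun i j => `|f i j| + f i j) (fun i => 2 * g i) b0).
    move=> i; have -> : (2 * g i)%:E = ((g i)%:E + (g i)%:E)%E.
      by rewrite -EFinD; congr (_%:E); ring.
    apply: le_trans (leeD (fg i) (fg i)); rewrite -nsumD//; apply: le_nsum => j.
    by rewrite lerD2l ler_norm.
  by rewrite nsumZ//; have [r _ ->] := nsum_finlt g0 go; rewrite -EFinM ltry.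
rewrite (@rsumE _ _ (fun i => fine (nsum (fun j => `|f i j| + f i j)))
  (fun i => fine (nsum (fun j => `|f i j|)%R)))//; last 2 first.
- by move=> i; exact: fine_nsum_ge0.
- by move=> i; exact: fine_nsum_ge0.
rewrite [RHS](@rsumE _ _ (fun j => fine (nsum (fun i => `|f i j| + f i j)))
  (fun j => fine (nsum (fun i => `|f i j|)%R)))//; last 4 first.
- by move=> i; exact: fine_nsum_ge0.
- by move=> i; exact: fine_nsum_ge0.
- by rewrite -p2.
- by rewrite -q2.
by rewrite p2 q2.
Qed.

Lemma rsmb_off (I : choiceType) (f : I -> R) s : rsmb f -> rsmb (off s f).
Proof.
move=> sf; apply: le_lt_trans sf; apply: le_nsum => i.
by rewrite /off; case: ifP => _; rewrite ?normr0.
Qed.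

Lemma rsum_split (I : choiceType) (f : I -> R) (s : seq I) :
  rsmb f -> uniq s -> rsum f = \sum_(i <- s) f i + rsum (off s f).
Proof.
move=> sf us.
have H (g : I -> R) : (forall i, 0 <= g i) -> (nsum g < +oo)%E ->
    fine (nsum g) = \sum_(i <- s) g i + fine (nsum (off s g)).
  move=> g0 go; have := nsum_split g0 us; have [r _ ->] := nsum_finlt g0 go.
  by case: (nsum (off s g)) => //= t [].
rewrite /rsum (H _ (fun i => addabs_ge0 (f i)) (rsmb_pos sf)).
rewrite (H _ (fun i => normr_ge0 (f i)) sf).
rewrite big_split /=.
have -> : off s (fun i => `|f i| + f i) = (fun i => `|off s f i| + off s f i).
  by apply/funext => i; rewrite /off; case: ifP; rewrite ?normr0 ?addr0.
have -> : off s (fun i => `|f i|) = (fun i => `|off s f i|).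
  by apply/funext => i; rewrite /off; case: ifP; rewrite ?normr0.
by ring.
Qed.

(** The sum of [x i * y i] is at most half the sum of squares after rescaling
    the two families to unit norm. *)
Lemma cauchy_schwarz_nsum (I : choiceType) (x y : I -> R) (X Y : R) :
  0 < X -> 0 < Y -> (forall i, 0 <= x i) -> (forall i, 0 <= y i) ->
  (nsum (fun i => x i ^+ 2)%R <= (X ^+ 2)%:E)%E ->
  (nsum (fun i => y i ^+ 2)%R <= (Y ^+ 2)%:E)%E ->
  (nsum (fun i => x i * y i)%R <= (X * Y)%:E)%E.
Proof.
move=> X0 Y0 x0 y0 hx hy.
have XY : 0 < Y / X / 2 by rewrite divr_gt0// divr_gt0.
have YX : 0 < X / Y / 2 by rewrite divr_gt0// divr_gt0.
apply: (@le_trans _ _ (nsum (fun i => (Y / X / 2) * x i ^+ 2 + (X / Y / 2) * y i ^+ 2))).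
  apply: le_nsum => i.
  have := sqr_ge0 (Y * x i - X * y i).
  have -> : Y / X / 2 * x i ^+ 2 + X / Y / 2 * y i ^+ 2 =
    (Y ^+ 2 * x i ^+ 2 + X ^+ 2 * y i ^+ 2) / (2 * (X * Y)).
    by field; rewrite ?gt_eqF.
  rewrite ler_pdivlMr ?mulr_gt0//; lra.
rewrite nsumD; last 2 first.
- by move=> i; rewrite mulr_ge0// ?sqr_ge0// ltW.
- by move=> i; rewrite mulr_ge0// ?sqr_ge0// ltW.
rewrite !nsumZ ?(ltW XY) ?(ltW YX)//; [|by move=> i; exact: sqr_ge0..].
apply: (@le_trans _ _ ((Y / X / 2)%:E * (X ^+ 2)%:E + (X / Y / 2)%:E * (Y ^+ 2)%:E)%E).
  by apply: leeD; apply: lee_wpmul2l => //; rewrite lee_fin ltW.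
rewrite -!EFinM -EFinD lee_fin le_eqVlt; apply/orP; left; apply/eqP.
by field; rewrite ?gt_eqF.
Qed.

Lemma normc_ge0 (z : C) : 0 <= normc z.
Proof. by case: z => a b /=; exact: sqrtr_ge0. Qed.

Lemma sqr_normcE (z : C) : normc z ^+ 2 = complex.Re z ^+ 2 + complex.Im z ^+ 2.
Proof. by case: z => a b /=; rewrite sqr_sqrtr// addr_ge0// sqr_ge0. Qed.

Lemma Re_le_normc (z : C) : `|complex.Re z| <= normc z.
Proof.
case: z => a b /=; rewrite -sqrtr_sqr ler_sqrt// ?addr_ge0 ?sqr_ge0//.
by rewrite lerDl sqr_ge0.
Qed.

Lemma Im_le_normc (z : C) : `|complex.Im z| <= normc z.
Proof.
case: z => a b /=; rewrite -sqrtr_sqr ler_sqrt// ?addr_ge0 ?sqr_ge0//.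
by rewrite lerDr sqr_ge0.
Qed.

Lemma normc_le2 (z : C) : normc z <= `|complex.Re z| + `|complex.Im z|.
Proof.
rewrite -(@ler_pXn2r _ 2)// ?nnegrE ?normc_ge0 ?addr_ge0// sqr_normcE sqrrD.
rewrite !real_normK ?num_real//.
have : 0 <= `|complex.Re z| * `|complex.Im z| by rewrite mulr_ge0.
by rewrite mulr2n; lra.
Qed.

Lemma normcR (x : R) : normc x%:C = `|x|.
Proof. by rewrite /= expr0n addr0 sqrtr_sqr. Qed.

Lemma normcB_le (x y : C) : normc (x - y) <= normc x + normc y.
Proof. by apply: le_trans (le_normcD _ _) _; rewrite normcN. Qed.

Lemma cReD (x y : C) : complex.Re (x + y) = complex.Re x + complex.Re y.
Proof. by case: x y => [a b] [c d]. Qed.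
Lemma cImD (x y : C) : complex.Im (x + y) = complex.Im x + complex.Im y.
Proof. by case: x y => [a b] [c d]. Qed.
Lemma cReM (x y : C) : complex.Re (x * y) =
  complex.Re x * complex.Re y - complex.Im x * complex.Im y.
Proof. by case: x y => [a b] [c d]. Qed.
Lemma cImM (x y : C) : complex.Im (x * y) =
  complex.Re x * complex.Im y + complex.Im x * complex.Re y.
Proof. by case: x y => [a b] [c d]. Qed.
Lemma cReN (x : C) : complex.Re (- x) = - complex.Re x.
Proof. by case: x. Qed.
Lemma cImN (x : C) : complex.Im (- x) = - complex.Im x.
Proof. by case: x. Qed.
Lemma cRe_sum (I : Type) (s : seq I) (f : I -> C) :
  complex.Re (\sum_(i <- s) f i) = \sum_(i <- s) complex.Re (f i).
Proof. by elim: s => [|i s ih]; rewrite ?big_nil// !big_cons cReD ih. Qed.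
Lemma cIm_sum (I : Type) (s : seq I) (f : I -> C) :
  complex.Im (\sum_(i <- s) f i) = \sum_(i <- s) complex.Im (f i).
Proof. by elim: s => [|i s ih]; rewrite ?big_nil// !big_cons cImD ih. Qed.
Lemma complexP (x y : C) : complex.Re x = complex.Re y ->
  complex.Im x = complex.Im y -> x = y.
Proof. by case: x y => [a b] [c d] /= -> ->. Qed.

Definition csum (I : choiceType) (f : I -> C) : C :=
  rsum (fun i => complex.Re (f i)) +i* rsum (fun i => complex.Im (f i)).

Definition csmb (I : choiceType) (f : I -> C) := (nsum (fun i => normc (f i)) < +oo)%E.

Lemma eq_csum (I : choiceType) (f g : I -> C) : f =1 g -> csum f = csum g.
Proof. by move=> /funext ->. Qed.

Lemma csmb_Re (I : choiceType) (f : I -> C) : csmb f -> rsmb (fun i => complex.Re (f i)).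
Proof. by move=> sf; apply: le_lt_trans sf; apply: le_nsum => i; exact: Re_le_normc. Qed.

Lemma csmb_Im (I : choiceType) (f : I -> C) : csmb f -> rsmb (fun i => complex.Im (f i)).
Proof. by move=> sf; apply: le_lt_trans sf; apply: le_nsum => i; exact: Im_le_normc. Qed.

Lemma csmb_le (I : choiceType) (f : I -> C) (g : I -> R) :
  (nsum g < +oo)%E -> (forall i, normc (f i) <= g i) -> csmb f.
Proof. by move=> go fg; apply: le_lt_trans go; exact: le_nsum. Qed.

Lemma csumD (I : choiceType) (f g : I -> C) : csmb f -> csmb g ->
  csum (fun i => f i + g i) = csum f + csum g.
Proof.
move=> sf sg; apply: complexP; rewrite ?cReD ?cImD /=.
  by rewrite -rsumD; [apply: eq_rsum => i; rewrite cReD|exact: csmb_Re..].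
by rewrite -rsumD; [apply: eq_rsum => i; rewrite cImD|exact: csmb_Im..].
Qed.

Lemma csumZ (I : choiceType) c (f : I -> C) : csmb f ->
  csum (fun i => c * f i) = c * csum f.
Proof.
move=> sf; have rf := csmb_Re sf; have jf := csmb_Im sf.
apply: complexP; rewrite ?cReM ?cImM /=.
  rewrite -mulNr -!rsumZ// -rsumD; [|exact: rsmbZ..].
  by apply: eq_rsum => i; rewrite cReM mulNr.
rewrite -!rsumZ// -rsumD; [|exact: rsmbZ..].
by apply: eq_rsum => i; rewrite cImM.
Qed.

Lemma csumN (I : choiceType) (f : I -> C) : csmb f ->
  csum (fun i => - f i) = - csum f.
Proof.
by move=> sf; rewrite -mulN1r -csumZ//; apply: eq_csum => i; rewrite mulN1r.
Qed.

Lemma csmbN (I : choiceType) (f : I -> C) : csmb f -> csmb (fun i => - f i).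
Proof. by move=> sf; rewrite /csmb; under eq_nsum do rewrite normcN. Qed.

Lemma csumB (I : choiceType) (f g : I -> C) : csmb f -> csmb g ->
  csum (fun i => f i - g i) = csum f - csum g.
Proof. by move=> sf sg; rewrite csumD// ?csumN//; exact: csmbN. Qed.

(** Multiplying by the conjugate of the sum makes it real, which gives the
    triangle inequality with constant 1; bounding real and imaginary parts
    separately would lose a factor. *)
Lemma csum_le (I : choiceType) (f : I -> C) (A : R) :
  (nsum (fun i => normc (f i)) <= A%:E)%E -> normc (csum f) <= A.
Proof.
move=> fA; have sf : csmb f by apply: le_lt_trans fA _; rewrite ltry.
have [z0|z0] := eqVneq (normc (csum f)) 0.
  by rewrite z0 -lee_fin (le_trans _ fA)// nsum_ge0// => i; exact: normc_ge0.
have zp : 0 < normc (csum f) by rewrite lt_neqAle eq_sym z0 normc_ge0.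
set z := csum f; pose w := conjc z.
have nw : normc w = normc z by rewrite /w; case: (z) => a b /=; rewrite sqrrN.
have e : complex.Re (w * z) = normc z ^+ 2.
  by rewrite cReM sqr_normcE /w; case: (z) => a b /=; ring.
rewrite -(ler_pM2l zp) -expr2 -e -/z -csumZ//=.
apply: (le_trans (ler_norm _)); apply: rsum_le.
apply: (@le_trans _ _ (nsum (fun i => normc z * normc (f i)))).
  by apply: le_nsum => i; rewrite -nw -Normc.normcM; exact: Re_le_normc.
rewrite nsumZ ?normc_ge0// ?EFinM; last by move=> i; exact: normc_ge0.
by apply: lee_wpmul2l => //; rewrite lee_fin normc_ge0.
Qed.

Lemma csum0 (I : choiceType) : csum (fun _ : I => 0) = 0 :> C.
Proof.
apply: Normc.eq0_normc; apply/eqP; rewrite eq_le normc_ge0 andbT.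
by apply: csum_le; rewrite Normc.normc0 nsum0.
Qed.

Lemma csum_reindex (I J : choiceType) (e : I -> J) (f : J -> C) :
  bijective e -> csum f = csum (f \o e).
Proof. by move=> be; rewrite /csum !(rsum_reindex _ be). Qed.

Lemma csum_swap (I J : choiceType) (f : I -> J -> C) (g : I -> R) :
  (forall i, (nsum (fun j => normc (f i j)) <= (g i)%:E)%E) -> (nsum g < +oo)%E ->
  csum (fun i => csum (f i)) = csum (fun j => csum (f^~ j)).
Proof.
move=> fg go; rewrite /csum; congr (_ +i* _) => /=.
  apply: (@rsum_swap _ _ _ g) => // i; apply: le_trans (fg i).
  by apply: le_nsum => j; exact: Re_le_normc.
apply: (@rsum_swap _ _ _ g) => // i; apply: le_trans (fg i).
by apply: le_nsum => j; exact: Im_le_normc.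
Qed.

Lemma csum_split (I : choiceType) (f : I -> C) (s : seq I) :
  csmb f -> uniq s -> csum f = \sum_(i <- s) f i + csum (off s f).
Proof.
have offE (g : C -> R) : g 0 = 0 ->
    (fun i => g (off s f i)) = off s (fun i => g (f i)).
  by move=> g0; apply/funext => i; rewrite /off; case: ifP.
move=> sf us; apply: complexP; rewrite ?cReD ?cImD ?cRe_sum ?cIm_sum /=.
  by rewrite (rsum_split (csmb_Re sf) us) offE.
by rewrite (rsum_split (csmb_Im sf) us) offE.
Qed.

Lemma csum_tail (I : choiceType) (f : I -> C) (e : R) : csmb f -> 0 < e ->
  exists2 s, uniq s & (nsum (fun i => normc (off s f i)) <= e%:E)%E.
Proof.
move=> sf e0; have [s us h] := nsum_tail (fun i => normc_ge0 (f i)) sf e0.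
exists s => //; apply: le_trans h; apply: le_nsum => i.
by rewrite /off; case: ifP; rewrite ?Normc.normc0.
Qed.

Lemma csum1 (I : choiceType) (f : I -> C) (i0 : I) :
  (forall i, i != i0 -> f i = 0) -> csum f = f i0.
Proof.
move=> h.
have e : off [:: i0] f = (fun=> 0).
  by apply/funext => i; rewrite /off inE; case: eqVneq => // /h.
rewrite (@csum_split _ f [:: i0])// ?big_seq1 ?e ?csum0 ?addr0//.
rewrite /csmb (@nsum_split _ _ [:: i0])//; last by move=> i; exact: normc_ge0.
rewrite (@eq_nsum _ _ (fun=> 0)); last first.
  by move=> i; rewrite /off inE; case: eqVneq => // /h ->; rewrite Normc.normc0.
by rewrite nsum0 adde0 ltry.
Qed.

End Sums.

(** * Weighted square-summable sequences *)
Section Spaces.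
Context {R : realType}.
Local Notation C := R[i].
Local Notation normc := Normc.normc.
Local Opaque nsum.

Definition jb (k : int) : R := 1 + k%:~R ^+ 2.
(** The square of the symbol of the Bessel potential of order [g]. *)
Definition wt (g : R) (k : int) : R := jb k `^ g.

Lemma jb_ge1 k : 1 <= jb k.
Proof. by rewrite /jb lerDl sqr_ge0. Qed.

Lemma jb_gt0 k : 0 < jb k.
Proof. exact: lt_le_trans ltr01 (jb_ge1 k). Qed.

Lemma wt_gt0 g k : 0 < wt g k.
Proof. exact: powR_gt0 (jb_gt0 k). Qed.

Lemma wt_ge0 g k : 0 <= wt g k.
Proof. exact: ltW (wt_gt0 g k). Qed.

Lemma wt_ge1 g k : 0 <= g -> 1 <= wt g k.
Proof. by move=> g0; rewrite -(powRr0 (jb k)) ler_powR ?jb_ge1. Qed.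

Lemma wtS g k : wt (g + 1) k = wt g k * jb k.
Proof.
by rewrite /wt powRD ?powRr1 ?(ltW (jb_gt0 k))// (gt_eqF (jb_gt0 k)) implybT.
Qed.

Lemma sum_uniq_le (f : nat -> R) (t : seq nat) (n : nat) :
  (forall i, 0 <= f i) -> uniq t -> (forall i, i \in t -> (i < n)%N) ->
  \sum_(i <- t) f i <= \sum_(0 <= i < n) f i.
Proof.
move=> f0 ut tn.
rewrite (@perm_big _ _ _ _ t [seq i <- iota 0 n | i \in t]); last first.
  apply: uniq_perm => //; first by rewrite filter_uniq ?iota_uniq.
  move=> i; rewrite mem_filter mem_iota /= add0n.
  by apply/idP/andP => [it|[]//]; split => //; exact: tn.
rewrite big_filter /index_iota subn0 big_mkcond; apply: ler_sum => i _.
by case: ifP.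
Qed.

(** Cauchy condensation: a dyadic block of the series is at most a term of a
    geometric series. *)
Lemma sum_powR_le (p : R) (N : nat) : 1 < p ->
  \sum_(1 <= n < 2 ^ N) (n%:R `^ p)^-1 <= (1 - 2 `^ (1 - p))^-1.
Proof.
move=> p1.
have q1 : 2 `^ (1 - p) < 1 :> R.
  rewrite /powR pnatr_eq0 /= expR_lt1 pmulr_llt0 ?subr_lt0//.
  by rewrite ln_gt0// ltr1n.
have q0 : 0 < 2 `^ (1 - p) :> R by exact: powR_gt0.
suff : \sum_(1 <= n < 2 ^ N) (n%:R `^ p)^-1 <= \sum_(j < N) (2 `^ (1 - p)) ^+ j.
  move=> h; apply: (le_trans h).
  have q2 : 0 < 1 - 2 `^ (1 - p) by rewrite subr_gt0.
  rewrite -(ler_pM2l q2) mulfV ?gt_eqF//.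
  rewrite -opprB mulNr -subrX1 opprB gerBl.
  by rewrite exprn_ge0// ltW.
elim: N => [|N ih]; first by rewrite expn0 big_geq// big_ord0.
rewrite (@big_cat_nat _ _ _ (2 ^ N))//=; last 2 first.
- by rewrite expn_gt0.
- by rewrite leq_exp2l.
rewrite big_ord_recr /= lerD//.
apply: (@le_trans _ _ (\sum_(2 ^ N <= n < 2 ^ N.+1) ((2 ^ N)%:R `^ p)^-1)).
  rewrite big_nat_cond [leRHS]big_nat_cond; apply: ler_sum => n /andP[/andP[h _] _].
  rewrite lef_pV2 ?posrE ?powR_gt0 ?ltr0n ?expn_gt0//; last first.
    by rewrite (leq_trans _ h)// expn_gt0.
  by apply: ge0_ler_powR; rewrite ?nnegrE ?ler_nat//; lra.
rewrite big_const_nat iter_addr_0 expnS mul2n -addnn addnK.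
rewrite powRB ?pnatr_eq0 ?implybT// powRr1// expr_div_n natrX.
have -> : (2 ^+ N) `^ p = (2 `^ p) ^+ N :> R.
  by rewrite -(powR_mulrn N (ler0n R 2)) -powRAC powR_mulrn ?powR_ge0.
by rewrite -[leLHS]mulr_natr natrX mulrC.
Qed.

Lemma nsum_nat_le (f : nat -> R) (B : R) : (forall i, 0 <= f i) ->
  (forall N, \sum_(0 <= n < 2 ^ N) f n <= B) -> (nsum f <= B%:E)%E.
Proof.
move=> f0 h; apply: nsum_le_seq => s us; rewrite lee_fin.
apply: le_trans (h (\max_(i <- s) i)%N); apply: sum_uniq_le => // i si.
apply: leq_ltn_trans (ltn_expl _ (isT : 1 < 2)%N).
by rewrite (big_rem i)//= leq_maxl.
Qed.

Lemma nsum_int_le (f : int -> R) (B : R) : (forall i, 0 <= f i) ->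
  (nsum (fun n => f (Posz n)) <= B%:E)%E -> (nsum (fun n => f (Negz n)) <= B%:E)%E ->
  (nsum f <= (2 * B)%:E)%E.
Proof.
move=> f0 hp hn; apply: nsum_le_seq => s us; rewrite lee_fin.
have H (g : nat -> int) (h : int -> nat) (P : pred int) : (forall k, P k -> g (h k) = k) ->
    (nsum (fun n => f (g n)) <= B%:E)%E -> \sum_(i <- s | P i) f i <= B.
  move=> hg gB; rewrite -lee_fin; apply: le_trans gB.
  rewrite -big_filter (eq_big_seq (fun i => f (g (h i)))); last first.
    by move=> i; rewrite mem_filter => /andP[/hg ->].
  rewrite -(big_map h xpredT (fun n => f (g n))).
  apply: (@seq_le_nsum _ _ (fun n => f (g n))) => //.
  rewrite map_inj_in_uniq ?filter_uniq// => x y.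
  by rewrite !mem_filter => /andP[/hg ex _] /andP[/hg ey _] e; rewrite -ex -ey e.
rewrite (bigID (fun k : int => 0 <= k)) /= mulr2n mulrDl !mul1r; apply: lerD.
  by apply: (H Posz absz) hp => -[].
by apply: (H Negz (fun k => absz (k + 1))) hn => -[|n]//= _; rewrite NegzE; lia.
Qed.

Definition Wsum (g : R) : R := fine (nsum (fun k => (wt g k)^-1)).

Lemma iwt_ge0 g k : 0 <= (wt g k)^-1.
Proof. by rewrite invr_ge0 wt_ge0. Qed.

Lemma nsum_iwt_lt (g : R) : 1 / 2 < g -> (nsum (fun k => (wt g k)^-1)%R < +oo)%E.
Proof.
move=> g2.
pose B : R := 1 + (1 - 2 `^ (1 - 2 * g))^-1.
apply: (@le_lt_trans _ _ (2 * B)%:E); last by rewrite ltry.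
have key (h : nat -> int) : (forall n, (n <= `|h n|)%N) ->
    (nsum (fun n => (wt g (h n))^-1)%R <= B%:E)%E.
  move=> hn; apply: nsum_nat_le => [i|N]; first exact: iwt_ge0.
  rewrite big_ltn ?expn_gt0//; apply: lerD.
    by rewrite invf_le1 ?wt_gt0// wt_ge1//; lra.
  apply: le_trans (sum_powR_le N _); last by lra.
  rewrite big_nat_cond [leRHS]big_nat_cond; apply: ler_sum => n /andP[/andP[n1 _] _].
  rewrite lef_pV2 ?posrE ?wt_gt0 ?powR_gt0 ?ltr0n//.
  rewrite powRrM powR_mulrn// /wt; apply: ge0_ler_powR; rewrite ?nnegrE ?sqr_ge0//.
  - by lra.
  - exact: ltW (jb_gt0 _).
  rewrite /jb -[_%:~R ^+ 2]real_normK ?num_real// -intr_norm -[`|h n|]abszE.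
  apply: (@le_trans _ _ ((`|h n|%N : int)%:~R ^+ 2)); last by rewrite lerDr.
  by rewrite lerXn2r ?nnegrE// -[_%:~R]/(_%:R) ?ler_nat.
by apply: nsum_int_le => [i||]; [exact: iwt_ge0|apply: key..] => n //=; rewrite ?NegzE; lia.
Qed.

Lemma Wsum_gt0 g : 1 / 2 < g -> 0 < Wsum g.
Proof.
move=> g2; rewrite -lte_fin /Wsum -nsum_fineK; last 2 first.
- exact: iwt_ge0.
- exact: nsum_iwt_lt.
apply: lt_le_trans (term_le_nsum 0 (iwt_ge0 g)).
by rewrite lte_fin invr_gt0 wt_gt0.
Qed.

Lemma jb_add k l : jb (k + l) <= 4 * Num.max (jb k) (jb l).
Proof.
have a := sqr_ge0 (k%:~R - l%:~R : R).
have b : jb k <= Num.max (jb k) (jb l) by rewrite le_max lexx.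
have c : jb l <= Num.max (jb k) (jb l) by rewrite le_max lexx orbT.
move: b c; rewrite /jb intrD; move: (Num.max _ _) => m; lra.
Qed.

Lemma wt_add g k l : 0 <= g -> wt g (k + l) <= 4 `^ g * (wt g k + wt g l).
Proof.
move=> g0; apply: (@le_trans _ _ ((4 * Num.max (jb k) (jb l)) `^ g)).
  apply: ge0_ler_powR; rewrite ?nnegrE ?jb_add ?(ltW (jb_gt0 _))// mulr_ge0//.
  by rewrite le_max (ltW (jb_gt0 k)).
rewrite powRM//; last by rewrite le_max (ltW (jb_gt0 k)).
rewrite ler_wpM2l ?powR_ge0// /Num.max; case: ifP => _.
  by rewrite lerDr wt_ge0.
by rewrite lerDl wt_ge0.
Qed.

Definition kap2 g : R := 4 `^ g * (2 * Wsum g).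
Definition kap g : R := Num.sqrt (kap2 g).

Lemma kap2_gt0 g : 1 / 2 < g -> 0 < kap2 g.
Proof. by move=> g2; rewrite mulr_gt0 ?powR_gt0// mulr_gt0// Wsum_gt0. Qed.

Lemma kap_gt0 g : 1 / 2 < g -> 0 < kap g.
Proof. by move=> g2; rewrite sqrtr_gt0 kap2_gt0. Qed.

Lemma bij_refl (x : int) : bijective (fun k : int => x - k).
Proof. by exists (fun k => x - k) => k; rewrite opprB addrC subrK. Qed.

(** By [wt_add] one of the two frequencies carries the weight of the sum, and the
    inverse weight of the other one is summable. *)
Lemma iwt_conv g xi : 1 / 2 < g ->
  (nsum (fun k => (wt g k)^-1 * (wt g (xi - k))^-1)%R <= (kap2 g / wt g xi)%:E)%E.
Proof.
move=> g2.
apply: (@le_trans _ _ (nsum (fun k => 4 `^ g / wt g xi * ((wt g k)^-1 + (wt g (xi - k))^-1))%R)).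
  apply: le_nsum => k.
  have := @wt_add g k (xi - k); rewrite addrC subrK => /(_ ltac:(lra)).
  move: (wt_gt0 g k) (wt_gt0 g (xi - k)) (wt_gt0 g xi).
  move: (wt g k) (wt g (xi - k)) (wt g xi) (4 `^ g) => a b c d a0 b0 c0 h.
  have -> : d / c * (a^-1 + b^-1) = (d * (a + b)) / (a * b * c).
    by field; rewrite !gt_eqF.
  rewrite ler_pdivlMr ?mulr_gt0//.
  have -> : a^-1 / b * (a * b * c) = c by field; rewrite !gt_eqF.
  exact: h.
rewrite nsumZ; last 2 first.
- by rewrite divr_ge0 ?powR_ge0 ?wt_ge0.
- by move=> k; rewrite addr_ge0 ?iwt_ge0.
have e : nsum (fun k => (wt g (xi - k))^-1) = nsum (fun k => (wt g k)^-1).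
  by rewrite [RHS](nsum_reindex _ (bij_refl xi)).
rewrite nsumD; last 2 first.
- by move=> k; exact: iwt_ge0.
- by move=> k; exact: iwt_ge0.
rewrite e (nsum_fineK (iwt_ge0 g) (nsum_iwt_lt g2)) -/(Wsum g) -EFinD -EFinM lee_fin.
by rewrite /kap2 le_eqVlt; apply/orP; left; apply/eqP; ring.
Qed.

(** The norm of [p] in the weighted space is at most [A]; positivity of [A] is
    included because these radii are multiplied and divided freely. *)
Definition rball (g : R) (p : int -> R) (A : R) :=
  0 < A /\ (nsum (fun k => wt g k * p k ^+ 2)%R <= (A ^+ 2)%:E)%E.

Definition rconv (p q : int -> R) (xi : int) : R :=
  fine (nsum (fun k => p k * q (xi - k))).

Lemma rball_le g p q A B : rball g q A -> (forall k, `|p k| <= `|q k|) -> A <= B -> rball g p B.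
Proof.
move=> [A0 qA] pq AB; split; first exact: lt_le_trans AB.
apply: (@le_trans _ _ (A ^+ 2)%:E); last first.
  by rewrite lee_fin lerXn2r// nnegrE ltW// (lt_le_trans A0).
apply: le_trans qA; apply: le_nsum => k; rewrite ler_wpM2l ?wt_ge0//.
by rewrite -real_normK ?num_real// -[leRHS]real_normK ?num_real// lerXn2r ?nnegrE.
Qed.

Lemma rballZ g p A c : 0 < c -> rball g p A -> rball g (fun k => c * p k) (c * A).
Proof.
move=> c0 [A0 pA]; split; first by rewrite mulr_gt0.
rewrite (@eq_nsum _ _ _ (fun k => c ^+ 2 * (wt g k * p k ^+ 2))); last by move=> k; ring.
rewrite nsumZ ?sqr_ge0//; last by move=> k; rewrite mulr_ge0 ?wt_ge0 ?sqr_ge0.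
have [r /andP[_ rA] ->] := nsum_fin (fun k => mulr_ge0 (wt_ge0 g k) (sqr_ge0 (p k))) pA.
by rewrite -EFinM lee_fin exprMn ler_wpM2l ?sqr_ge0.
Qed.

Lemma rballD g p q A B : rball g p A -> rball g q B -> rball g (fun k => p k + q k) (A + B).
Proof.
move=> [A0 pA] [B0 qB]; split; first by rewrite addr_gt0.
have BA : 0 <= 1 + B / A by rewrite addr_ge0// divr_ge0// ltW.
have AB : 0 <= 1 + A / B by rewrite addr_ge0// divr_ge0// ltW.
apply: (@le_trans _ _ (nsum (fun k => (1 + B / A) * (wt g k * p k ^+ 2) +
    (1 + A / B) * (wt g k * q k ^+ 2))%R)).
  apply: le_nsum => k.
  have -> : (1 + B / A) * (wt g k * p k ^+ 2) + (1 + A / B) * (wt g k * q k ^+ 2) =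
    wt g k * ((p k + q k) ^+ 2 + (B * p k - A * q k) ^+ 2 / (A * B)).
    by field; rewrite !gt_eqF.
  rewrite ler_wpM2l ?wt_ge0// lerDl divr_ge0 ?sqr_ge0// mulr_ge0// ltW//.
rewrite nsumD; last 2 first.
- by move=> k; rewrite mulr_ge0// mulr_ge0 ?wt_ge0 ?sqr_ge0.
- by move=> k; rewrite mulr_ge0// mulr_ge0 ?wt_ge0 ?sqr_ge0.
rewrite !nsumZ//; [|by move=> k; rewrite mulr_ge0 ?wt_ge0 ?sqr_ge0..].
apply: (@le_trans _ _ ((1 + B / A)%:E * (A ^+ 2)%:E + (1 + A / B)%:E * (B ^+ 2)%:E)%E).
  by apply: leeD; apply: lee_wpmul2l.
rewrite -!EFinM -EFinD lee_fin le_eqVlt; apply/orP; left; apply/eqP.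
by field; rewrite !gt_eqF.
Qed.

Lemma rball_term g p A k : 0 <= g -> rball g p A -> `|p k| <= A.
Proof.
move=> g0 [A0 pA].
rewrite -(@ler_pXn2r _ 2)// ?nnegrE// ?(ltW A0)// real_normK ?num_real//.
rewrite -lee_fin; apply: le_trans pA.
apply: le_trans (@term_le_nsum _ _ (fun k => wt g k * p k ^+ 2) k _); last first.
  by move=> i; rewrite mulr_ge0 ?wt_ge0 ?sqr_ge0.
by rewrite lee_fin ler_peMl ?sqr_ge0// wt_ge1.
Qed.

Lemma rball_sq g p A : 0 <= g -> rball g p A -> (nsum (fun k => p k ^+ 2)%R <= (A ^+ 2)%:E)%E.
Proof.
move=> g0 [A0 pA]; apply: le_trans pA; apply: le_nsum => k.
by rewrite ler_peMl ?sqr_ge0// wt_ge1.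
Qed.

Lemma rconv_lt g p q A B xi : 0 <= g -> (forall k, 0 <= p k) -> (forall k, 0 <= q k) ->
  rball g p A -> rball g q B ->
  (nsum (fun k => p k * q (xi - k))%R <= (A * B)%:E)%E.
Proof.
move=> g0 p0 q0 pA qB; apply: cauchy_schwarz_nsum => //; [by case: pA|by case: qB|..].
  exact: rball_sq pA.
by rewrite -(nsum_reindex (fun k => q k ^+ 2) (bij_refl xi)); exact: rball_sq qB.
Qed.

Lemma rconv_ge0 p q xi : (forall k, 0 <= p k) -> (forall k, 0 <= q k) -> 0 <= rconv p q xi.
Proof. by move=> p0 q0; apply: fine_nsum_ge0 => k; rewrite mulr_ge0. Qed.

(** The algebra property above 1/2. Cauchy-Schwarz splits the convolution into
    the convolution of inverse weights, bounded by [iwt_conv], and the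
    convolution of two summable sequences. *)
Lemma rball_rconv g p q A B : 1 / 2 < g -> (forall k, 0 <= p k) -> (forall k, 0 <= q k) ->
  rball g p A -> rball g q B -> rball g (rconv p q) (kap g * A * B).
Proof.
move=> g2 p0 q0 pA qB; have g0 : 0 <= g by lra.
have [A0 pA'] := pA; have [B0 qB'] := qB; have k0 := kap_gt0 g2.
split; first by rewrite !mulr_gt0.
pose al k := wt g k * p k ^+ 2; pose be k := wt g k * q k ^+ 2.
have al0 k : 0 <= al k by rewrite mulr_ge0 ?wt_ge0 ?sqr_ge0.
have be0 k : 0 <= be k by rewrite mulr_ge0 ?wt_ge0 ?sqr_ge0.
have [a /andP[a0 aA] Ea] := nsum_fin al0 pA'.
have [b /andP[b0 bB] Eb] := nsum_fin be0 qB'.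
have Sfin xi : (nsum (fun k => al k * be (xi - k))%R < +oo)%E.
  apply: (@le_lt_trans _ _ (nsum (fun k => b * al k)%R)).
    apply: le_nsum => k; rewrite mulrC ler_wpM2r// -lee_fin -Eb.
    exact: term_le_nsum.
  by rewrite nsumZ// Ea -EFinM ltry.
pose S xi := fine (nsum (fun k => al k * be (xi - k))).
have SE xi : nsum (fun k => al k * be (xi - k)) = (S xi)%:E.
  by rewrite -nsum_fineK// => k; rewrite mulr_ge0.
have S0 xi : 0 <= S xi by apply: fine_nsum_ge0 => k; rewrite mulr_ge0.
have key xi : wt g xi * rconv p q xi ^+ 2 <= kap2 g * S xi.
  apply/ler_addgt0Pr => e e0.
  pose Y2 := S xi + e / kap2 g.
  have Y20 : 0 < Y2 by rewrite ltr_wpDl// divr_gt0// kap2_gt0.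
  pose X2 := kap2 g / wt g xi.
  have X20 : 0 < X2 by rewrite divr_gt0 ?wt_gt0 ?kap2_gt0.
  have cs : (nsum (fun k => p k * q (xi - k))%R <= (Num.sqrt X2 * Num.sqrt Y2)%:E)%E.
    pose x k := Num.sqrt ((wt g k)^-1 * (wt g (xi - k))^-1).
    pose y k := Num.sqrt (al k * be (xi - k)).
    have x0 k : 0 <= (wt g k)^-1 * (wt g (xi - k))^-1 by rewrite mulr_ge0 ?iwt_ge0.
    have y0 k : 0 <= al k * be (xi - k) by rewrite mulr_ge0.
    rewrite (@eq_nsum _ _ _ (fun k => x k * y k)); last first.
      move=> k; rewrite /x /y -sqrtrM// /al /be.
      have -> : (wt g k)^-1 / wt g (xi - k) *
          (wt g k * p k ^+ 2 * (wt g (xi - k) * q (xi - k) ^+ 2)) =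
          (p k * q (xi - k)) ^+ 2 by field; rewrite !gt_eqF ?wt_gt0.
      by rewrite sqrtr_sqr ger0_norm// mulr_ge0.
    apply: cauchy_schwarz_nsum; rewrite ?sqrtr_gt0//.
    - by move=> k; exact: sqrtr_ge0.
    - by move=> k; exact: sqrtr_ge0.
    - rewrite sqr_sqrtr ?(ltW X20)//; under eq_nsum do rewrite sqr_sqrtr//.
      exact: iwt_conv.
    - rewrite sqr_sqrtr ?(ltW Y20)//; under eq_nsum do rewrite sqr_sqrtr//.
      by rewrite SE lee_fin lerDl divr_ge0// ltW// kap2_gt0.
  have c0 : 0 <= rconv p q xi by exact: rconv_ge0.
  have : rconv p q xi <= Num.sqrt X2 * Num.sqrt Y2.
    rewrite -lee_fin /rconv -nsum_fineK//; first by move=> k; rewrite mulr_ge0.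
    by apply: le_lt_trans cs _; rewrite ltry.
  have rhs0 : 0 <= Num.sqrt X2 * Num.sqrt Y2 by rewrite mulr_ge0 ?sqrtr_ge0.
  rewrite -(@ler_pXn2r _ 2)// exprMn (sqr_sqrtr (ltW X20)) (sqr_sqrtr (ltW Y20)) => h.
  apply: (@le_trans _ _ (wt g xi * (X2 * Y2))); first by rewrite ler_wpM2l ?wt_ge0.
  rewrite le_eqVlt; apply/orP; left; apply/eqP.
  by rewrite /X2 /Y2; field; rewrite !gt_eqF ?wt_gt0 ?kap2_gt0.
apply: (@le_trans _ _ (nsum (fun xi => kap2 g * S xi)%R)).
  by apply: le_nsum => xi; exact: key.
rewrite nsumZ ?(ltW (kap2_gt0 g2))//.
rewrite (_ : nsum S = (a * b)%:E); last first.
  rewrite -(@nsum_swap _ _ _ (fun k xi => al k * be (xi - k)) (fun k => b * al k) S) //.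
  - by rewrite nsumZ// Ea -EFinM mulrC.
  - by move=> k xi; rewrite mulr_ge0.
  - move=> k; rewrite nsumZ// -(nsum_reindex be (e := fun xi => xi - k)).
      by rewrite Eb -EFinM mulrC.
    by exists (fun xi => xi + k) => xi; rewrite ?subrK ?addrK.
rewrite -EFinM lee_fin !exprMn /kap sqr_sqrtr ?(ltW (kap2_gt0 g2))// -mulrA.
by rewrite ler_wpM2l ?(ltW (kap2_gt0 g2))// ler_pM.
Qed.

End Spaces.

(** * Double and triple convolutions *)
Section Convolution.
Context {R : realType}.
Local Notation C := R[i].
Local Notation normc := Normc.normc.
Local Opaque nsum.

Definition hball (g : R) (a : int -> C) (A : R) := rball g (fun k => normc (a k)) A.

Lemma hball_dom g (a b : int -> C) A c : 0 < c ->
  (forall k, normc (b k) <= c * normc (a k)) -> hball g a A -> hball g b (c * A).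
Proof.
move=> c0 ba /(rballZ c0) h; apply: (rball_le h) => // k.
by rewrite !ger0_norm ?normc_ge0// mulr_ge0 ?normc_ge0// ltW.
Qed.

Lemma hball_le g (a b : int -> C) A B :
  hball g a A -> (forall k, normc (b k) <= normc (a k)) -> A <= B -> hball g b B.
Proof. by move=> ha ba AB; apply: (rball_le ha) => // k; rewrite !ger0_norm ?normc_ge0. Qed.

Lemma hball_ext g (a b : int -> C) A : a =1 b -> hball g a A -> hball g b A.
Proof. by move=> /funext ->. Qed.

Lemma hball_gt0 g (a : int -> C) A : hball g a A -> 0 < A.
Proof. by case. Qed.

Lemma hballD g (a b : int -> C) A B :
  hball g a A -> hball g b B -> hball g (fun k => a k + b k) (A + B).
Proof.
move=> ha hb'; apply: (rball_le (rballD ha hb')) => // k.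
by rewrite !ger0_norm ?addr_ge0 ?normc_ge0// le_normcD.
Qed.

Lemma hballN g (a : int -> C) A : hball g a A -> hball g (fun k => - a k) A.
Proof. by move=> ha; apply: (hball_le ha) => // k; rewrite normcN. Qed.

Lemma hballB g (a b : int -> C) A B :
  hball g a A -> hball g b B -> hball g (fun k => a k - b k) (A + B).
Proof. by move=> ha hb'; apply: hballD => //; exact: hballN. Qed.

Lemma hball0 g A : 0 < A -> hball g (fun=> 0) A.
Proof.
move=> A0; split => //; rewrite (@eq_nsum _ _ _ (fun=> 0)).
  by rewrite nsum0 lee_fin sqr_ge0.
by move=> k; rewrite Normc.normc0 expr0n mulr0.
Qed.

Lemma hball_term g (a : int -> C) A k : 0 <= g -> hball g a A -> normc (a k) <= A.
Proof. by move=> g0 /(rball_term k g0); rewrite ger0_norm ?normc_ge0. Qed.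

(** The argument [f] depends on both frequencies, so that symbols which do not
    factor are covered. *)
Definition conv2 (f : int -> int -> C) (xi : int) : C := csum (fun k => f k (xi - k)).

Definition conv3 (f : int -> int -> int -> C) (xi : int) : C :=
  conv2 (fun j n => conv2 (fun k l => f k l n) j) xi.

Lemma eq_conv2 f f' xi : (forall k l, f k l = f' k l) -> conv2 f xi = conv2 f' xi.
Proof. by move=> h; apply: eq_csum => k. Qed.

Lemma eq_conv2_sum f f' xi : (forall k l, k + l = xi -> f k l = f' k l) -> conv2 f xi = conv2 f' xi.
Proof. by move=> h; apply: eq_csum => k; rewrite h// addrC subrK. Qed.

Lemma eq_conv3 f f' xi : (forall k l n, f k l n = f' k l n) -> conv3 f xi = conv3 f' xi.
Proof. by move=> h; apply: eq_conv2 => j n; apply: eq_conv2. Qed.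

Lemma eq_conv3_sum f f' xi : (forall k l n, k + l + n = xi -> f k l n = f' k l n) ->
  conv3 f xi = conv3 f' xi.
Proof. by move=> h; apply: eq_conv2_sum => j n e; apply: eq_conv2_sum => k l e'; apply: h; rewrite e'. Qed.

Definition maj (g : R) (p : int -> R) := (forall k, 0 <= p k) /\ exists A, rball g p A.

(** Domination by a product of two sequences in the weighted space: all the
    summability that rearranging a double or triple sum requires. *)
Definition maj2 (g : R) (f : int -> int -> C) :=
  exists p q, [/\ maj g p, maj g q & forall k l, normc (f k l) <= p k * q l].

Definition maj3 (g : R) (f : int -> int -> int -> C) :=
  exists p q r, [/\ maj g p, maj g q, maj g r & forall k l n, normc (f k l n) <= p k * q l * r n].

Lemma maj_hball g a A c : 0 < c -> hball g a A -> maj g (fun k => c * normc (a k)).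
Proof.
move=> c0 ha; split => [k|]; first by rewrite mulr_ge0 ?normc_ge0// ltW.
by exists (c * A); exact: rballZ.
Qed.

Lemma maj2_hball g (a b : int -> C) A B c f : 0 <= c -> hball g a A -> hball g b B ->
  (forall k l, normc (f k l) <= c * (normc (a k) * normc (b l))) -> maj2 g f.
Proof.
move=> c0 ha hb' h; exists (fun k => (c + 1) * normc (a k)), (fun k => 1 * normc (b k)).
split; [apply: maj_hball ha; lra|exact: maj_hball hb'|].
move=> k l; apply: (le_trans (h k l)); rewrite mul1r -mulrA ler_wpM2r//; last lra.
by rewrite mulr_ge0 ?normc_ge0.
Qed.

Lemma maj3_hball g (a b d : int -> C) A B D c f : 0 <= c -> hball g a A -> hball g b B -> hball g d D ->
  (forall k l n, normc (f k l n) <= c * (normc (a k) * normc (b l) * normc (d n))) -> maj3 g f.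
Proof.
move=> c0 ha hb' hd h.
exists (fun k => (c + 1) * normc (a k)), (fun k => 1 * normc (b k)), (fun k => 1 * normc (d k)).
split; [apply: maj_hball ha; lra|exact: maj_hball hb'|exact: maj_hball hd|].
move=> k l n; apply: (le_trans (h k l n)); rewrite !mul1r -!mulrA ler_wpM2r//; last lra.
by rewrite !mulr_ge0 ?normc_ge0.
Qed.

Lemma majD g p q : maj g p -> maj g q -> maj g (fun k => p k + q k).
Proof.
move=> [p0 [A pA]] [q0 [B qB]]; split; first by move=> k; rewrite addr_ge0.
by exists (A + B); exact: rballD.
Qed.

Lemma maj2D g f f' : maj2 g f -> maj2 g f' -> maj2 g (fun k l => f k l + f' k l).
Proof.
move=> [p [q [mp mq h]]] [p' [q' [mp' mq' h']]].
exists (fun k => p k + p' k), (fun k => q k + q' k); split; [exact: majD|exact: majD|].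
move=> k l; apply: (le_trans (le_normcD _ _)); apply: (le_trans (lerD (h k l) (h' k l))).
rewrite mulrDl !mulrDr -addrA lerD2l addrA lerDr addr_ge0// mulr_ge0//.
- exact: mp.1.
- exact: mq'.1.
- exact: mp'.1.
- exact: mq.1.
Qed.

Lemma majZ g c p : 0 < c -> maj g p -> maj g (fun k => c * p k).
Proof.
move=> c0 [p0 [A pA]]; split; first by move=> k; rewrite mulr_ge0// ltW.
by exists (c * A); exact: rballZ.
Qed.

Lemma maj3_dom g c f f' : 0 < c ->
  (forall k l n, normc (f' k l n) <= c * normc (f k l n)) -> maj3 g f -> maj3 g f'.
Proof.
move=> c0 ff [p [q [r [mp mq mr h]]]].
exists (fun k => c * p k), q, r; split => //; first exact: majZ.
move=> k l n; apply: (le_trans (ff k l n)); rewrite -!mulrA ler_wpM2l ?(ltW c0)//.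
by rewrite mulrA; exact: h.
Qed.

Lemma maj3D g f f' : maj3 g f -> maj3 g f' -> maj3 g (fun k l n => f k l n + f' k l n).
Proof.
move=> [p [q [r [mp mq mr h]]]] [p' [q' [r' [mp' mq' mr' h']]]].
exists (fun k => p k + p' k), (fun k => q k + q' k), (fun k => r k + r' k).
split; [exact: majD|exact: majD|exact: majD|].
move=> k l n; apply: (le_trans (le_normcD _ _)); apply: (le_trans (lerD (h k l n) (h' k l n))).
move: (mp.1 k) (mq.1 l) (mr.1 n) (mp'.1 k) (mq'.1 l) (mr'.1 n).
move: (p k) (q l) (r n) (p' k) (q' l) (r' n) => a b c a' b' c' *.
rewrite -subr_ge0.
have -> : (a + a') * (b + b') * (c + c') - (a * b * c + a' * b' * c') =
  a * b * c' + a * b' * c + a * b' * c' + a' * b * c + a' * b * c' + a' * b' * c by ring.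
by do ?[apply: addr_ge0 | apply: mulr_ge0].
Qed.

Section Fix.
Variable g : R.
Hypothesis g2 : 1 / 2 < g.

Let g0 : 0 <= g. Proof. by move: g2; lra. Qed.

Lemma rconv_E p q xi : maj g p -> maj g q ->
  nsum (fun k => p k * q (xi - k)) = (rconv p q xi)%:E.
Proof.
move=> [p0 [A pA]] [q0 [B qB]]; rewrite -nsum_fineK//.
  by move=> k; rewrite mulr_ge0.
by apply: le_lt_trans (rconv_lt xi g0 p0 q0 pA qB) _; rewrite ltry.
Qed.

Lemma conv2_nsum p q f (xi : int) : maj g p -> maj g q -> (forall k l, normc (f k l) <= p k * q l) ->
  (nsum (fun k => normc (f k (xi - k)))%R <= (rconv p q xi)%:E)%E.
Proof. by move=> mp mq h; rewrite -rconv_E//; apply: le_nsum. Qed.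

Lemma conv2_csmb f xi : maj2 g f -> csmb (fun k => f k (xi - k)).
Proof.
by move=> [p [q [mp mq h]]]; apply: le_lt_trans (conv2_nsum xi mp mq h) _; rewrite ltry.
Qed.

Lemma conv2_le p q f (xi : int) : maj g p -> maj g q -> (forall k l, normc (f k l) <= p k * q l) ->
  normc (conv2 f xi) <= rconv p q xi.
Proof. by move=> mp mq h; apply: csum_le; exact: conv2_nsum. Qed.

Lemma maj_rconv p q : maj g p -> maj g q -> maj g (rconv p q).
Proof.
move=> [p0 [A pA]] [q0 [B qB]]; split; first by move=> k; exact: rconv_ge0.
by exists (kap g * A * B); exact: rball_rconv.
Qed.

Lemma conv2_hball (a b : int -> C) A B c f : 0 < c -> hball g a A -> hball g b B ->
  (forall k l, normc (f k l) <= c * (normc (a k) * normc (b l))) ->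
  hball g (conv2 f) (c * (kap g * A * B)).
Proof.
move=> c0 ha hb' h.
have ma := maj_hball c0 ha; have mb := maj_hball ltr01 hb'.
have := rball_rconv g2 ma.1 mb.1 (rballZ c0 ha) (rballZ ltr01 hb') => hc.
apply: (rball_le hc) => [k|]; last by rewrite mul1r; lra.
rewrite !ger0_norm ?normc_ge0 ?(rconv_ge0 _ ma.1 mb.1)//; apply: conv2_le => // i j.
by rewrite mul1r -mulrA.
Qed.

Lemma conv2D f f' xi : maj2 g f -> maj2 g f' ->
  conv2 (fun k l => f k l + f' k l) xi = conv2 f xi + conv2 f' xi.
Proof. by move=> mf mf'; rewrite /conv2 csumD//; apply: conv2_csmb. Qed.

Lemma conv2B f f' xi : maj2 g f -> maj2 g f' ->
  conv2 (fun k l => f k l - f' k l) xi = conv2 f xi - conv2 f' xi.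
Proof. by move=> mf mf'; rewrite /conv2 csumB//; apply: conv2_csmb. Qed.

Lemma conv2Z f c xi : maj2 g f -> conv2 (fun k l => c * f k l) xi = c * conv2 f xi.
Proof. by move=> mf; rewrite /conv2 csumZ//; apply: conv2_csmb. Qed.

(** A symbol that depends only on the output frequency can be moved in and out of
    a convolution. *)
Lemma conv2_diag (h : int -> C) f xi : maj2 g f ->
  conv2 (fun k l => h (k + l) * f k l) xi = h xi * conv2 f xi.
Proof. by move=> mf; rewrite -conv2Z//; apply: eq_conv2_sum => k l ->. Qed.

Lemma conv2_sym f xi : conv2 f xi = conv2 (fun k l => f l k) xi.
Proof.
rewrite /conv2 (csum_reindex _ (bij_refl xi)); apply: eq_csum => k /=.
by rewrite opprB addrCA subrr addr0.
Qed.

Lemma maj3_inner f n : maj3 g f -> maj2 g (fun k l => f k l n).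
Proof.
move=> [p [q [r [mp mq mr h]]]]; have [p0 [A pA]] := mp; have [r0 _] := mr.
exists (fun k => (r n + 1) * p k), q; split => //.
  split => [k|]; first by rewrite mulr_ge0// addr_ge0.
  by exists ((r n + 1) * A); apply: rballZ => //; rewrite ltr_wpDl.
move=> k l; apply: (le_trans (h k l n)).
rewrite [leLHS]mulrC -[leRHS]mulrA ler_wpM2r ?mulr_ge0//; first exact: mq.1.
by rewrite lerDl.
Qed.

Lemma conv2_inner p q r f (j n : int) : maj g p -> maj g q -> maj g r ->
  (forall k l n, normc (f k l n) <= p k * q l * r n) ->
  (nsum (fun k => normc (f k (j - k) n))%R <= (rconv p q j * r n)%:E)%E.
Proof.
move=> mp mq mr h; rewrite mulrC EFinM -rconv_E// -nsumZ ?mr.1//; last first.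
  by move=> k; rewrite mulr_ge0 ?mp.1 ?mq.1.
by apply: le_nsum => k; rewrite mulrC.
Qed.

Lemma maj3_outer f : maj3 g f -> maj2 g (fun j n => conv2 (fun k l => f k l n) j).
Proof.
move=> [p [q [r [mp mq mr h]]]]; exists (rconv p q), r; split => //.
  exact: maj_rconv.
by move=> k l; apply: csum_le; exact: conv2_inner.
Qed.

Lemma conv3_hball (a b d : int -> C) A B D c f : 0 < c -> hball g a A -> hball g b B -> hball g d D ->
  (forall k l n, normc (f k l n) <= c * (normc (a k) * normc (b l) * normc (d n))) ->
  hball g (conv3 f) (c * (kap g * (kap g * A * B) * D)).
Proof.
move=> c0 ha hb' hd h.
have ma := maj_hball ltr01 ha; have mb := maj_hball ltr01 hb'; have md := maj_hball c0 hd.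
have hab := rball_rconv g2 ma.1 mb.1 (rballZ ltr01 ha) (rballZ ltr01 hb').
have mab := maj_rconv ma mb.
have := rball_rconv g2 mab.1 md.1 hab (rballZ c0 hd) => hc.
apply: (rball_le hc) => [k|]; last by rewrite !mul1r; lra.
rewrite !ger0_norm ?normc_ge0 ?(rconv_ge0 _ mab.1 md.1)//; apply: conv2_le => // i j.
apply: csum_le; apply: (@conv2_inner _ _ _ f i j ma mb md) => k1 l1 n1.
by apply: (le_trans (h _ _ _)); rewrite !mul1r mulrCA.
Qed.

Lemma conv3D f f' xi : maj3 g f -> maj3 g f' ->
  conv3 (fun k l n => f k l n + f' k l n) xi = conv3 f xi + conv3 f' xi.
Proof.
move=> mf mf'; rewrite /conv3 -conv2D; [|exact: maj3_outer..].
by apply: eq_conv2 => j n; rewrite conv2D//; exact: maj3_inner.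
Qed.

Lemma conv3B f f' xi : maj3 g f -> maj3 g f' ->
  conv3 (fun k l n => f k l n - f' k l n) xi = conv3 f xi - conv3 f' xi.
Proof.
move=> mf mf'; rewrite /conv3 -conv2B; [|exact: maj3_outer..].
by apply: eq_conv2 => j n; rewrite conv2B//; exact: maj3_inner.
Qed.

Lemma conv3Z f c xi : maj3 g f -> conv3 (fun k l n => c * f k l n) xi = c * conv3 f xi.
Proof.
move=> mf; rewrite /conv3 -conv2Z; last exact: maj3_outer.
by apply: eq_conv2 => j n; rewrite conv2Z//; exact: maj3_inner.
Qed.

Lemma conv3_diag (h : int -> C) f xi : maj3 g f ->
  conv3 (fun k l n => h (k + l + n) * f k l n) xi = h xi * conv3 f xi.
Proof. by move=> mf; rewrite -conv3Z//; apply: eq_conv3_sum => k l n ->. Qed.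

Lemma conv3_sym12 f xi : conv3 f xi = conv3 (fun k l n => f l k n) xi.
Proof. by apply: eq_conv2 => j n; exact: conv2_sym. Qed.

Lemma conv3_swap f xi : maj3 g f ->
  conv3 f xi = csum (fun k => csum (fun j => f k (j - k) (xi - j))).
Proof.
move=> [p [q [r [mp mq mr h]]]].
apply: (@csum_swap _ _ _ (fun j k => f k (j - k) (xi - j)) (fun j => rconv p q j * r (xi - j))).
  by move=> j; exact: conv2_inner.
by rewrite rconv_E ?ltry//; exact: maj_rconv.
Qed.

(** The triple sum is defined by nesting, which hides this symmetry; Fubini
    recovers it. *)
Lemma conv3_sym23 f xi : maj3 g f -> conv3 f xi = conv3 (fun k l n => f k n l) xi.
Proof.
move=> mf; have mf' : maj3 g (fun k l n => f k n l).
  move: mf => [p [q [r [mp mq mr h]]]]; exists p, r, q; split => // k l n.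
  by rewrite mulrAC.
rewrite !conv3_swap//; apply: eq_csum => k.
have be : bijective (fun j : int => k + xi - j).
  by exists (fun j : int => k + xi - j) => j; lia.
rewrite (csum_reindex _ be); apply: eq_csum => j /=.
by congr f; lia.
Qed.

End Fix.
End Convolution.

(** * The scheme on Fourier coefficients and its stability *)
Section Scheme.
Context {R : realType}.
Local Notation C := R[i].
Local Notation normc := Normc.normc.
Local Opaque nsum.
Implicit Types (k l n xi : int) (t : R) (a b w : int -> C).

Lemma expiD (x y : R) : expi (x + y) = expi x * expi y.
Proof. by apply: complexP; rewrite ?cReM ?cImM /= ?cosD ?sinD//; ring. Qed.

Lemma expi0 : expi (0 : R) = 1.
Proof. by rewrite /expi cos0 sin0. Qed.

Lemma normc_expi (x : R) : normc (expi x) = 1.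
Proof. by rewrite /= cos2Dsin2 sqrtr1. Qed.

Lemma sin_le_abs (x : R) : `|sin x| <= `|x|.
Proof.
wlog x0 : x / 0 < x => [h|].
  have [x0|x0|->] := ltgtP x 0; last by rewrite sin0 !normr0.
    by have := h (- x); rewrite oppr_gt0 sinN !normrN; apply.
  exact: h.
have [c _] := @MVT R sin cos 0 x x0 (fun y _ => is_derive_sin y)
  (continuous_subspaceT (@continuous_sin R)).
rewrite sin0 !subr0 => ->; rewrite normrM ler_piMl//.
by rewrite ler_norml cos_geN1 cos_le1.
Qed.

(** The chord is shorter than the arc. *)
Lemma expi_sub1 (x : R) : normc (expi x - 1) <= `|x|.
Proof.
rewrite -(@ler_pXn2r _ 2)// ?nnegrE ?normc_ge0// sqr_normcE /= subr0 real_normK ?num_real//.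
have -> : x = (x / 2) *+ 2 by rewrite -mulr_natr; field.
set y := x / 2; have : sin y ^+ 2 <= y ^+ 2.
  by rewrite -[leLHS]real_normK ?num_real// -[leRHS]real_normK ?num_real// lerXn2r ?nnegrE// sin_le_abs.
rewrite cos_mulr2n sin_mulr2n.
have := sin2cos2 y; rewrite !mulr2n; move: (cos y) (sin y) => c s e h.
have -> : (c ^+ 2 + c ^+ 2 - 1 - 1) ^+ 2 + (c * s + c * s) ^+ 2 = 4 * s ^+ 2.
  have ec : c ^+ 2 = 1 - s ^+ 2 by rewrite e; ring.
  have -> : (c * s + c * s) ^+ 2 = 4 * c ^+ 2 * s ^+ 2 by ring.
  by rewrite ec; ring.
by rewrite (_ : (y + y) ^+ 2 = 4 * y ^+ 2); [lra|ring].
Qed.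

Lemma expi_sub (x y : R) : normc (expi x - expi y) <= `|x - y|.
Proof.
have -> : expi x - expi y = expi y * (expi (x - y) - 1).
  by rewrite mulrBr mulr1 -expiD addrCA subrr addr0.
by rewrite Normc.normcM normc_expi mul1r expi_sub1.
Qed.

(** The symbol of the inverse derivative. *)
Definition iz (k : int) : C := if k == 0 then 0 else (0 +i* k%:~R)^-1.

Lemma normc_iz k : normc (iz k) = `|k%:~R : R|^-1.
Proof.
rewrite /iz; have [->|k0] := eqVneq k 0; first by rewrite Normc.normc0 normr0 invr0.
by rewrite Normc.normcV /= expr0n /= add0r sqrtr_sqr.
Qed.

Lemma absint_inv k : `|k%:~R : R|^-1 <= 1.
Proof.
have [->|k0] := eqVneq k 0; first by rewrite normr0 invr0.
rewrite invf_le1 ?normr_gt0 ?intr_eq0// -intr_norm.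
by rewrite -[1]/(1%:~R) ler_int; lia.
Qed.

Lemma normc_iz_le1 k : normc (iz k) <= 1.
Proof. by rewrite normc_iz absint_inv. Qed.

Lemma invM_le1 (u : R) : 0 <= u -> u^-1 * u <= 1.
Proof.
by move=> u0; have [->|h] := eqVneq u 0; [rewrite mulr0|rewrite mulVf].
Qed.

Lemma mul3_le1 (x y u : R) : 0 <= x <= 1 -> 0 <= y <= 1 -> 0 <= u <= 1 ->
  x * y * u <= 1.
Proof.
by move=> /andP[? ?] /andP[? ?] /andP[? ?]; do ?[apply: mulr_ile1|apply: mulr_ge0].
Qed.

Lemma invM_ge0 (u : R) : 0 <= u -> 0 <= u^-1 * u.
Proof. by move=> u0; rewrite mulr_ge0 ?invr_ge0. Qed.

(** The interaction phase of two frequencies: (k + l)^3 - k^3 - l^3 is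
    3 k l (k + l). *)
Definition phase2 t k l : C := expi (- (t * (3 * ((k + l)%:~R * k%:~R * l%:~R)))).
(** The interaction phase of three frequencies: the cube of the sum minus the sum
    of the cubes is 3 (k + l) (l + n) (n + k). *)
Definition phase3 t k l n : C :=
  expi (- (t * (3 * ((k + l)%:~R * (l + n)%:~R * (n + k)%:~R)))).

Lemma normc_phase2 t k l : normc (phase2 t k l) = 1.
Proof. exact: normc_expi. Qed.

Lemma phase2_0 k l : phase2 0 k l = 1.
Proof. by rewrite /phase2 mul0r oppr0 expi0. Qed.

Lemma normc_inv_nat (m : nat) : normc (m.+1%:R^-1 : C) = m.+1%:R^-1.
Proof.
rewrite Normc.normcV; congr (_^-1).
by rewrite -[m.+1%:R in LHS](rmorph_nat (real_complex R)) normcR ger0_norm.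
Qed.

Lemma phase2_sub1 t k l : 0 <= t ->
  normc (phase2 t k l - 1) <= t * 3 * (`|(k + l)%:~R| * `|k%:~R| * `|l%:~R|).
Proof.
move=> t0; apply: (le_trans (expi_sub1 _)).
by rewrite normrN !normrM (ger0_norm t0) (ger0_norm (ler0n R 3)) !mulrA.
Qed.

Lemma mult_Dquad_aux (t x y u e : R) : 0 <= t -> 0 <= x -> 0 <= y -> 0 <= u ->
  e <= t * 3 * (x * y * u) -> x^-1 * (6^-1 * e * (y^-1 * u^-1)) <= t / 2.
Proof.
move=> t0 x0 y0 u0 h.
apply: (@le_trans _ _ (x^-1 * (6^-1 * (t * 3 * (x * y * u)) * (y^-1 / u)))).
  by rewrite ler_wpM2l ?invr_ge0// ler_wpM2r ?mulr_ge0 ?invr_ge0// ler_wpM2l.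
have -> : x^-1 * (6^-1 * (t * 3 * (x * y * u)) * (y^-1 / u)) =
  t / 2 * ((x^-1 * x) * (y^-1 * y) * (u^-1 * u)).
  by move: (x^-1) (y^-1) (u^-1) => a b c; field.
by rewrite ler_piMr ?divr_ge0// mul3_le1 ?invM_ge0 ?invM_le1.
Qed.

(** The phase contributes at most a constant times t (k + l) k l, and each of the
    three factors is cancelled by an inverse derivative. *)
Lemma mult_Dquad t k l : 0 <= t ->
  normc (iz (k + l) * (6^-1 * (phase2 t k l - 1) * (iz k * iz l))) <= t / 2.
Proof.
move=> t0; rewrite !Normc.normcM !normc_iz (normc_inv_nat 5).
exact: mult_Dquad_aux (phase2_sub1 k l t0).
Qed.

Definition lo (K : R) k : C := if `|k%:~R| <= K then 1 else 0.
Definition hi (K : R) k : C := if `|k%:~R| <= K then 0 else 1.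

Lemma lo_hi K k : lo K k + hi K k = 1.
Proof. by rewrite /lo /hi; case: ifP; rewrite ?addr0 ?add0r. Qed.

Lemma normc_hi K k : normc (hi K k) <= 1.
Proof. by rewrite /hi; case: ifP => _; rewrite ?Normc.normc1 ?Normc.normc0. Qed.

(** The output frequency is at most [K], which replaces the missing inverse
    derivative. *)
Lemma mult_lo_quad K t k l : 0 <= t -> 0 <= K ->
  normc (lo K (k + l) * (6^-1 * (phase2 t k l - 1) * (iz k * iz l))) <= t * K / 2.
Proof.
move=> t0 K0; rewrite /lo; case: ifP => [h|_]; last first.
  by rewrite mul0r Normc.normc0 divr_ge0// mulr_ge0.
rewrite mul1r !Normc.normcM !normc_iz (normc_inv_nat 5).
move: h (phase2_sub1 k l t0).
move: (normr_ge0 ((k + l)%:~R : R)) (normr_ge0 (k%:~R : R)) (normr_ge0 (l%:~R : R)).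
move: (normc (phase2 t k l - 1)) `|(k + l)%:~R| `|k%:~R| `|l%:~R| => e x y u x0 y0 u0 xK h.
apply: (@le_trans _ _ (6^-1 * (t * 3 * (K * y * u)) * (y^-1 / u))).
  rewrite ler_wpM2r ?mulr_ge0 ?invr_ge0// ler_wpM2l//.
  by apply: (le_trans h); rewrite ler_wpM2l ?mulr_ge0// ler_wpM2r// ler_wpM2r.
have -> : 6^-1 * (t * 3 * (K * y * u)) * (y^-1 / u) = t * K / 2 * ((y^-1 * y) * (u^-1 * u)).
  by move: (y^-1) (u^-1) => b c; field.
by rewrite ler_piMr ?divr_ge0 ?mulr_ge0// mulr_ile1 ?invM_ge0 ?invM_le1.
Qed.

(** One of the two input frequencies is at least half the output frequency. *)
Lemma mult_hi (K : R) k l : 1 <= K ->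
  normc (hi K (k + l) * (iz k * iz l)) <= 2 / K.
Proof.
move=> K1; have K0 : 0 < K by exact: lt_le_trans K1.
have rhs0 : 0 <= 2 / K by rewrite divr_ge0// ltW.
rewrite /hi; case: ifPn => [_|]; first by rewrite mul0r Normc.normc0.
rewrite -ltNge => h; rewrite mul1r; have [->|k0] := eqVneq k 0; first by rewrite /iz eqxx mul0r Normc.normc0.
have [->|l0] := eqVneq l 0; first by rewrite {2}/iz eqxx mulr0 Normc.normc0.
rewrite Normc.normcM !normc_iz -invfM.
have ge1 (j : int) : j != 0 -> 1 <= `|j%:~R : R|.
  by move=> j0; rewrite -intr_norm -[1]/(1%:~R) ler_int; lia.
have := ge1 _ k0; have := ge1 _ l0.
have : `|(k + l)%:~R : R| <= `|k%:~R| + `|l%:~R| by rewrite intrD ler_normD.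
move: h; move: (`|(k + l)%:~R : R|) (`|k%:~R : R|) (`|l%:~R : R|) => x y u h1 h2 u1 y1.
have -> : 2 / K = (K / 2)^-1 by rewrite invfM invrK mulrC.
rewrite lef_pV2 ?posrE ?divr_gt0 ?mulr_gt0//; [|lra..].
have : y + u <= 2 * (y * u) by nra.
lra.
Qed.

(** With x = k + l + n, the product (k + l) (l + n) (n + k) equals
    x (k l + l n + n k) - k l n, and the four inverse frequencies control each of
    the four monomials. *)
Lemma mult_bdry t' k l n :
  normc (iz (k + l + n) * (phase3 t' k l n - 1) * (iz k * iz l * iz n)) <= 12 * `|t'|.
Proof.
rewrite !Normc.normcM !normc_iz.
have ek := absint_inv k; have el := absint_inv l; have en := absint_inv n.
have ex := absint_inv (k + l + n).
set t := `|t'|; have t0 : 0 <= t by exact: normr_ge0.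
have E : normc (phase3 t' k l n - 1) <= t * 3 * (`|(k + l + n)%:~R| * (`|k%:~R| * `|l%:~R| +
    `|l%:~R| * `|n%:~R| + `|n%:~R| * `|k%:~R|) + `|k%:~R| * `|l%:~R| * `|n%:~R|).
  apply: (le_trans (expi_sub1 _)); rewrite normrN normrM -/t normrM (ger0_norm (ler0n R 3)).
  rewrite -!mulrA ler_wpM2l// ler_wpM2l// !mulrA.
  have -> : (k + l)%:~R * (l + n)%:~R * (n + k)%:~R =
    (k + l + n)%:~R * (k%:~R * l%:~R + l%:~R * n%:~R + n%:~R * k%:~R) - k%:~R * l%:~R * n%:~R :> R.
    by rewrite !intrD; ring.
  apply: (le_trans (ler_normB _ _)); rewrite !normrM lerD2r ler_wpM2l//.
  by apply: (le_trans (ler_normD _ _)); rewrite !normrM lerD2r (le_trans (ler_normD _ _))// !normrM.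
move: E ek el en ex.
move: (normr_ge0 ((k + l + n)%:~R : R)) (normr_ge0 (k%:~R : R)) (normr_ge0 (l%:~R : R)) (normr_ge0 (n%:~R : R)).
move: (normc (phase3 t' k l n - 1)) `|(k + l + n)%:~R| `|k%:~R| `|l%:~R| `|n%:~R| =>
  e x y u v x0 y0 u0 v0 h hy hu hv hx.
have xi0 : 0 <= x^-1 by rewrite invr_ge0.
have yi0 : 0 <= y^-1 by rewrite invr_ge0.
have ui0 : 0 <= u^-1 by rewrite invr_ge0.
have vi0 : 0 <= v^-1 by rewrite invr_ge0.
have mx := invM_le1 x0; have my := invM_le1 y0; have mu := invM_le1 u0; have mv := invM_le1 v0.
have px := invM_ge0 x0; have py := invM_ge0 y0; have pu := invM_ge0 u0; have pv := invM_ge0 v0.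
apply: (@le_trans _ _ (x^-1 * (t * 3 * (x * (y * u + u * v + v * y) + y * u * v)) * (y^-1 * u^-1 * v^-1))).
  by rewrite ler_wpM2r ?mulr_ge0// ler_wpM2l.
have -> : x^-1 * (t * 3 * (x * (y * u + u * v + v * y) + y * u * v)) * (y^-1 * u^-1 * v^-1) =
  3 * t * ((x^-1 * x) * (y^-1 * y) * (u^-1 * u) * v^-1 + (x^-1 * x) * (u^-1 * u) * (v^-1 * v) * y^-1
    + (x^-1 * x) * (v^-1 * v) * (y^-1 * y) * u^-1 + (y^-1 * y) * (u^-1 * u) * (v^-1 * v) * x^-1).
  by move: (x^-1) (y^-1) (u^-1) (v^-1) => a b c d; ring.
rewrite (_ : 12 * t = 3 * t * (1 + 1 + 1 + 1)); last by ring.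
rewrite ler_wpM2l ?mulr_ge0//.
have H (a b c d : R) : 0 <= a <= 1 -> 0 <= b <= 1 -> 0 <= c <= 1 -> 0 <= d <= 1 ->
    a * b * c * d <= 1.
  move=> ha hb' hc /andP[d0 d1]; have h3 := mul3_le1 ha hb' hc.
  by move: ha hb' hc => /andP[? _] /andP[? _] /andP[? _]; rewrite mulr_ile1 ?mulr_ge0.
by apply: lerD; [apply: lerD; [apply: lerD|]|]; apply: H; apply/andP.
Qed.

Definition Dinv a k : C := iz k * a k.
(** The product conjugated by the Airy group, taken at time [t]; at time 0 it is
    the plain product. *)
Definition theta t a b xi : C := conv2 (fun k l => phase2 t k l * (a k * b l)) xi.
Definition pmean a xi : C := if xi == 0 then 0 else a xi.
(** The quadratic part of the twisted step; [quad_E] rewrites it as the increment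
    over a time step of a sixth of the twisted square of [Dinv w]. *)
Definition quad t w xi : C :=
  conv2 (fun k l => 6^-1 * (phase2 t k l - 1) * (Dinv w k * Dinv w l)) xi.
(** The boundary term of the second integration by parts in time. *)
Definition bdry t w xi : C :=
  conv3 (fun k l n => iz (k + l + n) * (phase3 t k l n - 1) * (Dinv w k * Dinv w l * Dinv w n)) xi.
Definition cube w xi : C := conv3 (fun k l n => w k * w l * w n) xi.
(** These terms integrate over a time step the cubic equation of the normal form,
    up to an error of second order in [t]. *)
Definition cubic3 t w xi : C :=
  3^-1 * pmean (theta t (Dinv w) (Dinv (quad t w))) xi - 54^-1 * bdry t w xi
  + (t / 6)%:C * theta 0 w w 0 * Dinv w xi - (t / 18)%:C * Dinv (cube w) xi.
Definition tstep t w xi : C := w xi + quad t w xi + cubic3 t w xi.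
Definition airy t a xi : C := expi (t * xi%:~R ^+ 3) * a xi.
Definition fstep t w : int -> C := airy t (tstep t w).
(** The change of unknowns in which one step is a perturbation of size [t] of an
    isometry. Low frequencies are left alone, because [quad] is already small
    there and because the map must stay invertible. *)
Definition nform (K : R) w xi : C := w xi - 6^-1 * (hi K xi * theta 0 (Dinv w) (Dinv w) xi).

Lemma normc_Dinv a k : normc (Dinv a k) <= normc (a k).
Proof. by rewrite Normc.normcM ler_piMl ?normc_ge0 ?normc_iz_le1. Qed.

Lemma hball_Dinv g a A : hball g a A -> hball g (Dinv a) A.
Proof. by move=> ha; apply: (hball_le ha) => // k; exact: normc_Dinv. Qed.

Lemma normc_airy t a k : normc (airy t a k) = normc (a k).
Proof. by rewrite Normc.normcM normc_expi mul1r. Qed.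

Lemma hball_airy g t a A : hball g a A -> hball g (airy t a) A.
Proof. by move=> ha; apply: (hball_le ha) => // k; rewrite normc_airy. Qed.

Lemma pmean_diag a k : pmean a k = (if k == 0 then 0 else 1) * a k.
Proof. by rewrite /pmean; case: ifP; rewrite ?mul0r ?mul1r. Qed.

Section Lipschitz.
Variables (g rho : R).
Hypothesis g2 : 1 / 2 < g.
Hypothesis rho0 : 0 < rho.

Let g0 : 0 <= g. Proof. by move: g2; lra. Qed.
Let kap0 : 0 < kap g. Proof. exact: kap_gt0. Qed.

(** One constant serves as a bound on the image of the ball of radius [rho] and as
    a Lipschitz constant there, which makes the class closed under products. *)
Definition LipC (F : (int -> C) -> int -> C) (A : R) :=
  [/\ 0 < A, forall w, hball g w rho -> hball g (F w) A &
      forall w w' d, hball g w rho -> hball g w' rho -> hball g (fun k => w k - w' k) d ->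
        hball g (fun k => F w k - F w' k) (A * d)].

Lemma LipC_mono F A B : A <= B -> LipC F A -> LipC F B.
Proof.
move=> AB [A0 hA hL]; split; first exact: lt_le_trans AB.
  by move=> w hw; apply: hball_le (hA w hw) _ AB.
move=> w w' d hw hw' hd; apply: hball_le (hL w w' d hw hw' hd) _ _ => //.
by rewrite ler_wpM2r// ltW// (hball_gt0 hd).
Qed.

Lemma LipC_ext F F' A : (forall w, hball g w rho -> F w =1 F' w) -> LipC F A -> LipC F' A.
Proof.
move=> e [A0 hA hL]; split => //.
  by move=> w hw; apply: hball_ext (hA w hw); exact: e.
move=> w w' d hw hw' hd; apply: hball_ext (hL w w' d hw hw' hd) => k.
by rewrite !e.
Qed.

Lemma LipC_id : LipC id (rho + 1).
Proof.
split; first by rewrite addr_gt0.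
  by move=> w hw; apply: (hball_le hw) => //; rewrite lerDl.
move=> w w' d hw hw' hd; apply: (hball_le hd) => //.
by rewrite ler_peMl ?(ltW (hball_gt0 hd))// lerDr ltW.
Qed.

Lemma LipC_add F F' A B : LipC F A -> LipC F' B -> LipC (fun w k => F w k + F' w k) (A + B).
Proof.
move=> [A0 hA hL] [B0 hB hL']; split; first by rewrite addr_gt0.
  by move=> w hw; apply: hballD; [exact: hA|exact: hB].
move=> w w' d hw hw' hd; rewrite mulrDl.
apply: hball_ext (hballD (hL _ _ _ hw hw' hd) (hL' _ _ _ hw hw' hd)) => k; ring.
Qed.

Lemma LipC_diag F A c (m : int -> C) : 0 < c -> (forall k, normc (m k) <= c) ->
  LipC F A -> LipC (fun w k => m k * F w k) (c * A).
Proof.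
move=> c0 mc [A0 hA hL]; split; first by rewrite mulr_gt0.
  move=> w hw; apply: hball_dom (hA w hw) => // k.
  by rewrite Normc.normcM ler_wpM2r// normc_ge0.
move=> w w' d hw hw' hd; rewrite -mulrA; apply: hball_dom (hL _ _ _ hw hw' hd) => // k.
by rewrite -mulrBr Normc.normcM ler_wpM2r// normc_ge0.
Qed.

Lemma LipC_opp F A : LipC F A -> LipC (fun w k => - F w k) A.
Proof.
move=> h; rewrite -[A]mul1r; apply: (LipC_ext (F := fun w k => -1 * F w k)).
  by move=> w _ k; rewrite mulN1r.
by apply: LipC_diag => // k; rewrite normcN Normc.normc1.
Qed.

Lemma maj2_mul c (m : int -> int -> C) a b A B : 0 <= c ->
  (forall k l, normc (m k l) <= c) -> hball g a A -> hball g b B ->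
  maj2 g (fun k l => m k l * (a k * b l)).
Proof.
move=> c0 mc ha hb'; apply: (maj2_hball c0 ha hb') => k l.
by rewrite !Normc.normcM ler_wpM2r// mulr_ge0// normc_ge0.
Qed.

Lemma conv2_mul_hball c (m : int -> int -> C) a b A B : 0 < c ->
  (forall k l, normc (m k l) <= c) -> hball g a A -> hball g b B ->
  hball g (conv2 (fun k l => m k l * (a k * b l))) (c * (kap g * A * B)).
Proof.
move=> c0 mc ha hb'; apply: (conv2_hball g2 c0 ha hb') => k l.
by rewrite !Normc.normcM ler_wpM2r// mulr_ge0// normc_ge0.
Qed.

Lemma LipC_conv2 F1 F2 A1 A2 c (m : int -> int -> C) : 0 < c ->
  (forall k l, normc (m k l) <= c) -> LipC F1 A1 -> LipC F2 A2 ->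
  LipC (fun w => conv2 (fun k l => m k l * (F1 w k * F2 w l))) (c * (kap g * (2 * A1 * A2))).
Proof.
move=> c0 mc [A10 h1 L1] [A20 h2 L2].
have A0 : 0 < c * (kap g * (2 * A1 * A2)) by rewrite !mulr_gt0.
split => //.
  move=> w hw; apply: hball_le (conv2_mul_hball c0 mc (h1 _ hw) (h2 _ hw)) _ _ => //.
  rewrite -!mulrA !ler_wpM2l ?(ltW c0) ?(ltW kap0)//.
  by rewrite ler_peMl ?mulr_ge0 ?(ltW A10) ?(ltW A20)// ler1n.
move=> w w' d hw hw' hd.
have p1 := L1 _ _ _ hw hw' hd; have p2 := L2 _ _ _ hw hw' hd.
have q2 := h2 _ hw; have q1 := h1 _ hw'; have q1' := h1 _ hw; have q2' := h2 _ hw'.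
have -> : c * (kap g * (2 * A1 * A2)) * d =
  c * (kap g * (A1 * d) * A2) + c * (kap g * A1 * (A2 * d)) by ring.
apply: hball_ext (hballD (conv2_mul_hball c0 mc p1 q2) (conv2_mul_hball c0 mc q1 p2)) => xi.
have cc := ltW c0.
rewrite -(conv2D g2)//; [|by apply: (maj2_mul cc mc p1 q2)|by apply: (maj2_mul cc mc q1 p2)].
rewrite -(conv2B g2)//; [|by apply: (maj2_mul cc mc q1' q2)|by apply: (maj2_mul cc mc q1 q2')].
by apply: eq_conv2 => k l; ring.
Qed.

Lemma maj3_mul c (m : int -> int -> int -> C) a b e A B E : 0 <= c ->
  (forall k l n, normc (m k l n) <= c) -> hball g a A -> hball g b B -> hball g e E ->
  maj3 g (fun k l n => m k l n * (a k * b l * e n)).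
Proof.
move=> c0 mc ha hb' he; apply: (maj3_hball c0 ha hb' he) => k l n.
by rewrite !Normc.normcM ler_wpM2r// !mulr_ge0// normc_ge0.
Qed.

Lemma conv3_mul_hball c (m : int -> int -> int -> C) a b e A B E : 0 < c ->
  (forall k l n, normc (m k l n) <= c) -> hball g a A -> hball g b B -> hball g e E ->
  hball g (conv3 (fun k l n => m k l n * (a k * b l * e n))) (c * (kap g * (kap g * A * B) * E)).
Proof.
move=> c0 mc ha hb' he; apply: (conv3_hball g2 c0 ha hb' he) => k l n.
by rewrite !Normc.normcM ler_wpM2r// !mulr_ge0// normc_ge0.
Qed.

Lemma LipC_conv3 F A c (m : int -> int -> int -> C) : 0 < c ->
  (forall k l n, normc (m k l n) <= c) -> LipC F A ->
  LipC (fun w => conv3 (fun k l n => m k l n * (F w k * F w l * F w n)))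
    (c * (kap g ^+ 2 * (3 * A ^+ 3))).
Proof.
move=> c0 mc [A0 h L].
have B0 : 0 < c * (kap g ^+ 2 * (3 * A ^+ 3)) by rewrite !mulr_gt0 ?exprn_gt0.
have cc := ltW c0.
split => //.
  move=> w hw; have q := h _ hw; apply: hball_le (conv3_mul_hball c0 mc q q q) _ _ => //.
  have -> : c * (kap g * (kap g * A * A) * A) = c * (kap g ^+ 2 * A ^+ 3) by ring.
  rewrite !ler_wpM2l ?sqr_ge0// ler_peMl ?exprn_ge0 ?(ltW A0)// ler1n//.
move=> w w' d hw hw' hd; have q := h _ hw; have q' := h _ hw'; have p := L _ _ _ hw hw' hd.
have -> : c * (kap g ^+ 2 * (3 * A ^+ 3)) * d =
   c * (kap g * (kap g * (A * d) * A) * A) + c * (kap g * (kap g * A * (A * d)) * A)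
   + c * (kap g * (kap g * A * A) * (A * d)) by ring.
apply: hball_ext (hballD (hballD (conv3_mul_hball c0 mc p q q) (conv3_mul_hball c0 mc q' p q))
  (conv3_mul_hball c0 mc q' q' p)) => xi.
have M1 := maj3_mul cc mc p q q; have M2 := maj3_mul cc mc q' p q.
have M3 := maj3_mul cc mc q' q' p; have M4 := maj3_mul cc mc q q q.
have M5 := maj3_mul cc mc q' q' q'.
have M6 := maj3_mul cc mc q' q q.
have M7 := maj3_mul cc mc q' q' q.
have e1 : conv3 (fun k l n => m k l n * ((F w k - F w' k) * F w l * F w n)) xi =
   conv3 (fun k l n => m k l n * (F w k * F w l * F w n)) xi -
   conv3 (fun k l n => m k l n * (F w' k * F w l * F w n)) xi.
  by rewrite -(conv3B g2 xi M4 M6); apply: eq_conv3 => k l n; ring.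
have e2 : conv3 (fun k l n => m k l n * (F w' k * (F w l - F w' l) * F w n)) xi =
   conv3 (fun k l n => m k l n * (F w' k * F w l * F w n)) xi -
   conv3 (fun k l n => m k l n * (F w' k * F w' l * F w n)) xi.
  by rewrite -(conv3B g2 xi M6 M7); apply: eq_conv3 => k l n; ring.
have e3' : conv3 (fun k l n => m k l n * (F w' k * F w' l * (F w n - F w' n))) xi =
   conv3 (fun k l n => m k l n * (F w' k * F w' l * F w n)) xi -
   conv3 (fun k l n => m k l n * (F w' k * F w' l * F w' n)) xi.
  by rewrite -(conv3B g2 xi M7 M5); apply: eq_conv3 => k l n; ring.
by rewrite e1 e2 e3'; ring.
Qed.

Lemma LipC_scal F1 F2 A1 A2 (j : int) : LipC F1 A1 -> LipC F2 A2 ->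
  LipC (fun w k => F1 w j * F2 w k) (2 * A1 * A2).
Proof.
move=> [A10 h1 L1] [A20 h2 L2]; split; first by rewrite !mulr_gt0.
  move=> w hw; have q1 := h1 _ hw; have q2 := h2 _ hw.
  apply: (@hball_le _ _ (fun k => F1 w j * F2 w k) _ (A1 * A2)) => //.
    apply: hball_dom q2 => // k; rewrite Normc.normcM ler_wpM2r ?normc_ge0//.
    exact: (hball_term j g0 q1).
  by rewrite -mulrA ler_peMl ?mulr_ge0 ?(ltW A10) ?(ltW A20)// ler1n.
move=> w w' d hw hw' hd; have q1 := h1 _ hw'; have q2 := h2 _ hw.
have p1 := L1 _ _ _ hw hw' hd; have p2 := L2 _ _ _ hw hw' hd.
have d0 := hball_gt0 hd.
have r1 : hball g (fun k => (F1 w j - F1 w' j) * F2 w k) (A1 * d * A2).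
  apply: hball_dom q2; first by rewrite mulr_gt0.
  move=> k; rewrite Normc.normcM ler_wpM2r ?normc_ge0//; exact: (hball_term j g0 p1).
have r2 : hball g (fun k => F1 w' j * (F2 w k - F2 w' k)) (A1 * (A2 * d)).
  apply: hball_dom p2 => // k; rewrite Normc.normcM ler_wpM2r ?normc_ge0//.
  exact: (hball_term j g0 q1).
have -> : 2 * A1 * A2 * d = A1 * d * A2 + A1 * (A2 * d) by ring.
by apply: hball_ext (hballD r1 r2) => k; ring.
Qed.

Definition unifL (F : R -> (int -> C) -> int -> C) :=
  exists2 A, 0 < A & forall t, 0 < t <= 1 -> LipC (F t) A.
(** The families that contribute only [1 + O(t)] to the growth of an error over
    one step. *)
Definition tauL (F : R -> (int -> C) -> int -> C) :=
  exists2 A, 0 < A & forall t, 0 < t <= 1 -> LipC (F t) (t * A).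

Lemma tauL_unifL F : tauL F -> unifL F.
Proof.
move=> [A A0 h]; exists A => // t t01; apply: LipC_mono (h t t01).
by rewrite ler_piMl ?(ltW A0)//; case/andP: t01.
Qed.

Lemma tauL_add F F' : tauL F -> tauL F' -> tauL (fun t w k => F t w k + F' t w k).
Proof.
move=> [A A0 h] [B B0 h']; exists (A + B); first by rewrite addr_gt0.
by move=> t t01; rewrite mulrDr; apply: LipC_add; [exact: h|exact: h'].
Qed.

Lemma unifL_add F F' : unifL F -> unifL F' -> unifL (fun t w k => F t w k + F' t w k).
Proof.
move=> [A A0 h] [B B0 h']; exists (A + B); first by rewrite addr_gt0.
by move=> t t01; apply: LipC_add; [exact: h|exact: h'].
Qed.

Lemma tauL_diag F c (m : int -> C) : 0 < c -> (forall k, normc (m k) <= c) ->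
  tauL F -> tauL (fun t w k => m k * F t w k).
Proof.
move=> c0 mc [A A0 h]; exists (c * A); first by rewrite mulr_gt0.
by move=> t t01; rewrite mulrCA; apply: LipC_diag => //; exact: h.
Qed.

Lemma unifL_diag F c (m : int -> C) : 0 < c -> (forall k, normc (m k) <= c) ->
  unifL F -> unifL (fun t w k => m k * F t w k).
Proof.
move=> c0 mc [A A0 h]; exists (c * A); first by rewrite mulr_gt0.
by move=> t t01; apply: LipC_diag => //; exact: h.
Qed.

Lemma tauL_ext F F' : (forall t w, 0 < t <= 1 -> hball g w rho -> F t w =1 F' t w) ->
  tauL F -> tauL F'.
Proof.
move=> e [A A0 h]; exists A => // t t01.
by apply: LipC_ext (h t t01) => w; exact: e.
Qed.

Lemma tauL_theta F1 F2 : tauL F1 -> unifL F2 -> tauL (fun t w => theta t (F1 t w) (F2 t w)).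
Proof.
move=> [A A0 h] [B B0 h']; exists (1 * (kap g * (2 * A * B))).
  by rewrite !mulr_gt0.
move=> t t01; rewrite (_ : t * _ = 1 * (kap g * (2 * (t * A) * B))); last by ring.
apply: LipC_conv2 => //; [by move=> k l; rewrite normc_phase2|exact: h|exact: h'].
Qed.

Lemma tauL_theta' F1 F2 : unifL F1 -> tauL F2 -> tauL (fun t w => theta t (F1 t w) (F2 t w)).
Proof.
move=> [A A0 h] [B B0 h']; exists (1 * (kap g * (2 * A * B))).
  by rewrite !mulr_gt0.
move=> t t01; rewrite (_ : t * _ = 1 * (kap g * (2 * A * (t * B)))); last by ring.
apply: LipC_conv2 => //; [by move=> k l; rewrite normc_phase2|exact: h|exact: h'].
Qed.

Lemma unifL_id : unifL (fun _ w => w).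
Proof. by exists (rho + 1); [rewrite addr_gt0|move=> t _; exact: LipC_id]. Qed.

Lemma unifL_Dinv : unifL (fun _ w => Dinv w).
Proof. by apply: (unifL_diag (c := 1)) unifL_id => // k; exact: normc_iz_le1. Qed.

Lemma tauL_conv2 c (m : R -> int -> int -> C) : 0 < c ->
  (forall t k l, 0 < t <= 1 -> normc (m t k l) <= t * c) ->
  tauL (fun t w => conv2 (fun k l => m t k l * (w k * w l))).
Proof.
move=> c0 mc; exists (c * (kap g * (2 * (rho + 1) * (rho + 1)))).
  by rewrite !mulr_gt0// addr_gt0.
move=> t t01; rewrite (mulrA t c); apply: (@LipC_conv2 id id _ _ (t * c) (m t)) LipC_id LipC_id.
  by rewrite mulr_gt0//; case/andP: t01.
by move=> k l; exact: mc.
Qed.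

Lemma tauL_conv3 c (m : R -> int -> int -> int -> C) : 0 < c ->
  (forall t k l n, 0 < t <= 1 -> normc (m t k l n) <= t * c) ->
  tauL (fun t w => conv3 (fun k l n => m t k l n * (w k * w l * w n))).
Proof.
move=> c0 mc; exists (c * (kap g ^+ 2 * (3 * (rho + 1) ^+ 3))).
  by rewrite !mulr_gt0 ?exprn_gt0// addr_gt0.
move=> t t01; rewrite (mulrA t c); apply: (@LipC_conv3 id _ (t * c) (m t)) LipC_id.
  by rewrite mulr_gt0//; case/andP: t01.
by move=> k l n; exact: mc.
Qed.

Lemma normc_6V : normc (6^-1 : C) <= 1.
Proof. by rewrite (normc_inv_nat 5) invf_le1// ler1n. Qed.

Lemma maj2_quad t w A : hball g w A ->
  maj2 g (fun k l => 6^-1 * (phase2 t k l - 1) * (Dinv w k * Dinv w l)).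
Proof.
move=> hw; apply: (@maj2_mul 2 (fun k l => 6^-1 * (phase2 t k l - 1))) (hball_Dinv hw) (hball_Dinv hw) => //.
move=> k l; rewrite Normc.normcM.
apply: (@le_trans _ _ (1 * 2)); last by rewrite mul1r.
apply: ler_pM; rewrite ?normc_ge0 ?normc_6V//.
by apply: (le_trans (normcB_le _ _)); rewrite normc_phase2 Normc.normc1.
Qed.

Lemma maj2_theta t a b A B : hball g a A -> hball g b B ->
  maj2 g (fun k l => phase2 t k l * (a k * b l)).
Proof.
by move=> ha hb'; apply: (maj2_mul ler01 _ ha hb') => k l; rewrite normc_phase2.
Qed.

Lemma theta_hball t a b A B : hball g a A -> hball g b B -> hball g (theta t a b) (kap g * A * B).
Proof.
move=> ha hb'; rewrite -[kap g * A * B]mul1r; apply: conv2_mul_hball ha hb' => // k l.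
by rewrite normc_phase2.
Qed.

(** One more inverse derivative makes the quadratic part small, by [mult_Dquad]. *)
Lemma tauL_Dquad : tauL (fun t w => Dinv (quad t w)).
Proof.
apply: (@tauL_ext (fun t w => conv2 (fun k l =>
    (iz (k + l) * (6^-1 * (phase2 t k l - 1) * (iz k * iz l))) * (w k * w l)))).
  move=> t w _ hw xi; rewrite /Dinv /quad -(conv2_diag g2)//; last exact: maj2_quad hw.
  by apply: eq_conv2 => k l; rewrite /Dinv; ring.
apply: (tauL_conv2 (c := 2^-1)); first by rewrite invr_gt0.
by move=> t k l /andP[t0 _]; apply: mult_Dquad; exact: ltW.
Qed.

Lemma tauL_lo_quad K : 0 < K -> tauL (fun t w xi => lo K xi * quad t w xi).
Proof.
move=> K0; apply: (@tauL_ext (fun t w => conv2 (fun k l =>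
    (lo K (k + l) * (6^-1 * (phase2 t k l - 1) * (iz k * iz l))) * (w k * w l)))).
  move=> t w _ hw xi; rewrite /quad -(conv2_diag g2)//; last exact: maj2_quad hw.
  by apply: eq_conv2 => k l; rewrite /Dinv; ring.
apply: (tauL_conv2 (c := K / 2)); first by rewrite divr_gt0.
by move=> t k l /andP[t0 _]; rewrite (mulrA t K); apply: mult_lo_quad; exact: ltW.
Qed.

Lemma unifL_quad : unifL (fun t w => quad t w).
Proof.
exists (2 * (kap g * (2 * (1 * (rho + 1)) * (1 * (rho + 1))))).
  by rewrite !mulr_gt0// addr_gt0.
move=> t t01; apply: (@LipC_conv2 Dinv Dinv _ _ 2 (fun k l => 6^-1 * (phase2 t k l - 1))).
- by [].
- move=> k l; rewrite Normc.normcM.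
  apply: (@le_trans _ _ (1 * 2)); last by rewrite mul1r.
  apply: ler_pM; rewrite ?normc_ge0 ?normc_6V//.
  by apply: (le_trans (normcB_le _ _)); rewrite normc_phase2 Normc.normc1.
- by apply: LipC_diag LipC_id => // k; exact: normc_iz_le1.
- by apply: LipC_diag LipC_id => // k; exact: normc_iz_le1.
Qed.

Lemma tauL_bdry : tauL bdry.
Proof.
apply: (@tauL_ext (fun t w => conv3 (fun k l n =>
   (iz (k + l + n) * (phase3 t k l n - 1) * (iz k * iz l * iz n)) * (w k * w l * w n)))).
  by move=> t w _ _ xi; apply: eq_conv3 => k l n; rewrite /Dinv; ring.
apply: (tauL_conv3 (c := 12)) => // t k l n /andP[t0 _].
by rewrite (mulrC t) -{2}(gtr0_norm t0); exact: mult_bdry.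
Qed.

Lemma tauL_tC c (F : (int -> C) -> int -> C) A : 0 < c -> LipC F A ->
  tauL (fun t w k => (t / c)%:C * F w k).
Proof.
move=> c0 [A0 h L]; exists (c^-1 * A); first by rewrite mulr_gt0 ?invr_gt0.
move=> t /andP[t0 _]; rewrite mulrA; apply: LipC_diag => //; first by rewrite divr_gt0.
by move=> k; rewrite normcR ger0_norm// divr_ge0// ltW.
Qed.

Lemma LipC_cube : exists A, LipC cube A.
Proof.
exists (1 * (kap g ^+ 2 * (3 * (rho + 1) ^+ 3))).
apply: (@LipC_ext (fun w => conv3 (fun k l n => 1 * (w k * w l * w n)))).
  by move=> w _ xi; apply: eq_conv3 => k l n; rewrite mul1r.
by apply: LipC_conv3 LipC_id => // k l n; rewrite Normc.normc1.
Qed.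

(** Every cubic term contains [Dinv (quad t w)], the small phase difference of
    [bdry], or an explicit factor [t]. *)
Lemma tauL_cubic3 : tauL cubic3.
Proof.
have LD := LipC_diag ltr01 normc_iz_le1 LipC_id.
apply: (@tauL_ext (fun t w xi =>
   (if xi == 0 then 0 else 3^-1) * theta t (Dinv w) (Dinv (quad t w)) xi
   + (- 54^-1) * bdry t w xi
   + (t / 6)%:C * (theta 0 w w 0 * Dinv w xi) + (t / 18)%:C * (- Dinv (cube w) xi))).
  move=> t w _ _ xi; rewrite /cubic3 /pmean; case: ifP => _; ring.
apply: tauL_add; [apply: tauL_add; [apply: tauL_add|]|].
- apply: (tauL_diag (c := 1)) => //.
    move=> k; case: ifP => _; rewrite ?Normc.normc0// (normc_inv_nat 2) invf_le1// ler1n//.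
  exact: tauL_theta' unifL_Dinv tauL_Dquad.
- apply: (tauL_diag (c := 1)) tauL_bdry => // k.
  by rewrite normcN (normc_inv_nat 53) invf_le1// ler1n.
- apply: tauL_tC => //; apply: (@LipC_scal (fun w => theta 0 w w) Dinv _ _ 0 _ LD).
  by apply: (@LipC_conv2 id id _ _ 1 (phase2 0) ltr01 _ LipC_id LipC_id) => k l; rewrite normc_phase2.
- have [A LA] := LipC_cube.
  apply: tauL_tC => //; apply: LipC_opp.
  by apply: (LipC_diag ltr01 normc_iz_le1 LA).
Qed.

Lemma unifL_tstep : unifL tstep.
Proof. exact: unifL_add (unifL_add unifL_id unifL_quad) (tauL_unifL tauL_cubic3). Qed.

Lemma thetaDl t a b e A B E xi : hball g a A -> hball g b B -> hball g e E ->
  theta t (fun k => a k + b k) e xi = theta t a e xi + theta t b e xi.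
Proof.
move=> ha hb' he; rewrite /theta -(conv2D g2 xi (maj2_theta t ha he) (maj2_theta t hb' he)).
by apply: eq_conv2 => k l; ring.
Qed.

Lemma thetaDr t a b e A B E xi : hball g a A -> hball g b B -> hball g e E ->
  theta t e (fun k => a k + b k) xi = theta t e a xi + theta t e b xi.
Proof.
move=> ha hb' he; rewrite /theta -(conv2D g2 xi (maj2_theta t he ha) (maj2_theta t he hb')).
by apply: eq_conv2 => k l; ring.
Qed.

Lemma quad_E t w A xi : hball g w A ->
  quad t w xi = 6^-1 * (theta t (Dinv w) (Dinv w) xi - theta 0 (Dinv w) (Dinv w) xi).
Proof.
move=> hw; have hD := hball_Dinv hw.
rewrite /theta -(conv2B g2 xi (maj2_theta t hD hD) (maj2_theta 0 hD hD)).
rewrite -(conv2Z g2).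
  by apply: eq_conv2 => k l; rewrite phase2_0; ring.
apply: (@maj2_hball _ _ (Dinv w) (Dinv w) A A 2) => // k l.
rewrite phase2_0 -mulrBl Normc.normcM Normc.normcM ler_wpM2r ?mulr_ge0 ?normc_ge0//.
by apply: (le_trans (normcB_le _ _)); rewrite normc_phase2 Normc.normc1.
Qed.

Lemma theta_airy t a b A B xi : hball g a A -> hball g b B ->
  theta 0 (Dinv (airy t a)) (Dinv (airy t b)) xi = expi (t * xi%:~R ^+ 3) * theta t (Dinv a) (Dinv b) xi.
Proof.
move=> ha hb'; rewrite /theta -(conv2_diag g2 (fun k => expi (t * k%:~R ^+ 3))); last first.
  exact: maj2_theta (hball_Dinv ha) (hball_Dinv hb').
apply: eq_conv2 => k l; rewrite phase2_0 mul1r /Dinv /airy.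
have -> : expi (t * (k + l)%:~R ^+ 3) * (phase2 t k l * (iz k * a k * (iz l * b l))) =
  (expi (t * (k + l)%:~R ^+ 3) * phase2 t k l) * (iz k * a k * (iz l * b l)) by ring.
rewrite /phase2 -expiD.
have -> : t * (k + l)%:~R ^+ 3 - t * (3 * ((k + l)%:~R * k%:~R * l%:~R)) =
  t * k%:~R ^+ 3 + t * l%:~R ^+ 3 :> R by rewrite intrD; ring.
by rewrite expiD; ring.
Qed.

Definition Dcorr t w := Dinv (fun k => quad t w k + cubic3 t w k).

Lemma tauL_Dcorr : tauL Dcorr.
Proof.
apply: (@tauL_ext (fun t w k => Dinv (quad t w) k + Dinv (cubic3 t w) k)).
  by move=> t w _ _ k; rewrite /Dcorr /Dinv; ring.
apply: tauL_add tauL_Dquad _.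
by apply: (tauL_diag (c := 1)) tauL_cubic3 => // k; exact: normc_iz_le1.
Qed.

(** What one step adds to the normal form: low frequencies of the quadratic part,
    cubic terms, and the effect on (D w)^2 of the change of [Dinv w], which is
    small. *)
Definition nrem K t w xi : C := lo K xi * quad t w xi + cubic3 t w xi
  + (- 6^-1 * hi K xi) * (theta t (Dinv w) (Dcorr t w) xi + theta t (Dcorr t w) (Dinv w) xi
    + theta t (Dcorr t w) (Dcorr t w) xi).

Lemma normc_hi6 K k : normc (- 6^-1 * hi K k) <= 1.
Proof.
by rewrite Normc.normcM normcN mulr_ile1 ?normc_ge0 ?normc_6V ?normc_hi.
Qed.

Lemma tauL_nrem K : 0 < K -> tauL (nrem K).
Proof.
move=> K0; apply: tauL_add; first exact: tauL_add (tauL_lo_quad K0) tauL_cubic3.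
apply: (tauL_diag (c := 1)) => //; first exact: normc_hi6.
apply: tauL_add; first apply: tauL_add.
- exact: tauL_theta' unifL_Dinv tauL_Dcorr.
- exact: tauL_theta tauL_Dcorr unifL_Dinv.
- exact: tauL_theta' (tauL_unifL tauL_Dcorr) tauL_Dcorr.
Qed.

(** Above frequency [K] the normal form of the step subtracts a sixth of the
    square of the updated [Dinv w]; its main part is the twisted square at time
    [t], and together with [quad] it leaves the square at time 0, that is, the
    normal form of [w]. *)
Lemma nform_fstep K t w : 0 < t <= 1 -> hball g w rho ->
  nform K (fstep t w) =1 airy t (fun k => nform K w k + nrem K t w k).
Proof.
move=> t01 hw xi.
have [A A0 /(_ t t01)[_ /(_ w hw) hP _]] := unifL_tstep.
have [B B0 /(_ t t01)[_ /(_ w hw) hS _]] := tauL_Dcorr.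
have hD := hball_Dinv hw; have hDS := hballD hD hS.
have e : Dinv (tstep t w) = (fun k => Dinv w k + Dcorr t w k).
  by apply/funext => k; rewrite /Dcorr /Dinv /tstep -addrA mulrDr.
rewrite /nform /fstep (theta_airy t xi hP hP) e (thetaDl t xi hD hS hDS).
rewrite (thetaDr t xi hD hS hD) (thetaDr t xi hD hS hS) /airy /tstep /nrem.
rewrite (quad_E t xi hw) -(lo_hi K xi).
have -> : lo K xi = 1 - hi K xi by rewrite -(lo_hi K xi) addrK.
ring.
Qed.

(** The Airy group is an isometry, so [nform_fstep] leaves only the remainder,
    whose Lipschitz constant is O(t). *)
Lemma stability K : 0 < K -> exists2 L, 0 < L & forall t, 0 < t <= 1 ->
  forall w w' d d', hball g w rho -> hball g w' rho -> hball g (fun k => w k - w' k) d ->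
  hball g (fun k => nform K w k - nform K w' k) d' ->
  hball g (fun k => nform K (fstep t w) k - nform K (fstep t w') k) (d' + t * L * d).
Proof.
move=> /tauL_nrem[L L0 hL]; exists L => // t t01 w w' d d' hw hw' hd hd'.
have [_ _ /(_ w w' d hw hw' hd) h] := hL t t01.
apply: hball_ext (hball_airy t (hballD hd' h)) => k.
rewrite (nform_fstep K t01 hw k) (nform_fstep K t01 hw' k) /airy -mulrBr; congr (_ * _).
by move: (nform K w k) (nform K w' k) (nrem K t w k) (nrem K t w' k) => a b c e; ring.
Qed.

Lemma nform_lip K : exists A, LipC (nform K) A.
Proof.
have [A LA] : exists A, LipC (fun w => theta 0 (Dinv w) (Dinv w)) A.
  eexists; apply: (@LipC_conv2 Dinv Dinv _ _ 1 (phase2 0) ltr01).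
  - by move=> k l; rewrite normc_phase2.
  - by apply: (LipC_diag ltr01 normc_iz_le1 LipC_id).
  - by apply: (LipC_diag ltr01 normc_iz_le1 LipC_id).
exists ((rho + 1) + 1 * A).
apply: (@LipC_ext (fun w k => w k + (- 6^-1 * hi K k) * theta 0 (Dinv w) (Dinv w) k)).
  by move=> w _ k; rewrite /nform; ring.
by apply: LipC_add LipC_id _; apply: LipC_diag LA => //; exact: normc_hi6.
Qed.

Lemma hball_limit a A : 0 < A -> (forall e, 0 < e -> hball g a (A + e)) -> hball g a A.
Proof.
move=> A0 h; split => //.
have [_ h1] := h 1 ltr01.
have n0 k : 0 <= wt g k * normc (a k) ^+ 2 by rewrite mulr_ge0 ?wt_ge0 ?sqr_ge0.
have [r /andP[r0 _] airy] := nsum_fin n0 h1.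
rewrite airy lee_fin -[r]sqr_sqrtr// lerXn2r ?nnegrE ?sqrtr_ge0 ?(ltW A0)//.
apply/ler_addgt0Pr => e e0; have [Ae he] := h e e0.
rewrite -(@ler_pXn2r _ 2)// ?nnegrE ?sqrtr_ge0 ?(ltW Ae)// sqr_sqrtr//.
by rewrite -lee_fin -airy.
Qed.

(** An a priori bound [d0] is improved by iterating the inequality
    d <= d' + d/2, whose fixed point is 2 d'. *)
Lemma half_iter a d0 d' : hball g a d0 ->
  (forall d, hball g a d -> hball g a (d' + d / 2)) -> 0 < d' -> hball g a (2 * d').
Proof.
move=> h0 step d'0; have d00 := hball_gt0 h0.
have it (n : nat) : hball g a (2 * d' + d0 / 2 ^+ n).
  elim: n => [|n ih].
    by apply: (hball_le h0) => //; rewrite expr0 divr1 lerDr mulr_ge0// ltW.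
  have -> : 2 * d' + d0 / 2 ^+ n.+1 = d' + (2 * d' + d0 / 2 ^+ n) / 2.
    by rewrite exprS; field; rewrite expf_neq0// pnatr_eq0.
  exact: step.
apply: hball_limit; first by rewrite mulr_gt0.
move=> e e0; pose n := Num.truncn (d0 / e).
apply: (hball_le (it n.+1)) => //; rewrite lerD2l ler_pdivrMr ?exprn_gt0//.
rewrite mulrC -ler_pdivrMr//; apply: ltW; apply: (lt_le_trans (truncnS_gt _)).
by rewrite -natrX ler_nat ltnW// ltn_expl.
Qed.

(** For [K] large the quadratic map in the normal form has Lipschitz constant at
    most 1/2 on the ball, by [mult_hi]. *)
Lemma nform_inv : exists2 K, 1 <= K & forall w w' d', hball g w rho -> hball g w' rho ->
  hball g (fun k => nform K w k - nform K w' k) d' -> hball g (fun k => w k - w' k) (2 * d').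
Proof.
pose B := kap g * (2 * (rho + 1) * (rho + 1)).
have B0 : 0 < B by rewrite !mulr_gt0// addr_gt0.
(* then 2 / K * B <= 1 / 2 *)
pose K := 1 + 4 * B; have K1 : 1 <= K by rewrite lerDl mulr_ge0// ltW.
exists K => // w w' d' hw hw' hd'.
have K0 : 0 < K by exact: lt_le_trans K1.
pose F w := conv2 (fun k l => (6^-1 * (hi K (k + l) * (iz k * iz l))) * (w k * w l)).
have LF : LipC F (2 / K * B).
  apply: (@LipC_conv2 id id _ _ (2 / K)) LipC_id LipC_id; first by rewrite divr_gt0.
  move=> k l; rewrite Normc.normcM; apply: le_trans (mult_hi k l K1).
  by rewrite ler_piMl ?normc_ge0 ?normc_6V.
have FE v : hball g v rho -> nform K v =1 (fun k => v k - F v k).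
  move=> hv xi; rewrite /nform /F; congr (_ - _).
  rewrite mulrA /theta -(conv2_diag g2 (fun k => 6^-1 * hi K k)); last first.
    exact: maj2_theta (hball_Dinv hv) (hball_Dinv hv).
  by apply: eq_conv2 => k l; rewrite phase2_0 /Dinv; ring.
have [_ _ LF2] := LF.
apply: (half_iter (hballB hw hw')); last exact: hball_gt0 hd'.
move=> d hd; have d0 := hball_gt0 hd.
have h := hballD hd' (LF2 w w' d hw hw' hd).
apply: (hball_le (b := fun k => w k - w' k) h) => [k|].
  by rewrite !FE// (_ : _ - F w k - _ + _ = w k - w' k)//; ring.
rewrite lerD2l [leRHS]mulrC ler_wpM2r ?(ltW d0)//.
rewrite [2 / K]mulrC -mulrA mulrC ler_pdivrMr// /K; move: B0; lra.
Qed.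

End Lipschitz.
End Scheme.

(** * Differentiating infinite sums in time *)
Section Derivatives.
Context {R : realType}.
Local Notation C := R[i].
Local Notation normc := Normc.normc.
Local Opaque nsum.
Implicit Types (k n xi : int) (s t : R) (a b w : int -> C).

(** Differentiability stated with an increment and an error, without a quotient:
    in this form it passes through sums. *)
Definition edr (f : R -> R) (t l : R) := forall e : R, 0 < e ->
  exists2 d : R, 0 < d & forall h, `|h| < d -> `|f (t + h) - f t - h * l| <= e * `|h|.

Lemma is_derive_edr (f : R -> R) t l : is_derive t (1 : R) f l -> edr f t l.
Proof.
move=> [fd dv] e e0.
have cv : (h^-1 *: ((f \o shift t) (h *: 1) - f t) @[h --> 0^'] --> l).
  by rewrite -dv; exact: fd.
move/cvgrPdist_le : cv => /(_ e e0) [d d0 hd]; exists d => // h hh.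
have [->|h0] := eqVneq h 0; first by rewrite addr0 subrr mul0r subrr !normr0 mulr0.
have := hd h _ h0; rewrite /= sub0r normrN => /(_ hh).
rewrite /shift /= -[h *: 1]/(h * 1) mulr1 -[_ *: _]/(_ * _) => H.
have -> : f (t + h) - f t - h * l = - h * (l - h^-1 * (f (h + t) - f t)).
  by rewrite addrC [t + h]addrC mulrBr mulNr mulNr mulrA mulfV// mul1r; ring.
by rewrite normrM normrN mulrC ler_wpM2r.
Qed.

Lemma edr_is_derive (f : R -> R) t l : edr f t l -> is_derive t (1 : R) f l.
Proof.
move=> H.
have cv : (h^-1 *: ((f \o shift t) (h *: 1) - f t) @[h --> 0^'] --> l).
  apply/cvgrPdist_le => e e0; have [d d0 hd] := H e e0.
  exists d => //= h; rewrite /= sub0r normrN => hh h0.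
  have := hd h hh; rewrite /shift /= -[h *: 1]/(h * 1) mulr1 -[_ *: _]/(_ * _).
  have -> : f (t + h) - f t - h * l = - h * (l - h^-1 * (f (h + t) - f t)).
    by rewrite [t + h]addrC mulrBr mulNr mulNr mulrA mulfV// mul1r; ring.
  by rewrite normrM normrN mulrC ler_pM2r// normr_gt0.
split; first by apply/cvg_ex; exists l.
exact: cvg_lim cv.
Qed.

Lemma edr_le (f : R -> R) t l m (d0 : R) : 0 < d0 -> edr f t l ->
  (forall h, `|h| < d0 -> `|f (t + h) - f t| <= m * `|h|) -> `|l| <= m.
Proof.
move=> d00 H lip; apply/ler_addgt0Pr => e e0.
have [d dp hd] := H e e0; pose h := Num.min d d0 / 2.
have mp : 0 < Num.min d d0 by rewrite lt_min dp.
have h0 : 0 < h by rewrite divr_gt0.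
have hm : h < Num.min d d0 by rewrite ltr_pdivrMr// ltr_pMr// ltr1n.
have := hm; rewrite lt_min => /andP[h1 h2].
have := hd h; have := lip h; rewrite (gtr0_norm h0) => /(_ h2) A /(_ h1) B.
rewrite -(ler_pM2l h0) -{1}(gtr0_norm h0) -normrM.
have -> : h * l = (f (t + h) - f t) - (f (t + h) - f t - h * l) by ring.
by apply: (le_trans (ler_normB _ _)); rewrite [leRHS]mulrC mulrDl lerD.
Qed.

Lemma edr_sum (I : Type) (r : seq I) (f : I -> R -> R) t (l : I -> R) :
  (forall i, edr (f i) t (l i)) -> edr (fun s => \sum_(i <- r) f i s) t (\sum_(i <- r) l i).
Proof.
move=> H; elim: r => [|i r ih] e e0.
  exists 1; first exact: ltr01.
  by move=> h _; rewrite !big_nil mulr0 subr0 subrr normr0 mulr_ge0// ltW.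
have e20 : 0 < e / 2 by rewrite divr_gt0.
have [d1 d10 h1] := H i _ e20; have [d2 d20 h2] := ih _ e20.
exists (Num.min d1 d2); first by rewrite lt_min d10.
move=> h; rewrite lt_min => /andP[/h1 A /h2 B]; rewrite !big_cons.
have -> : f i (t + h) + \sum_(j <- r) f j (t + h) - (f i t + \sum_(j <- r) f j t)
  - h * (l i + \sum_(j <- r) l j) = (f i (t + h) - f i t - h * l i) +
  (\sum_(j <- r) f j (t + h) - \sum_(j <- r) f j t - h * \sum_(j <- r) l j) by ring.
by apply: (le_trans (ler_normD _ _)); have -> : e * `|h| = e / 2 * `|h| + e / 2 * `|h|; [field|exact: lerD].
Qed.

(** A summable Lipschitz majorant reduces the sum to finitely many terms up to an
    error proportional to the increment. *)
Lemma rsum_derive (I : choiceType) (f : R -> I -> R) (f' : I -> R) (m : I -> R) t (d0 : R) :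
  0 < d0 -> (forall i, 0 <= m i) -> (nsum m < +oo)%E ->
  (forall i, is_derive t (1 : R) (f^~ i) (f' i)) ->
  (forall h, `|h| < d0 -> rsmb (f (t + h))) ->
  (forall i h, `|h| < d0 -> `|f (t + h) i - f t i| <= m i * `|h|) ->
  is_derive t (1 : R) (fun s => rsum (f s)) (rsum f').
Proof.
move=> d00 m0 mo df sf lip; apply: edr_is_derive => e e0.
have de i := is_derive_edr (df i).
have f'm i : `|f' i| <= m i by apply: edr_le d00 (de i) _ => h; exact: lip.
have sf' : rsmb f' by apply: le_lt_trans mo; exact: le_nsum.
have sft : rsmb (f t) by rewrite -[t]addr0; apply: sf; rewrite normr0.
have e40 : 0 < e / 4 by rewrite divr_gt0.
have [r ur tail] := nsum_tail m0 mo e40.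
have e20 : 0 < e / 2 by rewrite divr_gt0.
have [d1 d10 h1] := edr_sum r de e20.
exists (Num.min d1 d0); first by rewrite lt_min d10.
move=> h; rewrite lt_min => /andP[hd1 hd0].
rewrite (rsum_split (sf h hd0) ur) (rsum_split sft ur) (rsum_split sf' ur).
have so := rsmb_off r (sf h hd0); have so' := rsmb_off r sft; have so2 := rsmb_off r sf'.
have offm : (nsum (fun i => `|h| * off r m i)%R <= (`|h| * (e / 4))%:E)%E.
  have o0 i : 0 <= off r m i by rewrite /off; case: ifP.
  rewrite nsumZ//; have [c /andP[_ ce] ->] := nsum_fin o0 tail.
  by rewrite -EFinM lee_fin ler_wpM2l.
have T1 : `|rsum (off r (f (t + h))) - rsum (off r (f t))| <= `|h| * (e / 4).
  have -> : rsum (off r (f (t + h))) - rsum (off r (f t)) =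
      rsum (fun i => off r (f (t + h)) i + -1 * off r (f t) i).
    by rewrite rsumD//; [rewrite rsumZ// mulN1r|exact: rsmbZ].
  apply: rsum_le; apply: le_trans offm; apply: le_nsum => i; rewrite /off.
  by case: ifP => _; rewrite ?mulr0 ?addr0 ?normr0// mulN1r mulrC lip.
have T2 : `|rsum (off r f')| <= e / 4.
  apply: rsum_le; apply: le_trans tail; apply: le_nsum => i; rewrite /off.
  by case: ifP; rewrite ?normr0.
have T3 := h1 h hd1.
have T4 : `|h * rsum (off r f')| <= `|h| * (e / 4) by rewrite normrM ler_wpM2l.
have -> : forall x y z x' y' z' : R, x + x' - (y + y') - h * (z + z') =
  (x - y - h * z) + ((x' - y') - h * z') by move=> *; ring.
apply: (le_trans (ler_normD _ _)).
have := ler_normB (rsum (off r (f (t + h))) - rsum (off r (f t))) (h * rsum (off r f')).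
move: T1 T3 T4; lra.
Qed.

Definition cder (f : R -> C) t (l : C) :=
  is_derive t (1 : R) (fun s => complex.Re (f s)) (complex.Re l) /\
  is_derive t (1 : R) (fun s => complex.Im (f s)) (complex.Im l).

Lemma cder_ext (f f' : R -> C) t l l' : f =1 f' -> l = l' -> cder f t l -> cder f' t l'.
Proof. by move=> /funext -> ->. Qed.

Lemma cder_cst (c : C) t : cder (fun=> c) t 0.
Proof. by split; exact: is_derive_cst. Qed.

Lemma cderD f1 f2 t l1 l2 : cder f1 t l1 -> cder f2 t l2 ->
  cder (fun s => f1 s + f2 s) t (l1 + l2).
Proof.
move=> [a1 b1] [a2 b2]; split; rewrite ?cReD ?cImD.
  have := is_deriveD a1 a2; congr (is_derive _ _ _ _).
  by apply/funext => s /=; rewrite cReD.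
have := is_deriveD b1 b2; congr (is_derive _ _ _ _).
by apply/funext => s /=; rewrite cImD.
Qed.

Lemma cderM f1 f2 t l1 l2 : cder f1 t l1 -> cder f2 t l2 ->
  cder (fun s => f1 s * f2 s) t (l1 * f2 t + f1 t * l2).
Proof.
move=> [a1 b1] [a2 b2]; split; rewrite ?cReD ?cImD ?cReM ?cImM.
  have := is_deriveB (is_deriveM a1 a2) (is_deriveM b1 b2).
  have -> : (fun s => complex.Re (f1 s)) * (fun s => complex.Re (f2 s)) -
     (fun s => complex.Im (f1 s)) * (fun s => complex.Im (f2 s)) =
     (fun s => complex.Re (f1 s * f2 s)).
    by apply/funext => s; rewrite cReM.
  move=> h; apply: is_derive_eq; rewrite /GRing.scale /=; ring.
have := is_deriveD (is_deriveM a1 b2) (is_deriveM b1 a2).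
have -> : (fun s => complex.Re (f1 s)) * (fun s => complex.Im (f2 s)) +
   (fun s => complex.Im (f1 s)) * (fun s => complex.Re (f2 s)) =
   (fun s => complex.Im (f1 s * f2 s)).
  by apply/funext => s; rewrite cImM.
move=> h; apply: is_derive_eq; rewrite /GRing.scale /=; ring.
Qed.

Lemma cderZ (c : C) f t l : cder f t l -> cder (fun s => c * f s) t (c * l).
Proof. by move=> h; apply: cder_ext (cderM (cder_cst c t) h) => //; rewrite mul0r add0r. Qed.

Lemma cderN f t l : cder f t l -> cder (fun s => - f s) t (- l).
Proof.
by move=> h; apply: cder_ext (cderZ (-1) h) => [s|]; rewrite mulN1r.
Qed.

Lemma cderB f1 f2 t l1 l2 : cder f1 t l1 -> cder f2 t l2 ->
  cder (fun s => f1 s - f2 s) t (l1 - l2).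
Proof. by move=> h1 h2; apply: cderD => //; exact: cderN. Qed.

Definition ii (x : R) : C := 0 +i* x.

Lemma cder_lin (c : R) t : cder (fun s => (c * s)%:C) t c%:C.
Proof.
split => /=; last exact: is_derive_cst.
apply: edr_is_derive => e e0; exists 1 => // h _.
have -> : c * (t + h) - c * t - h * c = 0 by ring.
by rewrite normr0 mulr_ge0// ltW.
Qed.

Lemma is_derive_lin (c : R) t : is_derive t (1 : R) (fun s => c * s) c.
Proof. by have [] := cder_lin c t. Qed.

Lemma cder_expi (c : R) t : cder (fun s => expi (c * s)) t (ii c * expi (c * t)).
Proof.
have hl := is_derive_lin c t.
split; rewrite ?cReM ?cImM /=.
  apply: (is_derive_eq (is_derive1_comp (is_derive_cos (c * t)) hl)); ring.
apply: (is_derive_eq (is_derive1_comp (is_derive_sin (c * t)) hl)); ring.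
Qed.

Lemma cder_csum (I : choiceType) (f : R -> I -> C) (f' : I -> C) (m : I -> R) t (d0 : R) :
  0 < d0 -> (forall i, 0 <= m i) -> (nsum m < +oo)%E ->
  (forall i, cder (f^~ i) t (f' i)) ->
  (forall h, `|h| < d0 -> csmb (f (t + h))) ->
  (forall i h, `|h| < d0 -> normc (f (t + h) i - f t i) <= m i * `|h|) ->
  cder (fun s => csum (f s)) t (csum f').
Proof.
move=> d00 m0 mo df sf lip; split => /=.
  apply: (@rsum_derive _ (fun s i => complex.Re (f s i)) _ m t d0) => //.
  - by move=> i; case: (df i).
  - by move=> h /sf; exact: csmb_Re.
  - move=> i h hh; apply: le_trans (lip i h hh).
    by rewrite -cReN -cReD; exact: Re_le_normc.
apply: (@rsum_derive _ (fun s i => complex.Im (f s i)) _ m t d0) => //.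
- by move=> i; case: (df i).
- by move=> h /sf; exact: csmb_Im.
- move=> i h hh; apply: le_trans (lip i h hh).
  by rewrite -cImN -cImD; exact: Im_le_normc.
Qed.

Definition ccont (f : R -> C) (x y : R) :=
  {within `[x, y], continuous (fun s => complex.Re (f s))} /\
  {within `[x, y], continuous (fun s => complex.Im (f s))}.

Lemma lip_within (f : R -> R) (x y L : R) :
  (forall s t, x <= s <= y -> x <= t <= y -> `|f s - f t| <= L * `|s - t|) ->
  {within `[x, y], continuous f}.
Proof.
move=> H; apply/subspace_continuousP => t /=; rewrite in_itv /= => tI.
apply/cvgrPdist_le => e e0.
have L0 : 0 < `|L| + 1 by rewrite ltr_wpDl.
rewrite near_withinE; near=> s => sI.
apply: (le_trans (H _ _ tI sI)).
apply: (@le_trans _ _ ((`|L| + 1) * `|t - s|)).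
  by rewrite ler_wpM2r// (le_trans (ler_norm L))// lerDl.
rewrite mulrC -ler_pdivlMr//; apply: ltW.
by near: s; apply: nbhsx_ballx; rewrite divr_gt0.
Unshelve. all: by end_near.
Qed.

Lemma lip_ccont (f : R -> C) (x y L : R) :
  (forall s t, x <= s <= y -> x <= t <= y -> normc (f s - f t) <= L * `|s - t|) ->
  ccont f x y.
Proof.
move=> H; split; apply: (@lip_within _ _ _ L) => s t hs ht; apply: le_trans (H s t hs ht).
  by rewrite -cReN -cReD Re_le_normc.
by rewrite -cImN -cImD Im_le_normc.
Qed.

Lemma within_sum (I : Type) (r : seq I) (f : I -> R -> R) (A : set R) :
  (forall i, {within A, continuous (f i)}) ->
  {within A, continuous (fun s => \sum_(i <- r) f i s)}.
Proof.
move=> H; elim: r => [|i r ih].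
  by rewrite (_ : (fun s => _) = fun=> 0); [exact: cst_continuous|apply/funext => s; rewrite big_nil].
rewrite (_ : (fun s => _) = fun s => f i s + \sum_(j <- r) f j s).
  by move=> x; apply: continuousD; [exact: H|exact: ih].
by apply/funext => s; rewrite big_cons.
Qed.

Lemma cder_ccont (f : R -> C) (l : R -> C) x y : (forall s, cder f s (l s)) -> ccont f x y.
Proof.
move=> H; split; apply: continuous_subspaceT => s; have [h1 h2] := H s.
  by apply: differentiable_continuous; apply/derivable1_diffP; exact: ex_derive.
by apply: differentiable_continuous; apply/derivable1_diffP; exact: ex_derive.
Qed.

Lemma ccontD f1 f2 x y : ccont f1 x y -> ccont f2 x y -> ccont (fun s => f1 s + f2 s) x y.
Proof.
move=> [a1 b1] [a2 b2]; split.
  rewrite (_ : (fun s => _) = fun s => complex.Re (f1 s) + complex.Re (f2 s)).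
    by move=> z; apply: continuousD; [exact: a1|exact: a2].
  by apply/funext => s; rewrite cReD.
rewrite (_ : (fun s => _) = fun s => complex.Im (f1 s) + complex.Im (f2 s)).
  by move=> z; apply: continuousD; [exact: b1|exact: b2].
by apply/funext => s; rewrite cImD.
Qed.

Lemma ccontZ (c : C) f x y : ccont f x y -> ccont (fun s => c * f s) x y.
Proof.
move=> [a b]; split.
  rewrite (_ : (fun s => _) = fun s => complex.Re c * complex.Re (f s) + - complex.Im c * complex.Im (f s)).
    by move=> z; apply: cvgD; apply: (@cvgM R); try exact: cvg_cst; [exact: a|exact: b].
  by apply/funext => s; rewrite cReM mulNr.
rewrite (_ : (fun s => _) = fun s => complex.Re c * complex.Im (f s) + complex.Im c * complex.Re (f s)).
  by move=> z; apply: cvgD; apply: (@cvgM R); try exact: cvg_cst; [exact: b|exact: a].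
by apply/funext => s; rewrite cImM.
Qed.

Lemma ccont_cst (c : C) x y : ccont (fun=> c) x y.
Proof. by apply: cder_ccont => s; exact: cder_cst. Qed.

Lemma ccont_sub f x y x' y' : x <= x' -> y' <= y -> ccont f x y -> ccont f x' y'.
Proof.
move=> xx yy [a b].
have sub : `[x', y'] `<=` `[x, y].
  by move=> z /=; rewrite !in_itv /= => /andP[z1 z2]; rewrite (le_trans xx)// (le_trans z2).
by split; [exact: continuous_subspaceW a|exact: continuous_subspaceW b].
Qed.

(** The mean value theorem has no vector form; it is applied to the scalar product
    of [f] with the increment, over finitely many frequencies, and
    Cauchy-Schwarz gives the norm of the increment. *)
Lemma vector_mvt (g : R) (f f' : R -> int -> C) (x y A : R) : x < y -> 0 < A ->
  (forall s xi, x < s < y -> cder (f^~ xi) s (f' s xi)) ->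
  (forall xi, ccont (f^~ xi) x y) ->
  (forall s, x < s < y -> hball g (f' s) A) ->
  hball g (fun xi => f y xi - f x xi) (A * (y - x)).
Proof.
move=> xy A0 df cf hA; have yx : 0 < y - x by rewrite subr_gt0.
split; first by rewrite mulr_gt0.
apply: nsum_le_seq => r ur; rewrite lee_fin.
pose d xi := f y xi - f x xi.
pose S := \sum_(xi <- r) wt g xi * normc (d xi) ^+ 2.
rewrite -/S.
pose re s xi := complex.Re (f s xi); pose im s xi := complex.Im (f s xi).
(* the scalar product of [f s] with the increment [d] *)
pose phi s := \sum_(xi <- r) wt g xi * (complex.Re (d xi) * re s xi + complex.Im (d xi) * im s xi).
pose phi' s := \sum_(xi <- r) wt g xi * (complex.Re (d xi) * complex.Re (f' s xi)
  + complex.Im (d xi) * complex.Im (f' s xi)).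
have dphi s : s \in `]x, y[%R -> is_derive s (1 : R) phi (phi' s).
  rewrite in_itv /= => sI; apply: edr_is_derive; apply: edr_sum => xi.
  apply: is_derive_edr; have [d1 d2] := df s xi sI.
  exact: (is_deriveZ _ (is_deriveD (is_deriveZ _ d1) (is_deriveZ _ d2))).
have cphi : {within `[x, y], continuous phi}.
  apply: within_sum => xi; have [c1 c2] := cf xi => z.
  apply: (@cvgM R); first exact: cvg_cst.
  by apply: cvgD; apply: (@cvgM R); try exact: cvg_cst; [exact: c1|exact: c2].
have [c cI E] := MVT xy dphi cphi.
have ES : phi y - phi x = S.
  rewrite /phi -sumrB /S; apply: eq_bigr => xi _.
  by rewrite sqr_normcE /d cReD cImD cReN cImN /re /im; ring.
have pl : phi' c <= (y - x)^-1 / 2 * S + (y - x) / 2 * A ^+ 2.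
  have [_ hc] := hA c ltac:(by move: cI; rewrite in_itv).
  have hs : \sum_(xi <- r) wt g xi * normc (f' c xi) ^+ 2 <= A ^+ 2.
    rewrite -lee_fin; apply: le_trans hc; apply: seq_le_nsum => // xi.
    by rewrite mulr_ge0 ?wt_ge0 ?sqr_ge0.
  apply: (@le_trans _ _ ((y - x)^-1 / 2 * S + (y - x) / 2 * \sum_(xi <- r) wt g xi * normc (f' c xi) ^+ 2)).
    rewrite /phi' /S !mulr_sumr -big_split /=; apply: ler_sum => xi _.
    rewrite !(mulrCA _ (wt g xi)) -mulrDr ler_wpM2l ?wt_ge0// !sqr_normcE.
    move: (complex.Re (d xi)) (complex.Im (d xi)) (complex.Re (f' c xi)) (complex.Im (f' c xi)).
    move: (y - x) yx => h h0 a b p q.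
    rewrite -subr_ge0.
    have -> : h^-1 / 2 * (a ^+ 2 + b ^+ 2) + h / 2 * (p ^+ 2 + q ^+ 2) - (a * p + b * q) =
      ((a - h * p) ^+ 2 + (b - h * q) ^+ 2) / (2 * h) by field; rewrite gt_eqF.
    by rewrite divr_ge0 ?addr_ge0 ?sqr_ge0// mulr_ge0// ltW.
  by rewrite lerD2l ler_wpM2l// divr_ge0// ltW.
have : S <= ((y - x)^-1 / 2 * S + (y - x) / 2 * A ^+ 2) * (y - x).
  by rewrite -{1}ES E ler_wpM2r// ltW.
have -> : ((y - x)^-1 / 2 * S + (y - x) / 2 * A ^+ 2) * (y - x) =
  S / 2 + (A * (y - x)) ^+ 2 / 2 by field; rewrite gt_eqF.
by move: (S) => S'; lra.
Qed.

Lemma conv2_cder (f : R -> int -> int -> C) (f' : int -> int -> C) (m : int -> int -> R) (t d0 : R) xi :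
  0 < d0 -> (forall k l, 0 <= m k l) -> (nsum (fun k => m k (xi - k))%R < +oo)%E ->
  (forall k l, cder (fun s => f s k l) t (f' k l)) ->
  (forall h, `|h| < d0 -> csmb (fun k => f (t + h) k (xi - k))) ->
  (forall k l h, `|h| < d0 -> normc (f (t + h) k l - f t k l) <= m k l * `|h|) ->
  cder (fun s => conv2 (f s) xi) t (conv2 f' xi).
Proof.
move=> d00 m0 mo df sf lip.
apply: (@cder_csum _ (fun s k => f s k (xi - k)) (fun k => f' k (xi - k))
  (fun k => m k (xi - k)) t d0) => //.
by move=> i h; exact: lip.
Qed.

Lemma conv3_cder (g : R) (p q r : int -> R) (f : R -> int -> int -> int -> C) f' (t d0 : R) xi :
  1 / 2 < g -> 0 < d0 -> maj g p -> maj g q -> maj g r ->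
  (forall k l n, cder (fun s => f s k l n) t (f' k l n)) ->
  (forall h, `|h| < d0 -> maj3 g (f (t + h))) ->
  (forall k l n h, `|h| < d0 -> normc (f (t + h) k l n - f t k l n) <= p k * q l * r n * `|h|) ->
  cder (fun s => conv3 (f s) xi) t (conv3 f' xi).
Proof.
move=> g2 d00 mp mq mr df mf lip.
have mpq := maj_rconv g2 mp mq.
have mft : maj3 g (f t) by rewrite -[t]addr0; apply: mf; rewrite normr0.
apply: (@conv2_cder (fun s j n => conv2 (fun k l => f s k l n) j)
   (fun j n => conv2 (fun k l => f' k l n) j) (fun j n => rconv p q j * r n) t d0) => //.
- by move=> j n; rewrite mulr_ge0 ?mpq.1 ?mr.1.
- by rewrite (rconv_E g2 xi mpq mr) ltry.
- move=> j n; apply: (@conv2_cder (fun s k l => f s k l n) _ (fun k l => p k * q l * r n) t d0) => //.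
  + by move=> k l; rewrite !mulr_ge0 ?mp.1 ?mq.1 ?mr.1.
  + rewrite (@eq_nsum _ _ _ (fun k => r n * (p k * q (j - k)))); last by move=> k; rewrite mulrC.
    rewrite nsumZ ?mr.1//; last by move=> k; rewrite mulr_ge0 ?mp.1 ?mq.1.
    by rewrite (rconv_E g2 j mp mq) -EFinM ltry.
  + by move=> h hh; apply: (conv2_csmb g2 j (f := fun k l => f (t + h) k l n)); apply: maj3_inner; exact: mf.
  + by move=> k l h; exact: lip.
- by move=> h hh; apply: (conv2_csmb g2 xi (f := fun j n => conv2 (fun k l => f (t + h) k l n) j)); apply: maj3_outer => //; exact: mf.
- move=> j n h hh.
  rewrite -(conv2B g2); [|by apply: maj3_inner; exact: mf|exact: maj3_inner].
  apply: csum_le.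
  apply: (@le_trans _ _ (nsum (fun k => (r n * `|h|) * (p k * q (j - k)))%R)).
    apply: le_nsum => k; apply: (le_trans (lip _ _ _ _ hh)).
    by rewrite le_eqVlt; apply/orP; left; apply/eqP; ring.
  rewrite nsumZ ?mulr_ge0 ?mr.1//; last by move=> k; rewrite mulr_ge0 ?mp.1 ?mq.1.
  by rewrite (rconv_E g2 j mp mq) -EFinM lee_fin le_eqVlt; apply/orP; left; apply/eqP; ring.
Qed.

End Derivatives.

(** * The local error *)
Section Consistency.
Context {R : realType}.
Local Notation C := R[i].
Local Notation normc := Normc.normc.
Local Opaque nsum.
Implicit Types (k n xi : int) (s t : R) (a b w : int -> C).

(** The symbol of the derivative. *)
Definition zz (k : int) : C := ii k%:~R.
(** The symbol of the projection onto mean zero. *)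
Definition nz (k : int) : C := if k == 0 then 0 else 1.
Definition dz a k := zz k * a k.

Lemma iiM3 (x y u : R) : ii x * ii y * ii u = ii (- (x * y * u)).
Proof. by apply: complexP; rewrite ?cReM ?cImM /=; ring. Qed.

Lemma zzD k l : zz (k + l) = zz k + zz l.
Proof. by rewrite /zz intrD; apply: complexP; rewrite ?cReD ?cImD /=; ring. Qed.

Lemma iiZ (c x : R) : ii (c * x) = c%:C * ii x.
Proof. by apply: complexP; rewrite ?cReM ?cImM /=; ring. Qed.

Lemma zz_iz k : zz k * iz k = nz k.
Proof.
rewrite /nz /iz /zz /ii; have [->|k0] := eqVneq k 0; first by rewrite mulr0.
rewrite mulfV//; apply/eqP => -[] /eqP; rewrite intr_eq0; exact/negP.
Qed.

Lemma nz_iz k : nz k * iz k = iz k.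
Proof. by rewrite /nz /iz; case: ifP; rewrite ?mulr0 ?mul1r. Qed.

Lemma nz_zz k : nz k * zz k = zz k.
Proof.
by rewrite /nz; case: eqVneq => [->|_]; rewrite ?mul1r// mul0r.
Qed.

Lemma normc_ii (x : R) : normc (ii x) = `|x|.
Proof. by rewrite /= expr0n add0r sqrtr_sqr. Qed.

Lemma normc_nz k : normc (nz k) <= 1.
Proof. by rewrite /nz; case: ifP => _; rewrite ?Normc.normc0 ?Normc.normc1. Qed.

Lemma nzK a k : a 0 = 0 -> nz k * a k = a k.
Proof. by move=> a0; rewrite /nz; case: eqVneq => [->|_]; rewrite ?a0 ?mulr0 ?mul1r. Qed.

Lemma zz_Dinv a k : a 0 = 0 -> zz k * Dinv a k = a k.
Proof. by move=> a0; rewrite /Dinv mulrA zz_iz nzK. Qed.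

Lemma iz_dz a k : a 0 = 0 -> iz k * dz a k = a k.
Proof. by move=> a0; rewrite /dz mulrA [iz k * _]mulrC zz_iz nzK. Qed.

(** The spare derivative of the solution is spent here. *)
Lemma hball_dz g a M : hball (g + 1) a M -> hball g (dz a) M.
Proof.
move=> [M0 h]; split => //; apply: le_trans h; apply: le_nsum => k.
rewrite Normc.normcM normc_ii exprMn wtS -mulrA ler_wpM2l ?wt_ge0//.
rewrite ler_wpM2r ?sqr_ge0// real_normK ?num_real//.
by rewrite /jb lerDr.
Qed.

Lemma hball_down g a M : hball (g + 1) a M -> hball g a M.
Proof.
move=> [M0 h]; split => //; apply: le_trans h; apply: le_nsum => k.
rewrite ler_wpM2r ?sqr_ge0// wtS ler_peMr ?wt_ge0//.
exact: jb_ge1.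
Qed.

Lemma absint_ge1 k : k != 0 -> 1 <= `|k%:~R : R|.
Proof. by move=> j0; rewrite -intr_norm -[1]/(1%:~R) ler_int; lia. Qed.

(** A derivative falling on a product costs one derivative on each factor at most,
    because nonzero frequencies are at least 1 in absolute value. *)
Lemma dz_pair a b k l : a 0 = 0 -> b 0 = 0 ->
  `|(k + l)%:~R| * (normc (a k) * normc (b l)) <= 2 * (normc (dz a k) * normc (dz b l)).
Proof.
move=> a0 b0; rewrite !Normc.normcM !normc_ii.
have [->|k0] := eqVneq k 0; first by rewrite a0 Normc.normc0 !(mul0r, mulr0).
have [->|l0] := eqVneq l 0; first by rewrite b0 Normc.normc0 !(mul0r, mulr0).
have := absint_ge1 k0; have := absint_ge1 l0.
have : `|(k + l)%:~R : R| <= `|k%:~R| + `|l%:~R| by rewrite intrD ler_normD.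
move: `|(k + l)%:~R| `|k%:~R| `|l%:~R| => x y u h u1 y1.
rewrite (_ : 2 * _ = 2 * (y * u) * (normc (a k) * normc (b l))); last by ring.
rewrite ler_wpM2r ?mulr_ge0 ?normc_ge0//.
by apply: (le_trans h); nra.
Qed.

Lemma theta_sym t a b xi : theta t a b xi = theta t b a xi.
Proof.
rewrite /theta conv2_sym; apply: eq_conv2 => k l; rewrite /phase2 [l + k]addrC.
by rewrite [b k * _]mulrC; congr (expi (- (t * (3 * _))) * _); ring.
Qed.

Lemma theta00 t a b : theta t a b 0 = theta 0 a b 0.
Proof. by apply: eq_conv2_sum => k l kl; rewrite phase2_0 /phase2 kl !mul0r mulr0 mulr0 oppr0 expi0. Qed.

Lemma quad0 w xi : quad 0 w xi = 0.
Proof.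
rewrite /quad /conv2 -[RHS](csum0 (R := R) int); apply: eq_csum => k.
by rewrite phase2_0 subrr mulr0 mul0r.
Qed.

Lemma quad_mean0 t w : quad t w 0 = 0.
Proof.
rewrite -[RHS](quad0 w 0); apply: eq_conv2_sum => k l kl.
by rewrite phase2_0 /phase2 kl !mul0r mulr0 mulr0 oppr0 expi0.
Qed.

Lemma phase2E t k l : phase2 t k l = expi (- (3 * ((k + l)%:~R * k%:~R * l%:~R)) * t).
Proof. by rewrite /phase2; congr expi; ring. Qed.

Lemma phase3E t k l n :
  phase3 t k l n = expi (- (3 * ((k + l)%:~R * (l + n)%:~R * (n + k)%:~R)) * t).
Proof. by rewrite /phase3; congr expi; ring. Qed.

Lemma phase3_phase2 t k l n : phase3 t k l n = phase2 t (k + l) n * phase2 t k l.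
Proof. by rewrite /phase2 /phase3 -expiD; congr expi; rewrite !intrD; ring. Qed.

(** The time derivative of the logarithm of [phase2]. *)
Definition freq2 k l : C := ii (- (3 * ((k + l)%:~R * k%:~R * l%:~R))).
Definition freq3 k l n : C := ii (- (3 * ((k + l)%:~R * (l + n)%:~R * (n + k)%:~R))).

(** The phase frequency is divisible by the symbols of the derivative of the output
    and of both inputs; this is what makes integration by parts in time gain
    derivatives. *)
Lemma freq2E k l : freq2 k l = 3 * (zz (k + l) * zz k * zz l).
Proof.
rewrite /freq2 /zz iiM3 -mulrN iiZ; congr (_ * _).
by rewrite -(rmorph_nat (real_complex R)).
Qed.

(** Unlike [freq2E], the factors are sums of two frequencies, so this phase is
    resonant; expanding it gives [bdry_der_E]. *)
Lemma freq3E k l n : freq3 k l n = 3 * ((zz k + zz l) * (zz l + zz n) * (zz n + zz k)).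
Proof.
rewrite -!zzD /freq3 /zz iiM3 -mulrN iiZ; congr (_ * _).
by rewrite -(rmorph_nat (real_complex R)).
Qed.

Lemma cder_phase2 t k l : cder (fun s => phase2 s k l) t (freq2 k l * phase2 t k l).
Proof.
by apply: cder_ext (cder_expi _ t) => [s|]; rewrite ?phase2E.
Qed.

Lemma cder_phase3 t k l n : cder (fun s => phase3 s k l n) t (freq3 k l n * phase3 t k l n).
Proof.
by apply: cder_ext (cder_expi _ t) => [s|]; rewrite ?phase3E.
Qed.

Lemma phase2_lip s t k l : normc (phase2 s k l - phase2 t k l) <=
  3 * (`|(k + l)%:~R| * `|k%:~R| * `|l%:~R|) * `|s - t|.
Proof.
rewrite !phase2E; apply: (le_trans (expi_sub _ _)).
by rewrite -mulrBr normrM normrN normrM (ger0_norm (ler0n R 3)) !normrM.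
Qed.

(** The largest value at frequency [k] of a sequence in the unit ball: a single
    square-summable majorant for all times, as differentiation under a sum
    needs. *)
Definition envel (g : R) k : R := (Num.sqrt (wt g k))^-1.

Lemma envel_ge0 g k : 0 <= envel g k.
Proof. by rewrite invr_ge0 sqrtr_ge0. Qed.

Lemma rball_envel g : 1 / 2 < g -> exists2 A, 0 < A & rball 0 (envel g) A.
Proof.
move=> g2; exists (Num.sqrt (Wsum g)); first by rewrite sqrtr_gt0 Wsum_gt0.
split; first by rewrite sqrtr_gt0 Wsum_gt0.
rewrite sqr_sqrtr ?(ltW (Wsum_gt0 g2))// /Wsum -nsum_fineK; [|exact: iwt_ge0|exact: nsum_iwt_lt].
apply: le_nsum => k; rewrite /wt powRr0 mul1r /envel exprVn sqr_sqrtr//.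
exact: wt_ge0.
Qed.

Lemma hball_envel g a A k : hball g a A -> normc (a k) <= A * envel g k.
Proof.
move=> [A0 h]; rewrite /envel ler_pdivlMr ?sqrtr_gt0 ?wt_gt0//.
rewrite -(@ler_pXn2r _ 2)// ?nnegrE ?mulr_ge0 ?normc_ge0 ?sqrtr_ge0 ?(ltW A0)//.
rewrite exprMn sqr_sqrtr ?wt_ge0// mulrC -lee_fin; apply: le_trans h.
apply: (@term_le_nsum _ _ (fun k => wt g k * normc (a k) ^+ 2)) => i.
by rewrite mulr_ge0 ?wt_ge0 ?sqr_ge0.
Qed.

Lemma envel_lt g xi : 1 / 2 < g -> exists2 A, 0 < A &
  (nsum (fun k => envel g k * envel g (xi - k))%R <= A%:E)%E.
Proof.
move=> g2; have [A A0 hA] := rball_envel g2; exists (A * A); first by rewrite mulr_gt0.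
by apply: (rconv_lt xi (lexx 0) _ _ hA hA) => k; exact: envel_ge0.
Qed.

Section Fix.
Variable (g M : R).
Hypothesis g2 : 1 / 2 < g.
Hypothesis M0 : 0 < M.
Let kap0 : 0 < kap g. Proof. exact: kap_gt0. Qed.
Let g0 : 0 <= g. Proof. by move: g2; lra. Qed.

Variables (tau : R) (v : R -> int -> C).
Hypothesis tau0 : 0 < tau.
Hypothesis V0 : forall s, 0 <= s <= tau -> v s 0 = 0.
Hypothesis V1 : forall s, 0 <= s <= tau -> hball (g + 1) (v s) M.
Hypothesis V2 : forall xi, ccont (v^~ xi) 0 tau.
(** The equation for the twisted solution. *)
Definition rhs s xi : C := 2^-1 * zz xi * theta s (v s) (v s) xi.
Hypothesis V3 : forall s xi, 0 < s < tau -> cder (v^~ xi) s (rhs s xi).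

Let in0 : (0 : R) <= 0 <= tau. Proof. by rewrite lexx ltW. Qed.
Let oc s : 0 < s < tau -> 0 <= s <= tau.
Proof. by move=> /andP[a b]; rewrite !ltW. Qed.

Lemma v_hball s : 0 <= s <= tau -> hball g (v s) M.
Proof. by move=> sI; apply: hball_down; exact: V1. Qed.

Lemma v_dz s : 0 <= s <= tau -> hball g (dz (v s)) M.
Proof. by move=> sI; apply: hball_dz; exact: V1. Qed.

Definition rhs_bnd := kap g * M * M.
Let A10 : 0 < rhs_bnd. Proof. by rewrite /rhs_bnd !mulr_gt0. Qed.

Lemma normc_half : normc (2^-1 : C) = 2^-1.
Proof. exact: (normc_inv_nat 1). Qed.

(** The derivative in front of the product is controlled by the extra derivative of
    the solution ([dz_pair]). *)
Lemma rhs_hball s : 0 <= s <= tau -> hball g (rhs s) rhs_bnd.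
Proof.
move=> sI; have hv := v_hball sI; have hd := v_dz sI.
have := conv2_hball g2 (f := fun k l => 2^-1 * zz (k + l) * (phase2 s k l * (v s k * v s l))) ltr01 hd hd.
rewrite mul1r => h; apply: hball_ext (h _) => [xi|k l].
  by rewrite /rhs /theta -(conv2_diag g2 (fun k => 2^-1 * zz k))//; exact: (maj2_theta _ hv hv).
have := dz_pair k l (V0 sI) (V0 sI).
by rewrite !Normc.normcM normc_half !normc_ii normc_phase2; lra.
Qed.

Lemma v_lip s t : 0 <= s -> s < t -> t <= tau ->
  hball g (fun xi => v t xi - v s xi) (rhs_bnd * (t - s)).
Proof.
move=> s0 st tt; apply: (@vector_mvt _ g v rhs) => //.
- move=> r xi /andP[sr rt]; apply: V3.
  by rewrite (le_lt_trans s0 sr) (lt_le_trans rt).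
- by move=> xi; apply: ccont_sub (V2 xi).
- move=> r /andP[sr rt]; apply: rhs_hball.
  by rewrite (le_trans s0 (ltW sr)) (le_trans (ltW rt)).
Qed.

Lemma v_lipU s t k : 0 <= s <= tau -> 0 <= t <= tau ->
  normc (v s k - v t k) <= rhs_bnd * `|s - t| * envel g k.
Proof.
wlog st : s t / t < s => [h sI tI|/andP[s0 s1] /andP[t0 t1]].
  have [st|st|->] := ltgtP s t; last first.
  - by rewrite !subrr Normc.normc0 normr0 mulr0 mul0r.
  - exact: h.
  - by rewrite -normcN opprB distrC; exact: h.
have := hball_envel k (v_lip t0 st s1); rewrite gtr0_norm//.
by rewrite subr_gt0.
Qed.

Definition quad_der s xi : C := 2^-1 * zz xi * theta s (v 0) (v 0) xi.

Lemma cder_quad s xi : cder (fun s => quad s (v 0) xi) s (quad_der s xi).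
Proof.
have hv := v_hball in0; have hd := v_dz in0; have v00 := V0 in0.
rewrite /quad_der /theta -(conv2_diag g2 (fun k => 2^-1 * zz k)); last exact: (maj2_theta _ hv hv).
apply: (@conv2_cder _ (fun s k l => 6^-1 * (phase2 s k l - 1) * (Dinv (v 0) k * Dinv (v 0) l)) _
   (fun k l => normc (dz (v 0) k) * normc (dz (v 0) l)) s 1) => //.
- by move=> k l; rewrite mulr_ge0 ?normc_ge0.
- have [d0 dM] := hd.
  apply: le_lt_trans (rconv_lt xi g0 _ _ hd hd) _; rewrite ?ltry// => k; exact: normc_ge0.
- move=> k l.
  have h := cderM (cderZ (6^-1) (cderB (cder_phase2 s k l) (cder_cst 1 s))) (cder_cst (Dinv (v 0) k * Dinv (v 0) l) s).
  apply: cder_ext h => //; rewrite freq2E.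
  rewrite -[in RHS](zz_Dinv k v00) -[in RHS](zz_Dinv l v00).
  by move: (Dinv (v 0) k) (Dinv (v 0) l) => p q; field.
- by move=> h _; exact: (conv2_csmb g2 xi (maj2_quad (s + h) hv)).
- move=> k l h _.
  have -> : 6^-1 * (phase2 (s + h) k l - 1) * (Dinv (v 0) k * Dinv (v 0) l) -
    6^-1 * (phase2 s k l - 1) * (Dinv (v 0) k * Dinv (v 0) l) =
    6^-1 * (phase2 (s + h) k l - phase2 s k l) * (Dinv (v 0) k * Dinv (v 0) l) by ring.
  rewrite !Normc.normcM (normc_inv_nat 5) !normc_iz.
  have := phase2_lip (s + h) s k l; rewrite [s + h - s]addrC addKr.
  have := dz_pair k l v00 v00; rewrite !Normc.normcM !normc_ii.
  have i1 := invM_le1 (normr_ge0 (k%:~R : R)); have i2 := invM_le1 (normr_ge0 (l%:~R : R)).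
  have i3 := invM_ge0 (normr_ge0 (k%:~R : R)); have i4 := invM_ge0 (normr_ge0 (l%:~R : R)).
  move: i1 i2 i3 i4.
  have := normr_ge0 ((k + l)%:~R : R); have := normc_ge0 (v 0 k); have := normc_ge0 (v 0 l).
  have := normr_ge0 h; have := normr_ge0 (k%:~R : R); have := normr_ge0 (l%:~R : R).
  move: (normc (phase2 (s + h) k l - phase2 s k l)) `|(k + l)%:~R| `|k%:~R| `|l%:~R| `|h| (normc (v 0 k)) (normc (v 0 l)).
  move=> E x y u c p q u0 y0 c0 q0 p0 x0 i1 i2 i3 i4 D Eb.
  apply: (@le_trans _ _ (6^-1 * (3 * (x * y * u) * c) * (y^-1 * p * (u^-1 * q)))).
    by rewrite ler_wpM2r ?mulr_ge0 ?invr_ge0// ler_wpM2l.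
  have -> : 6^-1 * (3 * (x * y * u) * c) * (y^-1 * p * (u^-1 * q)) =
    (x * (p * q)) / 2 * ((y^-1 * y) * (u^-1 * u)) * c.
    by move: (y^-1) (u^-1) => a b; field.
  rewrite ler_wpM2r//; apply: (@le_trans _ _ (x * (p * q) / 2)).
    by rewrite ler_piMr ?divr_ge0 ?mulr_ge0// mulr_ile1.
  by rewrite ler_pdivrMr//; move: D; lra.
Qed.

(** The error of the first order expansion of the solution, after an inverse
    derivative, which cancels the derivative in the equation. *)
Definition lowdef s xi : C := Dinv (v s) xi - Dinv (v 0) xi - Dinv (quad s (v 0)) xi.
Definition lowdef_der s xi : C :=
  2^-1 * nz xi * (theta s (v s) (v s) xi - theta s (v 0) (v 0) xi).

Lemma theta_diff t a b A xi : hball g a A -> hball g b A ->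
  theta t a a xi - theta t b b xi =
  theta t (fun k => a k - b k) a xi + theta t b (fun k => a k - b k) xi.
Proof.
move=> ha hb'; have hab := hballB ha hb'.
rewrite /theta -(conv2B g2 xi (maj2_theta t ha ha) (maj2_theta t hb' hb')).
rewrite -(conv2D g2 xi (maj2_theta t hab ha) (maj2_theta t hb' hab)).
by apply: eq_conv2 => k l; ring.
Qed.

(** The time derivative is a difference of twisted squares of [v s] and [v 0], hence of
    size [s]. *)
Lemma lowdef_hball : hball g (lowdef tau) (kap g * M * rhs_bnd * tau * tau).
Proof.
have e0 : lowdef tau =1 (fun xi => lowdef tau xi - lowdef 0 xi).
  by move=> xi; rewrite {3}/lowdef /Dinv quad0; ring.
apply: (hball_ext (fun xi => esym (e0 xi))).
rewrite -[X in hball _ _ (_ * X)]subr0; apply: (@vector_mvt _ g lowdef lowdef_der) => //.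
- by rewrite !mulr_gt0.
- move=> s xi sI.
  have h := cderB (cderB (cderZ (iz xi) (V3 xi sI)) (cder_cst (Dinv (v 0) xi) s))
    (cderZ (iz xi) (cder_quad s xi)).
  apply: cder_ext h => //; rewrite /rhs /quad_der /lowdef_der -zz_iz; ring.
- move=> xi; apply: ccontD; first apply: ccontD.
  + by apply: ccontZ; exact: V2.
  + exact: ccont_cst.
  + apply: (@cder_ccont _ _ (fun s => - (iz xi * quad_der s xi))) => s.
    exact: cderN (cderZ _ (cder_quad s xi)).
- move=> s sI; have sI' := oc sI; have hs := v_hball sI'; have h0 := v_hball in0.
  have /andP[s0 st] := sI.
  have hd := v_lip (lexx 0) s0 (ltW st); rewrite subr0 in hd.
  have h := hballD (theta_hball g2 s hd hs) (theta_hball g2 s h0 hd).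
  have c0 : 0 < 2^-1 :> R by rewrite invr_gt0.
  apply: (hball_le (b := lowdef_der s) (hball_dom (b := lowdef_der s) c0 _ h)) => //.
    move=> xi; rewrite /lowdef_der (theta_diff s xi hs h0) Normc.normcM.
    rewrite ler_wpM2r ?normc_ge0// Normc.normcM normc_half ler_piMr// normc_nz//.
  have -> : 2^-1 * (kap g * (rhs_bnd * s) * M + kap g * M * (rhs_bnd * s)) = kap g * M * rhs_bnd * s by field.
  by rewrite ler_wpM2l ?ltW// !mulr_gt0.
Qed.

Definition tsq_K : R := 6 * M ^+ 2 + 2 * rhs_bnd * M.

Lemma tsq_K_gt0 : 0 < tsq_K.
Proof. by rewrite addr_gt0// !mulr_gt0// exprn_gt0. Qed.

Lemma dzv_U s k : 0 <= s <= tau -> normc (dz (v s) k) <= M * envel g k.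
Proof. by move=> sI; apply: hball_envel; exact: v_dz. Qed.

Lemma Dv_U s k : 0 <= s <= tau -> normc (Dinv (v s) k) <= M * envel g k.
Proof. by move=> sI; apply: hball_envel; apply: hball_Dinv; exact: v_hball. Qed.

Lemma Dv_lipU s t k : 0 <= s <= tau -> 0 <= t <= tau ->
  normc (Dinv (v s) k - Dinv (v t) k) <= rhs_bnd * `|s - t| * envel g k.
Proof.
move=> sI tI; apply: le_trans (v_lipU k sI tI).
rewrite /Dinv -mulrBr Normc.normcM ler_piMl ?normc_ge0 ?normc_iz_le1//.
Qed.

Lemma absD_le s k : 0 <= s <= tau -> `|k%:~R| * normc (Dinv (v s) k) <= normc (v s k).
Proof. by move=> sI; rewrite -normc_ii -Normc.normcM -/(zz k) zz_Dinv// V0. Qed.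

Lemma thetaDD_lip s t k l : 0 <= s <= tau -> 0 <= t <= tau ->
  normc (phase2 s k l * (Dinv (v s) k * Dinv (v s) l) - phase2 t k l * (Dinv (v t) k * Dinv (v t) l))
  <= tsq_K * (envel g k * envel g l) * `|s - t|.
Proof.
move=> sI tI.
have -> : phase2 s k l * (Dinv (v s) k * Dinv (v s) l) - phase2 t k l * (Dinv (v t) k * Dinv (v t) l) =
  (phase2 s k l - phase2 t k l) * (Dinv (v s) k * Dinv (v s) l) +
  (phase2 t k l * ((Dinv (v s) k - Dinv (v t) k) * Dinv (v s) l) +
   phase2 t k l * (Dinv (v t) k * (Dinv (v s) l - Dinv (v t) l))) by ring.
have b1 : normc ((phase2 s k l - phase2 t k l) * (Dinv (v s) k * Dinv (v s) l)) <=
    6 * M ^+ 2 * (envel g k * envel g l) * `|s - t|.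
  rewrite Normc.normcM [normc (Dinv _ _ * _)]Normc.normcM.
  apply: (@le_trans _ _ (3 * (`|(k + l)%:~R| * `|k%:~R| * `|l%:~R|) * `|s - t| *
     (normc (Dinv (v s) k) * normc (Dinv (v s) l)))).
    by rewrite ler_wpM2r ?mulr_ge0 ?normc_ge0// phase2_lip.
  apply: (@le_trans _ _ (3 * (`|(k + l)%:~R| * (normc (v s k) * normc (v s l))) * `|s - t|)).
    rewrite (_ : 3 * _ * _ * _ = 3 * (`|(k + l)%:~R| * ((`|k%:~R| * normc (Dinv (v s) k)) *
      (`|l%:~R| * normc (Dinv (v s) l)))) * `|s - t|); last by ring.
    rewrite ler_wpM2r// ler_wpM2l// ler_wpM2l// ler_pM ?mulr_ge0 ?normc_ge0//.
      exact: absD_le.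
    exact: absD_le.
  have h1 := dz_pair k l (V0 sI) (V0 sI).
  have h2 : normc (dz (v s) k) * normc (dz (v s) l) <= (M * envel g k) * (M * envel g l).
    by apply: ler_pM; rewrite ?normc_ge0// dzv_U.
  rewrite ler_wpM2r//; move: h1 h2; rewrite expr2; lra.
have b2 : normc (phase2 t k l * ((Dinv (v s) k - Dinv (v t) k) * Dinv (v s) l)) <=
    rhs_bnd * M * (envel g k * envel g l) * `|s - t|.
  rewrite Normc.normcM normc_phase2 mul1r Normc.normcM.
  have h : normc (Dinv (v s) k - Dinv (v t) k) * normc (Dinv (v s) l) <=
     (rhs_bnd * `|s - t| * envel g k) * (M * envel g l).
    by apply: ler_pM; rewrite ?normc_ge0// ?Dv_lipU// Dv_U.
  by move: h; lra.
have b3 : normc (phase2 t k l * (Dinv (v t) k * (Dinv (v s) l - Dinv (v t) l))) <=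
    rhs_bnd * M * (envel g k * envel g l) * `|s - t|.
  rewrite Normc.normcM normc_phase2 mul1r Normc.normcM.
  have h : normc (Dinv (v t) k) * normc (Dinv (v s) l - Dinv (v t) l) <=
     (M * envel g k) * (rhs_bnd * `|s - t| * envel g l).
    by apply: ler_pM; rewrite ?normc_ge0// ?Dv_lipU// Dv_U.
  by move: h; lra.
apply: (le_trans (le_normcD _ _)); apply: (le_trans (lerD b1 (le_normcD _ _))).
by move: b2 b3; rewrite /tsq_K; lra.
Qed.

Lemma envel_conv_lt xi c : 0 <= c -> (nsum (fun k => c * (envel g k * envel g (xi - k)))%R < +oo)%E.
Proof.
move=> c0; have [A A0 h] := envel_lt xi g2.
rewrite nsumZ//; last by move=> k; rewrite mulr_ge0 ?envel_ge0.
have U0 k : 0 <= envel g k * envel g (xi - k) by rewrite mulr_ge0 ?envel_ge0.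
by have [r _ ->] := nsum_fin U0 h; rewrite -EFinM ltry.
Qed.

(** A sixth of this twisted square is the quadratic normal form of the equation. *)
Definition tsq s xi : C := theta s (Dinv (v s)) (Dinv (v s)) xi.
Definition tsq_der s xi : C := 3 * zz xi * theta s (v s) (v s) xi
  + 2 * theta s (Dinv (rhs s)) (Dinv (v s)) xi.

(** When the derivative hits the phase it reproduces the quadratic term of the
    equation by [freq2E]; when it hits [v] it gives a cubic term in which the
    derivative of the equation meets an inverse derivative. *)
Lemma cder_tsq s xi : 0 < s < tau -> cder (fun s => tsq s xi) s (tsq_der s xi).
Proof.
move=> sI; have sI' := oc sI; have hv := v_hball sI'; have v00 := V0 sI'.
have hD := hball_Dinv hv; have hvd := hball_Dinv (rhs_hball sI').
have -> : tsq_der s xi = conv2 (fun k l => freq2 k l * phase2 s k l * (Dinv (v s) k * Dinv (v s) l) +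
   phase2 s k l * (Dinv (rhs s) k * Dinv (v s) l + Dinv (v s) k * Dinv (rhs s) l)) xi.
  have m1 := maj2_theta s hv hv; have m2 := maj2_theta s hvd hD; have m3 := maj2_theta s hD hvd.
  rewrite /tsq_der (_ : 2 * _ = theta s (Dinv (rhs s)) (Dinv (v s)) xi +
    theta s (Dinv (v s)) (Dinv (rhs s)) xi); last by rewrite (theta_sym s (Dinv (v s))); ring.
  have -> : 3 * zz xi * theta s (v s) (v s) xi =
     conv2 (fun k l => 3 * zz (k + l) * (phase2 s k l * (v s k * v s l))) xi.
    by rewrite (conv2_diag g2 (fun k => 3 * zz k) xi m1).
  have m4 : maj2 g (fun k l => 3 * zz (k + l) * (phase2 s k l * (v s k * v s l))).
    apply: (maj2_hball (c := 6) _ (v_dz sI') (v_dz sI')) => // k l.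
    have := dz_pair k l v00 v00; rewrite !Normc.normcM !normc_ii normc_phase2.
    rewrite (_ : normc (3 : C) = 3); last first.
      by rewrite -(rmorph_nat (real_complex R)) normcR ger0_norm.
    by lra.
  have m5 := maj2D m2 m3.
  rewrite /theta -(conv2D g2 xi m2 m3) -(conv2D g2 xi m4 m5); apply: eq_conv2 => k l.
  rewrite freq2E -[in LHS](zz_Dinv k v00) -[in LHS](zz_Dinv l v00).
  by move: (Dinv (v s) k) (Dinv (v s) l) (Dinv (rhs s) k) (Dinv (rhs s) l) => p q r u; ring.
pose d0 := Num.min s (tau - s).
have d00 : 0 < d0 by rewrite lt_min; case/andP: sI => -> h; rewrite subr_gt0.
have shI h : `|h| < d0 -> 0 <= s + h <= tau.
  rewrite lt_min => /andP[]; rewrite !ltr_norml => /andP[a b] /andP[c e].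
  by apply/andP; split; lra.
apply: (@conv2_cder _ (fun s k l => phase2 s k l * (Dinv (v s) k * Dinv (v s) l)) _
   (fun k l => tsq_K * (envel g k * envel g l)) s d0) => //.
- by move=> k l; rewrite !mulr_ge0 ?envel_ge0// ltW// tsq_K_gt0.
- by apply: envel_conv_lt; rewrite ltW// tsq_K_gt0.
- move=> k l.
  have hD' j := cderZ (iz j) (V3 j sI).
  exact: cderM (cder_phase2 s k l) (cderM (hD' k) (hD' l)).
- by move=> h /shI hI; have hh := hball_Dinv (v_hball hI); exact: (conv2_csmb g2 xi (maj2_theta (s + h) hh hh)).
- move=> k l h /shI hI; have := thetaDD_lip k l hI sI'.
  by rewrite [s + h - s]addrC addKr.
Qed.

Lemma ccont_tsq xi : ccont (fun s => tsq s xi) 0 tau.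
Proof.
have [A A0 hA] := envel_lt xi g2.
apply: (@lip_ccont _ _ _ _ (tsq_K * A)) => s t sI tI.
have hs := hball_Dinv (v_hball sI); have ht := hball_Dinv (v_hball tI).
rewrite /tsq /theta -(conv2B g2 xi (maj2_theta s hs hs) (maj2_theta t ht ht)).
apply: csum_le.
apply: (@le_trans _ _ (nsum (fun k => (tsq_K * `|s - t|) * (envel g k * envel g (xi - k)))%R)).
  apply: le_nsum => k; apply: (le_trans (thetaDD_lip _ _ sI tI)).
  by rewrite mulrAC.
have U0 k : 0 <= envel g k * envel g (xi - k) by rewrite mulr_ge0 ?envel_ge0.
have c0 : 0 <= tsq_K * `|s - t| by rewrite mulr_ge0// ltW// tsq_K_gt0.
rewrite nsumZ//; have [r /andP[_ rA] ->] := nsum_fin U0 hA.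
by rewrite -EFinM lee_fin [leRHS]mulrAC ler_wpM2l.
Qed.

Definition tcub1 s w xi : C := conv3 (fun k l n => phase3 s k l n * (w k * w l * Dinv w n)) xi.
Definition tcub s w xi : C := conv3 (fun k l n => phase3 s k l n * (w k * w l * w n)) xi.
(** The cubic equation satisfied by the normal form, with the derivative lost in the
    original equation cancelled. *)
Definition crhs s w xi : C :=
  - 6^-1 * nz xi * theta s (fun j => nz j * theta s w w j) (Dinv w) xi.

Lemma normc_phase3 s k l n : normc (phase3 s k l n) = 1.
Proof. exact: normc_expi. Qed.

Lemma maj3_phase3 s a b e A B E : hball g a A -> hball g b B -> hball g e E ->
  maj3 g (fun k l n => phase3 s k l n * (a k * b l * e n)).
Proof. by move=> ha hb' he; apply: (maj3_mul ler01 _ ha hb' he) => k l n; rewrite normc_phase3. Qed.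

Lemma phase3_sym12 s k l n : phase3 s l k n = phase3 s k l n.
Proof. by rewrite /phase3 [l + k]addrC [k + n]addrC [n + l]addrC; congr (expi (- (s * (3 * _)))); ring. Qed.

Lemma phase3_sym23 s k l n : phase3 s k n l = phase3 s k l n.
Proof.
rewrite /phase3 [k + n]addrC [n + l]addrC [l + k]addrC.
by congr (expi (- (s * (3 * _)))); ring.
Qed.

Lemma tcub1_sym23 s w A xi : hball g w A ->
  conv3 (fun k l n => phase3 s k l n * (w k * w n * Dinv w l)) xi = tcub1 s w xi.
Proof.
move=> hw; have hD := hball_Dinv hw.
rewrite /tcub1 (conv3_sym23 g2 xi (maj3_phase3 s hw hw hD)).
by apply: eq_conv3 => k l n; rewrite phase3_sym23.
Qed.

Lemma tcub1_sym13 s w A xi : hball g w A ->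
  conv3 (fun k l n => phase3 s k l n * (w l * w n * Dinv w k)) xi = tcub1 s w xi.
Proof.
move=> hw; rewrite -(tcub1_sym23 s xi hw) conv3_sym12.
by apply: eq_conv3 => k l n; rewrite phase3_sym12.
Qed.

(** The projection in the inner product removes the pairs of opposite frequencies;
    these are the resonant interactions and give the mass times [Dinv w]. *)
Lemma theta_tcub1 s w A xi : hball g w A ->
  theta s (fun j => nz j * theta s w w j) (Dinv w) xi = tcub1 s w xi - theta 0 w w 0 * Dinv w xi.
Proof.
move=> hw; have hD := hball_Dinv hw; have hth := theta_hball g2 s hw hw.
have hnz : hball g (fun j => nz j * theta s w w j) (kap g * A * A).
  apply: (hball_le hth) => // k; rewrite Normc.normcM ler_piMl ?normc_ge0 ?normc_nz//.
have hz : hball g (fun j => (1 - nz j) * theta s w w j) (2 * (kap g * A * A)).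
  apply: (hball_dom _ _ hth) => // k; rewrite Normc.normcM ler_wpM2r ?normc_ge0//.
  apply: (le_trans (normcB_le _ _)); rewrite Normc.normc1 (_ : 2 = 1 + 1)// lerD2l.
  exact: normc_nz.
have -> : tcub1 s w xi = theta s (theta s w w) (Dinv w) xi.
  apply: eq_conv2 => j n; rewrite /theta.
  have := conv2_diag g2 (fun i => phase2 s i n * Dinv w n) j (maj2_theta s hw hw).
  rewrite (_ : phase2 s j n * (_ * Dinv w n) = phase2 s j n * Dinv w n * conv2 (fun k l => phase2 s k l * (w k * w l)) j); last by ring.
  move=> <-; apply: eq_conv2 => k l; rewrite phase3_phase2; ring.
have -> : theta 0 w w 0 * Dinv w xi = theta s (fun j => (1 - nz j) * theta s w w j) (Dinv w) xi.
  rewrite /theta {2}/conv2 (@csum1 _ _ _ (0 : int)).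
    change (theta 0 w w 0 * Dinv w xi = phase2 s 0 (xi - 0) * ((1 - nz 0) * theta s w w 0 * Dinv w (xi - 0))).
    have -> : nz 0 = 0 by [].
    rewrite !subr0 mul1r theta00.
    by rewrite /phase2 !(mul0r, mulr0, oppr0) expi0 mul1r.
  by move=> j j0; rewrite /nz (negPf j0) subrr !(mul0r, mulr0).
apply: (@addIr _ (theta s (fun j => (1 - nz j) * theta s w w j) (Dinv w) xi)).
rewrite subrK; apply: (etrans (esym (conv2D g2 xi (maj2_theta s hnz hD) (maj2_theta s hz hD)))).
by apply: eq_conv2 => k l; ring.
Qed.

Definition bdry_der s xi : C :=
  conv3 (fun k l n => iz (k + l + n) * (freq3 k l n * phase3 s k l n) * (Dinv (v 0) k * Dinv (v 0) l * Dinv (v 0) n)) xi.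

Lemma cder_bdry s xi : cder (fun s => bdry s (v 0) xi) s (bdry_der s xi).
Proof.
have hv := v_hball in0; have hD := hball_Dinv hv.
have m1 := maj_hball (ltr01 : 0 < 1 :> R) hv.
have m12 := maj_hball (_ : 0 < 12 :> R) hv.
apply: (@conv3_cder _ g (fun k => 12 * normc (v 0 k)) (fun k => 1 * normc (v 0 k))
   (fun k => 1 * normc (v 0 k))
   (fun s k l n => iz (k + l + n) * (phase3 s k l n - 1) * (Dinv (v 0) k * Dinv (v 0) l * Dinv (v 0) n)) _ s 1) => //.
- exact: m12.
- move=> k l n.
  have h := cderM (cderZ (iz (k + l + n)) (cderB (cder_phase3 s k l n) (cder_cst 1 s)))
     (cder_cst (Dinv (v 0) k * Dinv (v 0) l * Dinv (v 0) n) s).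
  by apply: cder_ext h => //; rewrite subr0 mulr0 addr0.
- move=> h _; apply: (maj3_mul (c := 2) _ _ hD hD hD) => // k l n.
  rewrite Normc.normcM; apply: (@le_trans _ _ (1 * 2)); last by rewrite mul1r.
  apply: ler_pM; rewrite ?normc_ge0 ?normc_iz_le1//.
  by apply: (le_trans (normcB_le _ _)); rewrite normc_phase3 Normc.normc1.
- move=> k l n h _.
  have -> : iz (k + l + n) * (phase3 (s + h) k l n - 1) * (Dinv (v 0) k * Dinv (v 0) l * Dinv (v 0) n)
    - iz (k + l + n) * (phase3 s k l n - 1) * (Dinv (v 0) k * Dinv (v 0) l * Dinv (v 0) n) =
    phase3 s k l n * (iz (k + l + n) * (phase3 h k l n - 1) * (iz k * iz l * iz n) * (v 0 k * v 0 l * v 0 n)).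
    have -> : phase3 (s + h) k l n = phase3 s k l n * phase3 h k l n.
      by rewrite !phase3E -expiD; congr expi; ring.
    by rewrite /Dinv; ring.
  rewrite Normc.normcM normc_phase3 mul1r Normc.normcM [normc (v 0 k * _ * _)]Normc.normcM [normc (v 0 k * _)]Normc.normcM.
  have b := mult_bdry h k l n.
  rewrite !mul1r (_ : 12 * _ * _ * _ * _ = 12 * `|h| * (normc (v 0 k) * normc (v 0 l) * normc (v 0 n))); last by ring.
  by rewrite ler_wpM2r ?mulr_ge0 ?normc_ge0.
Qed.

(** The expansion (z_k + z_l) (z_l + z_n) (z_n + z_k) =
    (z_k + z_l + z_n) (z_k z_l + z_l z_n + z_n z_k) - z_k z_l z_n, summed with
    the symmetries of the phase. *)
Lemma bdry_der_E s xi : bdry_der s xi = 9 * nz xi * tcub1 s (v 0) xi - 3 * iz xi * tcub s (v 0) xi.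
Proof.
have hv := v_hball in0; have hD := hball_Dinv hv; have v00 := V0 in0.
set w := v 0 in hv hD v00 *.
have M1 := maj3_phase3 s hv hv hD; have M0' := maj3_phase3 s hv hv hv.
have M2 : maj3 g (fun k l n => phase3 s k l n * (w k * w n * Dinv w l)).
  by apply: (maj3_hball ler01 hv hD hv) => k l n; rewrite !Normc.normcM normc_phase3; lra.
have M3 : maj3 g (fun k l n => phase3 s k l n * (w l * w n * Dinv w k)).
  by apply: (maj3_hball ler01 hD hv hv) => k l n; rewrite !Normc.normcM normc_phase3; lra.
have -> : 9 * nz xi * tcub1 s w xi = 3 * nz xi * (tcub1 s w xi + conv3 (fun k l n => phase3 s k l n * (w k * w n * Dinv w l)) xi
   + conv3 (fun k l n => phase3 s k l n * (w l * w n * Dinv w k)) xi).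
  by rewrite (tcub1_sym23 s xi hv) (tcub1_sym13 s xi hv); ring.
rewrite !mulrDr /tcub1 /tcub -!(conv3_diag g2 (fun i => 3 * nz i))// -(conv3_diag g2 (fun i => 3 * iz i))//.
have n3 : normc (3 : C) = 3 by rewrite -(rmorph_nat (real_complex R)) normcR ger0_norm.
have D (h : int -> C) f : (forall i, normc (h i) <= 1) -> maj3 g f ->
    maj3 g (fun k l n => 3 * h (k + l + n) * f k l n).
  move=> h1; apply: (maj3_dom (c := 3)) => // k l n.
  by rewrite !Normc.normcM n3 ler_wpM2r ?normc_ge0// ler_piMr.
have D1 := D _ _ normc_nz M1; have D2 := D _ _ normc_nz M2; have D3 := D _ _ normc_nz M3.
have D0 := D _ _ normc_iz_le1 M0'.
rewrite -(conv3D g2 xi D1 D2) -(conv3D g2 xi (maj3D D1 D2) D3) -(conv3B g2 xi (maj3D (maj3D D1 D2) D3) D0).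
apply: eq_conv3 => k l n; rewrite freq3E -zz_iz.
rewrite -[w k in RHS](zz_Dinv k v00) -[w l in RHS](zz_Dinv l v00) -[w n in RHS](zz_Dinv n v00).
have -> : zz (k + l + n) = zz k + zz l + zz n by rewrite !zzD.
move: (iz (k + l + n)) (zz k) (zz l) (zz n) (phase3 s k l n) (Dinv w k) (Dinv w l) (Dinv w n).
by move=> *; ring.
Qed.

(** The error of replacing the phase by 1 in the inverse derivative of the cube. *)
Definition osc3 s xi : C :=
  conv3 (fun k l n => iz (k + l + n) * ((phase3 s k l n - 1) * (v 0 k * v 0 l * v 0 n))) xi.

Lemma osc3_E s xi : osc3 s xi = iz xi * tcub s (v 0) xi - Dinv (cube (v 0)) xi.
Proof.
have hv := v_hball in0; have M1 := maj3_phase3 s hv hv hv.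
have M2 : maj3 g (fun k l n => v 0 k * v 0 l * v 0 n).
  by apply: (maj3_hball ler01 hv hv hv) => k l n; rewrite mul1r !Normc.normcM.
rewrite /Dinv /tcub /cube -mulrBr -(conv3B g2 xi M1 M2) -(conv3_diag g2 iz).
  by apply: eq_conv3 => k l n; ring.
apply: (maj3_hball (c := 2) _ hv hv hv) => // k l n.
rewrite (_ : _ - _ = (phase3 s k l n - 1) * (v 0 k * v 0 l * v 0 n)); last by ring.
rewrite !Normc.normcM ler_wpM2r ?mulr_ge0 ?normc_ge0//.
by apply: (le_trans (normcB_le _ _)); rewrite normc_phase3 Normc.normc1.
Qed.

(** The phase difference costs [s] times the symbol estimated in [mult_bdry], which
    is bounded once a derivative is taken from each factor. *)
Lemma osc3_hball s : 0 < s -> hball g (osc3 s) (12 * s * (kap g * (kap g * M * M) * M)).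
Proof.
move=> s0; have hd := v_dz in0; have v00 := V0 in0.
apply: hball_ext (conv3_mul_hball g2 (c := 12 * s)
  (m := fun k l n => iz (k + l + n) * (phase3 s k l n - 1) * (iz k * iz l * iz n)) _ _ hd hd hd).
- move=> xi; apply: eq_conv3 => k l n.
  rewrite -[v 0 k](iz_dz k v00) -[v 0 l](iz_dz l v00) -[v 0 n](iz_dz n v00); ring.
- by rewrite mulr_gt0.
- by move=> k l n; rewrite -{2}(gtr0_norm s0); exact: mult_bdry.
Qed.

(** The local error, except that the twisted square is that of the exact solution
    at time [s]. *)
Definition nfdef s xi : C := v s xi - v 0 xi - 6^-1 * nz xi * (tsq s xi - tsq 0 xi)
  + 54^-1 * bdry s (v 0) xi + (18^-1 * s)%:C * Dinv (cube (v 0)) xi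
  - (6^-1 * s)%:C * (theta 0 (v 0) (v 0) 0 * Dinv (v 0) xi).

Definition nfdef_der s xi : C := crhs s (v s) xi - crhs s (v 0) xi - 18^-1 * osc3 s xi.

Lemma natVC (m : nat) : (m.+1%:R^-1 : R)%:C = m.+1%:R^-1.
Proof. by rewrite fmorphV rmorph_nat. Qed.

Lemma Dinv_rhs s xi : Dinv (rhs s) xi = 2^-1 * (nz xi * theta s (v s) (v s) xi).
Proof. by rewrite /Dinv /rhs -zz_iz; ring. Qed.

(** The quadratic terms cancel by [cder_tsq]; the cubic term frozen at time 0 is the
    derivative of [bdry] plus the mass term and the cube, up to [osc3]. *)
Lemma cder_nfdef s xi : 0 < s < tau -> cder (fun s => nfdef s xi) s (nfdef_der s xi).
Proof.
move=> sI; have sI' := oc sI; have hs := v_hball sI'; have h0 := v_hball in0.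
have D1 := cderB (V3 xi sI) (cder_cst (v 0 xi) s).
have D2 := cderZ (6^-1 * nz xi) (cderB (cder_tsq xi sI) (cder_cst (tsq 0 xi) s)).
have D3 := cderZ (54^-1) (cder_bdry s xi).
have D4 := cderM (cder_lin (18^-1) s) (cder_cst (Dinv (cube (v 0)) xi) s).
have D5 := cderM (cder_lin (6^-1) s) (cder_cst (theta 0 (v 0) (v 0) 0 * Dinv (v 0) xi) s).
have D := cderB (cderD (cderD (cderB D1 D2) D3) D4) D5.
apply: cder_ext D => //; rewrite !mulr0 !addr0 !subr0 (natVC 17) (natVC 5).
have tv : theta s (Dinv (rhs s)) (Dinv (v s)) xi =
    2^-1 * theta s (fun j => nz j * theta s (v s) (v s) j) (Dinv (v s)) xi.
  have hn : hball g (fun j => nz j * theta s (v s) (v s) j) (kap g * M * M).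
    apply: (hball_le (theta_hball g2 s hs hs)) => // k.
    by rewrite Normc.normcM ler_piMl ?normc_ge0 ?normc_nz.
  rewrite -[RHS](conv2Z g2 _ xi (maj2_theta s hn (hball_Dinv hs))).
  by apply: eq_conv2 => k l; rewrite Dinv_rhs; ring.
have nz0 : nz xi * Dinv (v 0) xi = Dinv (v 0) xi by rewrite /Dinv mulrA nz_iz.
rewrite /nfdef_der /crhs (theta_tcub1 s xi h0) osc3_E bdry_der_E /tsq_der tv /rhs.
have nn : nz xi * zz xi = zz xi := nz_zz xi.
move: nz0 nn.
move: (theta s (fun j => nz j * theta s (v s) (v s) j) (Dinv (v s)) xi) => tA.
move: (theta s (v s) (v s) xi) (theta 0 (v 0) (v 0) 0) (Dinv (v 0) xi) => tB mu d.
move: (tcub1 s (v 0) xi) (tcub s (v 0) xi) (Dinv (cube (v 0)) xi) (nz xi) (zz xi) (iz xi) => a b c n z i nd nn.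
have -> : 6^-1 * n * (3 * z * tB + 2 * (2^-1 * tA)) = 2^-1 * (n * z) * tB + 6^-1 * n * tA by field.
have -> : - 6^-1 * n * (a - mu * d) = - 6^-1 * n * a + 6^-1 * mu * (n * d) by ring.
by rewrite nn nd; field.
Qed.

Lemma ccont_nfdef xi : ccont (fun s => nfdef s xi) 0 tau.
Proof.
have lin (c : R) (e : C) : ccont (fun s => (c * s)%:C * e) 0 tau.
  by apply: (@cder_ccont _ _ (fun s => c%:C * e)) => s;
     apply: cder_ext (cderM (cder_lin c s) (cder_cst e s)) => //; rewrite mulr0 addr0.
have neg f : ccont f 0 tau -> ccont (fun s => - f s) 0 tau.
  move=> /(ccontZ (-1)); congr (ccont _ _ _); apply/funext => s; exact: mulN1r.
apply: ccontD; [apply: ccontD; [apply: ccontD; [apply: ccontD; [apply: ccontD|]|]|]|].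
- exact: V2.
- exact: ccont_cst.
- apply: neg; apply: ccontZ; apply: ccontD; [exact: ccont_tsq|exact: ccont_cst].
- by apply: ccontZ; apply: (@cder_ccont _ _ (fun s => bdry_der s xi)) => s; exact: cder_bdry.
- exact: lin.
- by apply: neg; exact: lin.
Qed.

Definition crhs_aux : R := 1 * (1 * (kap g * (2 * (M + 1) * (M + 1)))).
Definition crhs_K : R := 1 * (1 * (kap g * (2 * crhs_aux * (1 * (M + 1))))).

Lemma crhs_lip s : LipC g M (crhs s) crhs_K.
Proof.
have L1 : LipC g M (fun w j => nz j * theta s w w j) crhs_aux.
  apply: LipC_diag => //; first exact: normc_nz.
  apply: (@LipC_conv2 _ _ _ g2 id id _ _ 1 (phase2 s)) => //; [|exact: LipC_id|exact: LipC_id].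
  by move=> k l; rewrite normc_phase2.
have L2 : LipC g M (fun w => Dinv w) (1 * (M + 1)).
  by apply: LipC_diag => //; [exact: normc_iz_le1|exact: LipC_id].
apply: (@LipC_diag _ _ _ _ _ 1 (fun xi => - 6^-1 * nz xi)) => //.
  by move=> k; rewrite Normc.normcM normcN mulr_ile1 ?normc_ge0 ?normc_6V ?normc_nz.
apply: (@LipC_conv2 _ _ _ g2 _ _ _ _ 1 (phase2 s)) L1 L2 => //.
by move=> k l; rewrite normc_phase2.
Qed.

Lemma crhs_K_gt0 : 0 < crhs_K.
Proof. by have [] := crhs_lip 0. Qed.

Definition osc_bnd : R := kap g * (kap g * M * M) * M.

Lemma nfdef_hball : hball g (nfdef tau) ((crhs_K * (rhs_bnd * tau) + 12 * tau * osc_bnd) * tau).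
Proof.
have K30 : 0 < osc_bnd by rewrite !mulr_gt0.
have e0 : nfdef tau =1 (fun xi => nfdef tau xi - nfdef 0 xi).
  have z0 xi : nfdef 0 xi = 0.
    rewrite /nfdef !subrr !mulr0 subr0 (_ : (0 : R)%:C = 0)// !mul0r.
    suff -> : bdry 0 (v 0) xi = 0 by rewrite mulr0 !addr0 subr0.
    have hv := v_hball in0; have hD := hball_Dinv hv.
    rewrite /bdry (@eq_conv3 _ _ (fun _ _ _ => 0 * 0)); last first.
      by move=> k l n; rewrite phase3E mulr0 expi0 subrr mulr0 !mul0r.
    rewrite (conv3Z g2) ?mul0r//; apply: (maj3_hball ler01 hv hv hv) => k l n.
    by rewrite Normc.normc0 !mulr_ge0 ?normc_ge0.
  by move=> xi; rewrite z0 subr0.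
apply: (hball_ext (fun xi => esym (e0 xi))).
rewrite -[X in hball _ _ (_ * X)]subr0; apply: (@vector_mvt _ g nfdef nfdef_der) => //.
- by do ?[apply: addr_gt0|apply: mulr_gt0]; rewrite ?crhs_K_gt0.
- by move=> s xi sI; exact: cder_nfdef.
- by move=> xi; exact: ccont_nfdef.
- move=> s sI; have sI' := oc sI; have hs := v_hball sI'; have h0 := v_hball in0.
  have /andP[s0 st] := sI; have [_ _ L] := crhs_lip s.
  have hd := v_lip (lexx 0) s0 (ltW st); rewrite subr0 in hd.
  have h1 := L _ _ _ hs h0 hd; have h2 := osc3_hball s0.
  have h3 : hball g (fun xi => 18^-1 * osc3 s xi) (12 * s * osc_bnd).
    apply: (hball_le h2) => // k; rewrite Normc.normcM ler_piMl ?normc_ge0//.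
    by rewrite (normc_inv_nat 17) invf_le1// ler1n.
  apply: (hball_le (b := nfdef_der s) (hballB h1 h3)) => //.
  rewrite lerD// ?ler_wpM2l// ?ler_wpM2r// ?ler_wpM2l//; rewrite ?(ltW st) ?(ltW K30) ?(ltW crhs_K_gt0) ?(ltW A10)//.
Qed.

Definition cons_bnd : R := crhs_K * rhs_bnd + 12 * osc_bnd + 2 * (kap g * (kap g * M * rhs_bnd) * M) + kap g * rhs_bnd * rhs_bnd.

Lemma cons_bnd_gt0 : 0 < cons_bnd.
Proof.
have K30 : 0 < osc_bnd by rewrite !mulr_gt0.
by rewrite /cons_bnd; do ?[apply: addr_gt0|apply: mulr_gt0]; rewrite ?crhs_K_gt0.
Qed.

(** [nfdef] contains the square of [Dinv (v tau)], the scheme only the terms of it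
    that are at most linear in [quad]; their difference is quadratic in the
    increment or linear in [lowdef], hence of order tau^2. *)
Lemma local_error_aux : hball g (fun xi => v tau xi - tstep tau (v 0) xi) (cons_bnd * tau ^+ 2).
Proof.
have inT : 0 <= tau <= tau by rewrite lexx ltW.
have h0 := v_hball in0; have hT := v_hball inT; have hD0 := hball_Dinv h0; have hDT := hball_Dinv hT.
have hX := lowdef_hball; have hZ := nfdef_hball.
have hdl : hball g (fun k => Dinv (v tau) k - Dinv (v 0) k) (rhs_bnd * tau).
  have := v_lip (lexx 0) tau0 (lexx tau); rewrite subr0 => h.
  by apply: (hball_le (hball_Dinv h)) => // k; rewrite /Dinv -mulrBr.
set dl := fun k => Dinv (v tau) k - Dinv (v 0) k in hdl.
have hG : hball g (Dinv (quad tau (v 0))) (rhs_bnd * tau + kap g * M * rhs_bnd * tau * tau).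
  by apply: hball_ext (hballB hdl hX) => k; rewrite /dl /lowdef; ring.
have hQ : hball g (fun xi => 6^-1 * nz xi * (theta tau (lowdef tau) (Dinv (v 0)) xi
    + theta tau (Dinv (v 0)) (lowdef tau) xi + theta tau dl dl xi))
    (kap g * (kap g * M * rhs_bnd * tau * tau) * M + kap g * M * (kap g * M * rhs_bnd * tau * tau)
     + kap g * (rhs_bnd * tau) * (rhs_bnd * tau)).
  have h := hballD (hballD (theta_hball g2 tau hX hD0) (theta_hball g2 tau hD0 hX)) (theta_hball g2 tau hdl hdl).
  apply: (hball_le h) => // k; rewrite Normc.normcM ler_piMl ?normc_ge0//.
  by rewrite Normc.normcM mulr_ile1 ?normc_ge0 ?normc_6V ?normc_nz.
have -> : cons_bnd * tau ^+ 2 = (crhs_K * (rhs_bnd * tau) + 12 * tau * osc_bnd) * tau +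
  (kap g * (kap g * M * rhs_bnd * tau * tau) * M + kap g * M * (kap g * M * rhs_bnd * tau * tau)
     + kap g * (rhs_bnd * tau) * (rhs_bnd * tau)) by rewrite /cons_bnd; ring.
apply: hball_ext (hballD hZ hQ) => xi.
(* expansion of the new inverse derivative around the initial one *)
have eT : Dinv (v tau) = (fun k => Dinv (v 0) k + (Dinv (quad tau (v 0)) k + lowdef tau k)).
  by apply/funext => k; rewrite /lowdef; ring.
have edl : dl = (fun k => Dinv (quad tau (v 0)) k + lowdef tau k).
  by apply/funext => k; rewrite /dl eT; ring.
have hGX := hballD hG hX.
have eQ : tsq tau xi = theta tau (Dinv (v 0)) (Dinv (v 0)) xi +
    2 * theta tau (Dinv (v 0)) (Dinv (quad tau (v 0))) xi + theta tau (Dinv (v 0)) (lowdef tau) xi +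
    theta tau (lowdef tau) (Dinv (v 0)) xi + theta tau dl dl xi.
  rewrite /tsq [in LHS]eT edl.
  have hDG := hballD hD0 hGX.
  rewrite (thetaDl g2 tau xi hD0 hGX hDG).
  rewrite (thetaDr g2 tau xi hD0 hGX hD0) (thetaDr g2 tau xi hD0 hGX hGX).
  rewrite (thetaDr g2 tau xi hG hX hD0) (thetaDl g2 tau xi hG hX hD0).
  rewrite (theta_sym tau (Dinv (quad tau (v 0))) (Dinv (v 0))); ring.
have eG : quad tau (v 0) xi = 6^-1 * nz xi * (theta tau (Dinv (v 0)) (Dinv (v 0)) xi - tsq 0 xi).
  rewrite -[LHS]nzK; last exact: quad_mean0.
  by rewrite (quad_E g2 tau xi h0) /tsq; ring.
rewrite /nfdef eQ /tstep eG /cubic3 pmean_diag -/(nz xi).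
rewrite (_ : tau / 6 = 6^-1 * tau) 1?mulrC// (_ : tau / 18 = 18^-1 * tau) 1?mulrC//.
by field.
Qed.

End Fix.

Lemma local_error (g M : R) : 1 / 2 < g -> 0 < M -> exists2 K, 0 < K &
  forall (tau : R) (v : R -> int -> C), 0 < tau ->
  (forall s, 0 <= s <= tau -> v s 0 = 0) ->
  (forall s, 0 <= s <= tau -> hball (g + 1) (v s) M) ->
  (forall xi, ccont (v^~ xi) 0 tau) ->
  (forall s xi, 0 < s < tau -> cder (v^~ xi) s (2^-1 * zz xi * theta s (v s) (v s) xi)) ->
  hball g (fun xi => v tau xi - tstep tau (v 0) xi) (K * tau ^+ 2).
Proof.
move=> g2 M0; exists (cons_bnd g M); first exact: cons_bnd_gt0.
by move=> tau v tau0 V0 V1 V2 V3; exact: local_error_aux.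
Qed.

End Consistency.

(** * Convergence for Fourier coefficients *)
Section Convergence.
Context {R : realType}.
Local Notation C := R[i].
Local Notation normc := Normc.normc.
Local Opaque nsum.
Implicit Types (k xi : int) (s t : R) (a b w : int -> C).

Lemma hball_weaken g a A B : A <= B -> hball g a A -> hball g a B.
Proof. by move=> AB h; exact: (hball_le h). Qed.

Lemma cder_shift (f : R -> C) (t s : R) l : cder f (t + s) l -> cder (fun r => f (t + r)) s l.
Proof.
move=> [d1 d2]; split; apply: edr_is_derive => e e0.
  have [d d0 hd] := is_derive_edr d1 e0; exists d => // h hh.
  by rewrite addrA; exact: hd.
have [d d0 hd] := is_derive_edr d2 e0; exists d => // h hh.
by rewrite addrA; exact: hd.
Qed.

Lemma within_shift (f : R -> R) (t x y : R) : {within `[t + x, t + y], continuous f} ->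
  {within `[x, y], continuous (fun s => f (t + s))}.
Proof.
move=> /subspace_continuousP cf; apply/subspace_continuousP => s /= sI.
have sI' : `[t + x, t + y] (t + s) by move: sI; rewrite /= !in_itv /= !lerD2l.
apply/cvgrPdist_le => e e0; have /cvgrPdist_le /(_ e e0) := cf _ sI'.
rewrite !near_withinE => -[d /= d0 hd].
exists d => // r hr; rewrite /= in_itv /= => rI; apply: hd.
  by move: hr; rewrite /ball_ /= opprD addrACA subrr add0r.
by rewrite in_itv /= !lerD2l.
Qed.

Lemma ccont_shift (f : R -> C) t x y : ccont f (t + x) (t + y) ->
  ccont (fun s => f (t + s)) x y.
Proof. by move=> [a b]; split; [exact: (within_shift a)|exact: (within_shift b)]. Qed.

Lemma ccontM (f1 f2 : R -> C) x y : ccont f1 x y -> ccont f2 x y -> ccont (fun s => f1 s * f2 s) x y.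
Proof.
move=> [a1 b1] [a2 b2]; split.
  rewrite (_ : (fun s => _) = fun s => complex.Re (f1 s) * complex.Re (f2 s)
     + (-1) * (complex.Im (f1 s) * complex.Im (f2 s))).
    move=> z; apply: cvgD; first by apply: (@cvgM R); [exact: a1|exact: a2].
    by apply: (@cvgM R); [exact: cvg_cst|apply: (@cvgM R); [exact: b1|exact: b2]].
  by apply/funext => s; rewrite cReM mulN1r.
rewrite (_ : (fun s => _) = fun s => complex.Re (f1 s) * complex.Im (f2 s)
   + complex.Im (f1 s) * complex.Re (f2 s)).
  move=> z; apply: cvgD; apply: (@cvgM R); [exact: a1|exact: b2|exact: b1|exact: a2].
by apply/funext => s; rewrite cImM.
Qed.

Section Trajectory.
Variables (g T M : R).
Hypothesis g2 : 1 / 2 < g.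
Hypothesis M0 : 0 < M.
Variable U : R -> int -> C.
Hypothesis U0 : forall t, 0 <= t <= T -> U t 0 = 0.
Hypothesis U1 : forall t, 0 <= t <= T -> hball (g + 1) (U t) M.
Hypothesis U2 : forall xi, ccont (U^~ xi) 0 T.
Hypothesis U3 : forall t xi, 0 < t < T ->
  cder (U^~ xi) t (ii (xi%:~R ^+ 3) * U t xi + 2^-1 * zz xi * theta 0 (U t) (U t) xi).

(** Conjugation by the Airy group turns the plain product into [theta]. *)
Lemma theta_twist s a A xi : hball g a A ->
  theta s (fun k => expi (- (k%:~R ^+ 3) * s) * a k) (fun k => expi (- (k%:~R ^+ 3) * s) * a k) xi =
  expi (- (xi%:~R ^+ 3) * s) * theta 0 a a xi.
Proof.
move=> ha; rewrite /theta -(conv2_diag g2 (fun k => expi (- (k%:~R ^+ 3) * s))); last first.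
  exact: (maj2_theta _ ha ha).
apply: eq_conv2 => k l; rewrite phase2_0 mul1r.
have -> : expi (- (k + l)%:~R ^+ 3 * s) = phase2 s k l * (expi (- k%:~R ^+ 3 * s) * expi (- l%:~R ^+ 3 * s)).
  by rewrite /phase2 -!expiD; congr expi; rewrite intrD; ring.
by ring.
Qed.

(** The twisted variable restarts at the beginning of each step, where it agrees with
    the solution. *)
Lemma one_step K t0 tau : 0 < tau -> 0 <= t0 -> t0 + tau <= T ->
  (forall (tau : R) (v : R -> int -> C), 0 < tau ->
    (forall s, 0 <= s <= tau -> v s 0 = 0) ->
    (forall s, 0 <= s <= tau -> hball (g + 1) (v s) M) ->
    (forall xi, ccont (v^~ xi) 0 tau) ->
    (forall s xi, 0 < s < tau -> cder (v^~ xi) s (2^-1 * zz xi * theta s (v s) (v s) xi)) ->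
    hball g (fun xi => v tau xi - tstep tau (v 0) xi) (K * tau ^+ 2)) ->
  hball g (fun xi => U (t0 + tau) xi - fstep tau (U t0) xi) (K * tau ^+ 2).
Proof.
move=> tau0 t00 tT le.
pose v s xi := expi (- (xi%:~R ^+ 3) * s) * U (t0 + s) xi.
have I s : 0 <= s <= tau -> 0 <= t0 + s <= T.
  by move=> /andP[s0 s1]; rewrite addr_ge0//= (le_trans _ tT)// lerD2l.
have v0 : v 0 = U t0 by apply/funext => xi; rewrite /v mulr0 expi0 mul1r addr0.
have h : hball g (fun xi => v tau xi - tstep tau (v 0) xi) (K * tau ^+ 2).
  apply: le => //.
  - by move=> s sI; rewrite /v U0 ?mulr0//; exact: I.
  - move=> s sI; apply: (hball_le (U1 (I s sI))) => // k.
    by rewrite Normc.normcM normc_expi mul1r.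
  - move=> xi; apply: ccontM.
      by apply: (@cder_ccont _ _ (fun s => ii (- (xi%:~R ^+ 3)) * expi (- (xi%:~R ^+ 3) * s))) => s; exact: cder_expi.
    apply: (@ccont_shift (U^~ xi) t0 0 tau); apply: ccont_sub (U2 xi) => //; by rewrite addr0.
  - move=> s xi /andP[s0 s1].
    have tsI : 0 < t0 + s < T by rewrite ltr_wpDl//= (lt_le_trans _ tT)// ltrD2l.
    have tsI' : 0 <= t0 + s <= T by case/andP: tsI => *; rewrite !ltW.
    have hu := hball_down (U1 tsI').
    have D := cderM (cder_expi (- (xi%:~R ^+ 3)) s) (cder_shift (U3 xi tsI)).
    apply: cder_ext D => //; rewrite (theta_twist s xi hu).
    have -> : ii (- xi%:~R ^+ 3) = - ii (xi%:~R ^+ 3) :> C.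
      by apply: complexP; rewrite ?cReN ?cImN /= ?oppr0.
    by ring.
apply: hball_ext (hball_airy tau h) => xi; rewrite v0 /airy /fstep /airy /v mulrBr; congr (_ - _).
by rewrite mulrA -expiD (_ : _ + _ = 0) ?expi0 ?mul1r//; ring.
Qed.

End Trajectory.

Lemma expR_growth (L tau T : R) (n : nat) : 0 <= L -> 0 <= tau -> n%:R * tau <= T ->
  (1 + L * tau) ^+ n <= expR (L * T).
Proof.
move=> L0 t0 nT; apply: (@le_trans _ _ (expR (L * tau) ^+ n)).
  by rewrite lerXn2r ?nnegrE ?expR_ge0// ?addr_ge0 ?mulr_ge0// expR_ge1Dx.
rewrite -expRM_natl ler_expR.
by rewrite mulrCA ler_wpM2l.
Qed.

(** The error is propagated in the normal form, where it grows by a factor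
    1 + 2 L tau per step, and it is converted back at the cost of a factor 2. The
    induction also carries the bound on the numerical solution, which the choice
    of [tau0] keeps within distance 1 of the exact one. *)
Theorem fourier_convergence (g T M : R) : 1 / 2 < g -> 0 < T -> 0 < M ->
  exists tau0 K : R, [/\ 0 < tau0, 0 < K & forall (U : R -> int -> C) (W : nat -> int -> C) (tau : R),
  0 < tau <= tau0 ->
  (forall t, 0 <= t <= T -> U t 0 = 0) ->
  (forall t, 0 <= t <= T -> hball (g + 1) (U t) M) ->
  (forall xi, ccont (U^~ xi) 0 T) ->
  (forall t xi, 0 < t < T ->
    cder (U^~ xi) t (ii (xi%:~R ^+ 3) * U t xi + 2^-1 * zz xi * theta 0 (U t) (U t) xi)) ->
  W 0%N =1 U 0 -> (forall n : nat, n.+1%:R * tau <= T -> hball g (W n) (M + 1) -> W n.+1 =1 fstep tau (W n)) ->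
  forall n : nat, n%:R * tau <= T -> hball g (fun xi => U (n%:R * tau) xi - W n xi) (K * tau)].
Proof.
move=> g2 T0 M0; have g0 : 0 <= g by lra.
pose rho := M + 1; have rho0 : 0 < rho by rewrite addr_gt0.
have [A A0 hA] := unifL_tstep g2 rho0.
(* the ball that contains the images of one step from the ball of radius rho *)
pose rho2 := rho + A; have rho20 : 0 < rho2 by rewrite addr_gt0.
have [KK KK1 hinv] := nform_inv g2 rho20; have KK0 : 0 < KK by exact: lt_le_trans KK1.
have [L L0 hstab] := stability g2 rho0 KK0.
have [Kl Kl0 hloc] := local_error g2 M0.
have [AN [AN0 _ hlip]] := nform_lip g2 rho20 KK.
pose c := AN * Kl; have c0 : 0 < c by rewrite mulr_gt0.
pose E := expR (2 * L * T) * (1 + T * c).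
have E0 : 0 < E by rewrite mulr_gt0 ?expR_gt0// addr_gt0// mulr_gt0.
pose tau0 := Num.min 1 (2 * E)^-1.
have tau00 : 0 < tau0 by rewrite lt_min ltr01 invr_gt0 mulr_gt0.
exists tau0, (2 * E); split; [exact: tau00|by rewrite mulr_gt0|].
move=> U W tau /andP[t0 tt] U0 U1 U2 U3 W0 WS.
move: tt; rewrite le_min => /andP[t1 tE].
have tE1 : 2 * E * tau <= 1.
    have E20 : 0 < 2 * E by rewrite mulr_gt0.
    by have := ler_wpM2l (ltW E20) tE; rewrite mulfV // gt_eqF.
(* a supersolution of y_(n + 1) = (1 + 2 L tau) y_n + c tau^2 with y_0 >= 0 *)
pose Y (n : nat) := tau * (1 + 2 * L * tau) ^+ n * (1 + n%:R * tau * c).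
have q0 : 0 < 1 + 2 * L * tau by rewrite addr_gt0// !mulr_gt0.
have q1 : 1 <= 1 + 2 * L * tau by rewrite lerDl !mulr_ge0// ltW.
have Y0 n : 0 < Y n by rewrite /Y !mulr_gt0 ?exprn_gt0// ltr_wpDr// !mulr_ge0// ltW.
have YE n : n%:R * tau <= T -> Y n <= E * tau.
  move=> nT; rewrite /Y /E [leRHS]mulrC -mulrA ler_wpM2l ?(ltW t0)//.
  apply: ler_pM.
  - by rewrite exprn_ge0// ltW.
  - by rewrite addr_ge0// !mulr_ge0// ltW.
  - by apply: expR_growth => //; rewrite ?mulr_ge0// ltW.
  - by rewrite lerD2l ler_wpM2r// ltW.
have Us t : 0 <= t <= T -> hball g (U t) M by move=> tI; apply: hball_down; exact: U1.
have nI (n : nat) : n%:R * tau <= T -> 0 <= n%:R * tau <= T by move=> ->; rewrite mulr_ge0// ltW.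
have main (n : nat) : n%:R * tau <= T -> [/\ hball g (W n) rho,
    hball g (fun xi => nform KK (U (n%:R * tau)) xi - nform KK (W n) xi) (Y n) &
    hball g (fun xi => U (n%:R * tau) xi - W n xi) (2 * Y n)].
  elim: n => [|n ih] nT.
    have Ue : W 0%N = U 0 by apply/funext.
    rewrite mul0r Ue; split.
    - by apply: hball_weaken (Us 0 _); [rewrite lerDl|rewrite lexx ltW].
    - by apply: (hball_le (hball0 g (Y0 0%N))) => // k; rewrite subrr Normc.normc0.
    - have Y20 : 0 < 2 * Y 0%N by rewrite mulr_gt0.
      by apply: (hball_le (hball0 g Y20)) => // k; rewrite subrr Normc.normc0.
  have nT' : n%:R * tau <= T.
    by apply: le_trans nT; rewrite ler_wpM2r ?(ltW t0)// ler_nat.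
  have [hW hN hD] := ih nT'.
  have hU : hball g (U (n%:R * tau)) rho by apply: hball_weaken (Us _ (nI _ nT')); rewrite lerDl.
  have t01 : 0 < tau <= 1 by rewrite t0.
  have WE : W n.+1 = fstep tau (W n) by apply/funext; exact: WS.
  have tn : n.+1%:R * tau = n%:R * tau + tau by rewrite -natr1 mulrDl mul1r.
  have h1 := hstab tau t01 _ _ _ _ hU hW hD hN.
  have h2 : hball g (fun xi => U (n.+1%:R * tau) xi - fstep tau (U (n%:R * tau)) xi) (Kl * tau ^+ 2).
    rewrite tn; apply: (one_step g2 U0 U1 U2 U3) => //.
      by rewrite mulr_ge0// ltW.
    by rewrite -tn.
  have [_ hP _] := hA tau t01.
  have r2 w : hball g w rho -> hball g (fstep tau w) rho2.
    by move=> hw; apply: hball_weaken (hball_airy tau (hP w hw)); rewrite lerDr ltW.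
  have hUS : hball g (U (n.+1%:R * tau)) M by apply: Us; exact: nI.
  have hUS2 : hball g (U (n.+1%:R * tau)) rho2.
    by apply: hball_weaken hUS; rewrite /rho2 /rho -addrA lerDl addr_ge0// ltW.
  have h3 := hlip _ _ _ hUS2 (r2 _ hU) h2.
  have h4 := hballD h3 h1.
  have hNS : hball g (fun xi => nform KK (U (n.+1%:R * tau)) xi - nform KK (W n.+1) xi) (Y n.+1).
    have h4' := hball_ext (b := fun xi => nform KK (U (n.+1%:R * tau)) xi - nform KK (W n.+1) xi) (fun xi => _) h4.
    have h6 : hball g (fun xi => nform KK (U (n.+1%:R * tau)) xi - nform KK (W n.+1) xi) (AN * (Kl * tau ^+ 2) + (Y n + tau * L * (2 * Y n))).
      by rewrite WE in h4' *; apply: h4' => xi; rewrite addrA subrK.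
    apply: hball_weaken h6.
    rewrite /Y exprS; set q := 1 + 2 * L * tau in q0 q1 *.
    have qn1 : 1 <= q * q ^+ n by rewrite -exprS exprn_ege1.
    have -> : AN * (Kl * tau ^+ 2) + (tau * q ^+ n * (1 + n%:R * tau * c) +
        tau * L * (2 * (tau * q ^+ n * (1 + n%:R * tau * c)))) =
      tau * (tau * c) + tau * (q * q ^+ n) * (1 + n%:R * tau * c) by rewrite /c /q; ring.
    rewrite exprS -natr1.
    have -> : tau * (q * q ^+ n) * (1 + (n%:R + 1) * tau * c) =
      q * q ^+ n * (tau * (tau * c)) + tau * (q * q ^+ n) * (1 + n%:R * tau * c) by ring.
    by rewrite lerD2r ler_peMl// !mulr_ge0// ltW.
  have hW2 : hball g (W n.+1) rho2 by rewrite WE; exact: r2.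
  have hDS := hinv _ _ _ hUS2 hW2 hNS.
  split => //.
  have := hballB hUS hDS => h5.
  have h5' := hball_ext (b := W n.+1) (fun xi => _) h5.
  have h6 : hball g (W n.+1) (M + 2 * Y n.+1) by apply: h5' => xi; rewrite opprB addrCA subrr addr0.
  apply: hball_weaken h6.
  rewrite /rho lerD2l; apply: le_trans tE1.
  by rewrite -mulrA ler_wpM2l// YE.
move=> n nT; have [_ _ h] := main n nT.
by apply: hball_weaken h; rewrite -mulrA ler_wpM2l// YE.
Qed.

End Convergence.

(** * Integration on the torus *)
Section Integration.
Context {R : realType}.
Local Notation C := R[i].
Local Notation normc := Normc.normc.
Local Notation mu := (@lebesgue_measure R).
Local Notation TT := (@torus R).
Implicit Types (f g h : R -> R) (F G H : R -> C).

Lemma mtorus : measurable (TT : set (measurableTypeR R)).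
Proof. exact: measurable_itv. Qed.
Local Hint Resolve mtorus : core.

Lemma pi2_gt0 : 0 < 2 * pi :> R.
Proof. by rewrite mulr_gt0// pi_gt0. Qed.

Lemma mu_torus : mu TT = (2 * pi)%:E.
Proof.
by rewrite /torus lebesgue_measure_itv/= lte_fin pi2_gt0 sube0.
Qed.

Definition ig f := mu.-integrable TT (EFin \o f).

Lemma ig_mf f : ig f -> measurable_fun TT f.
Proof. by move=> /integrableP[/measurable_EFinP]. Qed.

Lemma ig_dom f h : measurable_fun TT f -> ig h -> (forall x, TT x -> `|f x| <= h x) -> ig f.
Proof.
move=> mf ih fh; apply: (le_integrable mtorus _ _ ih); first exact/measurable_EFinP.
by move=> x Tx /=; rewrite lee_fin (le_trans (fh x Tx))// ler_norm.
Qed.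

Lemma ig_cst (c : R) : ig (fun=> c).
Proof.
apply: measurable_bounded_integrable; first exact: mtorus.
- by rewrite [X in (X < _)%E]mu_torus ltry.
- exact: measurable_cst.
- exact: bounded_cst.
Qed.

Lemma ig_ext f g : (forall x, TT x -> f x = g x) -> ig f -> ig g.
Proof.
move=> e; apply: eq_integrable => // x; rewrite inE => Tx /=; by rewrite e.
Qed.

Lemma igD f g : ig f -> ig g -> ig (fun x => f x + g x).
Proof.
move=> i1 i2; have := integrableD mtorus i1 i2.
by apply: eq_integrable.
Qed.

Lemma igZ (c : R) f : ig f -> ig (fun x => c * f x).
Proof. by move=> i1; have := integrableZl mtorus c i1; apply: eq_integrable. Qed.

Lemma igN f : ig f -> ig (fun x => - f x).
Proof. by move=> i1; have := integrableN i1; apply: eq_integrable. Qed.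

Lemma igB f g : ig f -> ig g -> ig (fun x => f x - g x).
Proof. by move=> i1 i2; apply: igD => //; exact: igN. Qed.

Lemma ig_abs f : ig f -> ig (fun x => `|f x|).
Proof. by move=> /integrable_norm. Qed.

Lemma igM (B : R) f g : measurable_fun TT f -> (forall x, TT x -> `|f x| <= B) -> ig g ->
  ig (fun x => f x * g x).
Proof.
move=> mf fB ih; apply: (@ig_dom _ (fun x => B * `|g x|)).
- by apply: measurable_funM => //; exact: ig_mf.
- by apply: igZ; exact: ig_abs.
- by move=> x Tx; rewrite normrM ler_wpM2r// fB.
Qed.

Lemma ig_bnd (B : R) f : measurable_fun TT f -> (forall x, TT x -> `|f x| <= B) -> ig f.
Proof. by move=> mf fB; apply: (ig_dom mf (ig_cst B)). Qed.

Lemma intD f g : ig f -> ig g ->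
  \int[mu]_(x in TT) (f x + g x) = \int[mu]_(x in TT) f x + \int[mu]_(x in TT) g x.
Proof. exact: RintegralD. Qed.

Lemma intZ (c : R) f : ig f -> \int[mu]_(x in TT) (c * f x) = c * \int[mu]_(x in TT) f x.
Proof. exact: RintegralZl. Qed.

Lemma intN f : ig f -> \int[mu]_(x in TT) (- f x) = - \int[mu]_(x in TT) f x.
Proof.
move=> i; rewrite -mulN1r -intZ//; congr Rintegral; apply/funext => x; by rewrite mulN1r.
Qed.

Lemma intB f g : ig f -> ig g ->
  \int[mu]_(x in TT) (f x - g x) = \int[mu]_(x in TT) f x - \int[mu]_(x in TT) g x.
Proof. exact: RintegralB. Qed.

Lemma int_le f g : ig f -> ig g -> (forall x, TT x -> f x <= g x) ->
  \int[mu]_(x in TT) f x <= \int[mu]_(x in TT) g x.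
Proof. exact: le_Rintegral. Qed.

Lemma int_ge0 f : (forall x, TT x -> 0 <= f x) -> 0 <= \int[mu]_(x in TT) f x.
Proof. by move=> h; apply: Rintegral_ge0. Qed.

Lemma int_ext f g : (forall x, TT x -> f x = g x) ->
  \int[mu]_(x in TT) f x = \int[mu]_(x in TT) g x.
Proof. by move=> e; apply: eq_Rintegral => x; rewrite inE => /e. Qed.

Lemma int_cst (c : R) : \int[mu]_(x in TT) c = 2 * pi * c.
Proof. rewrite Rintegral_cst; last exact: mtorus. by rewrite mulrC; congr (_ * _); rewrite [X in fine X]mu_torus. Qed.

Local Notation aef := (ae_filter_ringOfSetsType mu).

(** Almost everywhere on the torus. *)
Definition aeT (P : R -> Prop) := {ae mu, forall x, TT x -> P x}.

Lemma aeT_imp (P Q : R -> Prop) : (forall x, TT x -> P x -> Q x) -> aeT P -> aeT Q.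
Proof. by move=> h; move=> hP; rewrite /aeT in hP *; apply: (@filterS _ _ aef) hP => x hx Tx; apply: h => //; exact: hx. Qed.

Lemma aeT_imp2 (P Q S : R -> Prop) : (forall x, TT x -> P x -> Q x -> S x) -> aeT P -> aeT Q -> aeT S.
Proof. by move=> h; move=> hP hQ; rewrite /aeT in hP hQ *; apply: (@filterS2 _ _ aef) hP hQ => x hx hx' Tx; apply: h => //; [exact: hx|exact: hx']. Qed.

Lemma int_ae f g : measurable_fun TT f -> measurable_fun TT g -> aeT (fun x => f x = g x) ->
  \int[mu]_(x in TT) f x = \int[mu]_(x in TT) g x.
Proof.
move=> mf mg e; congr fine; apply: ae_eq_integral => //.
- exact/measurable_EFinP.
- exact/measurable_EFinP.
- by rewrite /aeT in e *; apply: (@filterS _ _ aef) e => x + Tx; move=> /(_ Tx) ->.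
Qed.

Lemma ig_ae f g : measurable_fun TT f -> ig g -> aeT (fun x => f x = g x) -> ig f.
Proof.
move=> mf /integrableP[mg ig'] e; apply/integrableP; split; first exact/measurable_EFinP.
rewrite (_ : integral _ _ _ = \int[mu]_(x in TT) `|(EFin \o g) x|)%E//.
apply: ae_eq_integral => //.
- by apply: measurableT_comp => //; exact/measurable_EFinP.
- by apply: measurableT_comp.
- by rewrite /aeT in e *; apply: (@filterS _ _ aef) e => x + Tx /=; move=> /(_ Tx) ->.
Qed.

(** Measurability and integrability of a complex function are those of its real and
    imaginary parts, in accordance with the definition of the integral. *)
Definition cmf F := measurable_fun TT (fun x => complex.Re (F x)) /\
  measurable_fun TT (fun x => complex.Im (F x)).
Definition cig F := ig (fun x => complex.Re (F x)) /\ ig (fun x => complex.Im (F x)).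

Lemma cig_cmf F : cig F -> cmf F.
Proof. by move=> [a b]; split; exact: ig_mf. Qed.

Lemma cmfD F G : cmf F -> cmf G -> cmf (fun x => F x + G x).
Proof.
move=> [a b] [a' b']; split.
  by under eq_fun do rewrite cReD; exact: measurable_funD.
by under eq_fun do rewrite cImD; exact: measurable_funD.
Qed.

Lemma cmfM F G : cmf F -> cmf G -> cmf (fun x => F x * G x).
Proof.
move=> [a b] [a' b']; split.
  by under eq_fun do rewrite cReM; apply: measurable_funB; exact: measurable_funM.
by under eq_fun do rewrite cImM; apply: measurable_funD; exact: measurable_funM.
Qed.

Lemma cmf_cst (c : C) : cmf (fun=> c).
Proof. by split; exact: measurable_cst. Qed.

Lemma cmfN F : cmf F -> cmf (fun x => - F x).
Proof.
move=> h; rewrite (_ : (fun x => - F x) = fun x => (-1) * F x).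
  by apply: cmfM => //; exact: cmf_cst.
by apply/funext => x; rewrite mulN1r.
Qed.

Lemma cmf_sum (I : Type) (s : seq I) (F : I -> R -> C) : (forall i, cmf (F i)) ->
  cmf (fun x => \sum_(i <- s) F i x).
Proof.
move=> h; elim: s => [|i s ih].
  by under eq_fun do rewrite big_nil; exact: cmf_cst.
by under eq_fun do rewrite big_cons; exact: cmfD.
Qed.

Lemma measurable_normc F : cmf F -> measurable_fun TT (fun x => normc (F x)).
Proof.
move=> [a b].
rewrite (_ : (fun x => _) = Num.sqrt \o (fun x => complex.Re (F x) ^+ 2 + complex.Im (F x) ^+ 2)).
  apply: measurableT_comp; last by apply: measurable_funD; exact: measurable_funX.
  exact: continuous_measurable_fun (@sqrt_continuous R).
by apply/funext => x /=; rewrite -sqr_normcE sqrtr_sqr ger0_norm// normc_ge0.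
Qed.

Lemma cig_dom F h : cmf F -> ig h -> (forall x, TT x -> normc (F x) <= h x) -> cig F.
Proof.
move=> [a b] ih le; split; apply: (ig_dom _ ih) => // x Tx; apply: le_trans (le x Tx).
  exact: Re_le_normc.
exact: Im_le_normc.
Qed.

Lemma cig_normc F : cig F -> ig (fun x => normc (F x)).
Proof.
move=> [a b]; apply: (ig_dom _ (igD (ig_abs a) (ig_abs b))).
  by apply: measurable_normc; split; exact: ig_mf.
by move=> x _; rewrite ger0_norm ?normc_ge0// normc_le2.
Qed.

Lemma cigM B F G : cmf F -> (forall x, TT x -> normc (F x) <= B) -> cig G -> cig (fun x => F x * G x).
Proof.
move=> mF FB iG; apply: (@cig_dom _ (fun x => B * normc (G x))).
- by apply: cmfM => //; exact: cig_cmf.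
- by apply: igZ; exact: cig_normc.
- by move=> x Tx; rewrite Normc.normcM ler_wpM2r ?normc_ge0// FB.
Qed.

Lemma cigZ c F : cig F -> cig (fun x => c * F x).
Proof. by move=> iF; apply: (@cigM (normc c)) => //; exact: cmf_cst. Qed.

Lemma cigD F G : cig F -> cig G -> cig (fun x => F x + G x).
Proof.
move=> [a b] [a' b']; split.
  by under eq_fun do rewrite cReD; exact: igD.
by under eq_fun do rewrite cImD; exact: igD.
Qed.

Lemma cig_cst c : cig (fun=> c).
Proof. by split; exact: ig_cst. Qed.

Lemma cig_sum (I : Type) (s : seq I) (F : I -> R -> C) : (forall i, cig (F i)) ->
  cig (fun x => \sum_(i <- s) F i x).
Proof.
move=> h; elim: s => [|i s ih].
  by under eq_fun do rewrite big_nil; exact: cig_cst.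
by under eq_fun do rewrite big_cons; exact: cigD.
Qed.

Lemma eq_cint F G : (forall x, TT x -> F x = G x) -> cint F = cint G.
Proof. by move=> e; apply: complexP => /=; apply: int_ext => x Tx; rewrite e. Qed.

Lemma cint_ae F G : cmf F -> cmf G -> aeT (fun x => F x = G x) -> cint F = cint G.
Proof.
move=> [a b] [a' b'] e; apply: complexP => /=; apply: int_ae => //.
  by apply: aeT_imp e => x _ ->.
by apply: aeT_imp e => x _ ->.
Qed.

Lemma cintD F G : cig F -> cig G -> cint (fun x => F x + G x) = cint F + cint G.
Proof.
move=> [a b] [a' b']; apply: complexP => /=.
  by rewrite -intD//; apply: int_ext => x _; rewrite cReD.
by rewrite -intD//; apply: int_ext => x _; rewrite cImD.
Qed.

Lemma cintZ c F : cig F -> cint (fun x => c * F x) = c * cint F.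
Proof.
move=> [a b]; apply: complexP => /=.
  rewrite cReM /= -!intZ// -intB; [|exact: igZ..].
  by apply: int_ext => x _; rewrite cReM.
rewrite cImM /= -!intZ// -intD; [|exact: igZ..].
by apply: int_ext => x _; rewrite cImM.
Qed.

Lemma cintN F : cig F -> cint (fun x => - F x) = - cint F.
Proof. by move=> iF; rewrite -mulN1r -cintZ//; apply: eq_cint => x _; rewrite mulN1r. Qed.

Lemma cint0 : cint (fun=> 0 : C) = 0.
Proof. by apply: complexP => /=; rewrite int_cst mulr0. Qed.

Lemma cint_sum (I : Type) (s : seq I) (F : I -> R -> C) : (forall i, cig (F i)) ->
  cint (fun x => \sum_(i <- s) F i x) = \sum_(i <- s) cint (F i).
Proof.
move=> h; elim: s => [|i s ih].
  by under eq_fun do rewrite big_nil; rewrite big_nil cint0.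
under eq_fun do rewrite big_cons; rewrite big_cons -ih cintD//.
exact: cig_sum.
Qed.

Lemma cint_le F h : cmf F -> ig h -> (forall x, TT x -> normc (F x) <= h x) ->
  normc (cint F) <= 2 * \int[mu]_(x in TT) h x.
Proof.
move=> mF ih le; have [a b] := cig_dom mF ih le.
apply: (le_trans (normc_le2 _)); rewrite mulr_natl mulr2n lerD//=.
  apply: (le_trans (le_normr_Rintegral mtorus a)); apply: int_le => //; first exact: ig_abs.
  by move=> x Tx; rewrite (le_trans (Re_le_normc _))// le.
apply: (le_trans (le_normr_Rintegral mtorus b)); apply: int_le => //; first exact: ig_abs.
by move=> x Tx; rewrite (le_trans (Im_le_normc _))// le.
Qed.

Lemma cint_Re F : complex.Re (cint F) = \int[mu]_(x in TT) complex.Re (F x).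
Proof. by []. Qed.

Definition E2 F := \int[mu]_(x in TT) (normc (F x) ^+ 2).

Lemma E2_ge0 F : 0 <= E2 F.
Proof. by apply: int_ge0 => x _; rewrite sqr_ge0. Qed.

Lemma L2_lt F : cmf F -> (L2norm F < +oo)%E -> ig (fun x => normc (F x) ^+ 2).
Proof.
move=> mF; rewrite /L2norm => h; apply/integrableP; split.
  by apply/measurable_EFinP; apply: measurable_funX; exact: measurable_normc.
rewrite (_ : integral _ _ _ = \int[mu]_(x in TT) (normc (F x) ^+ 2)%:E)%E; last first.
  by apply: eq_integral => x _; rewrite /= ger0_norm ?sqr_ge0.
rewrite ltey; apply/eqP => e; move: h; rewrite e poweRyr ?invr_eq0 ?pnatr_eq0//.
Qed.

Lemma L2normE F : ig (fun x => normc (F x) ^+ 2) -> L2norm F = (Num.sqrt (E2 F))%:E.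
Proof.
move=> i; rewrite /L2norm -[X in (X `^ _)%E]fineK; last first.
  exact: integrable_fin_num i.
by rewrite poweR_EFin powR12_sqrt// E2_ge0.
Qed.

Lemma inL2P F : inL2 F <-> cmf F /\ ig (fun x => normc (F x) ^+ 2).
Proof.
split; first by move=> [a b c]; split => //; apply: L2_lt.
by move=> [[a b] i]; split => //; rewrite L2normE// ltry.
Qed.

Lemma inL2_cig F : inL2 F -> cig F.
Proof.
move=> /inL2P[mF i]; apply: (cig_dom mF (igD (ig_cst 1) i)) => x _.
have := normc_ge0 (F x); move: (normc (F x)) => y y0.
by have := sqr_ge0 (y - 1); rewrite sqrrB; lra.
Qed.

Lemma inL2D F G : inL2 F -> inL2 G -> inL2 (fun x => F x + G x).
Proof.
move=> /inL2P[mF iF] /inL2P[mG iG]; apply/inL2P; split; first exact: cmfD.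
apply: (ig_dom _ (igD (igZ 2 iF) (igZ 2 iG))).
  by apply: measurable_funX; apply: measurable_normc; exact: cmfD.
move=> x _; rewrite ger0_norm ?sqr_ge0//.
have h := le_normcD (F x) (G x).
apply: (@le_trans _ _ ((normc (F x) + normc (G x)) ^+ 2)).
  by rewrite lerXn2r ?nnegrE ?addr_ge0 ?normc_ge0.
by have := sqr_ge0 (normc (F x) - normc (G x)); rewrite sqrrB sqrrD; lra.
Qed.

Lemma inL2M B F G : cmf F -> (forall x, TT x -> normc (F x) <= B) -> inL2 G ->
  inL2 (fun x => F x * G x).
Proof.
move=> mF FB /inL2P[mG iG]; apply/inL2P; split; first exact: cmfM.
apply: (ig_dom _ (igZ (B ^+ 2) iG)).
  by apply: measurable_funX; apply: measurable_normc; exact: cmfM.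
move=> x Tx; rewrite ger0_norm ?sqr_ge0// Normc.normcM exprMn ler_wpM2r ?sqr_ge0//.
by rewrite lerXn2r ?nnegrE ?normc_ge0 ?(le_trans (normc_ge0 _) (FB x Tx))// FB.
Qed.

Lemma inL2Z c F : inL2 F -> inL2 (fun x => c * F x).
Proof. by move=> hF; apply: (@inL2M (normc c)) => //; exact: cmf_cst. Qed.

Lemma inL2_bnd B F : cmf F -> (forall x, TT x -> normc (F x) <= B) -> inL2 F.
Proof.
move=> mF FB; apply/inL2P; split => //.
apply: (@ig_bnd (B ^+ 2)); first by apply: measurable_funX; exact: measurable_normc.
move=> x Tx; rewrite ger0_norm ?sqr_ge0//.
by rewrite lerXn2r ?nnegrE ?normc_ge0 ?(le_trans (normc_ge0 _) (FB x Tx))// FB.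
Qed.

Lemma inL2_ae F G : cmf F -> inL2 G -> aeT (fun x => F x = G x) -> inL2 F.
Proof.
move=> mF /inL2P[mG iG] e; apply/inL2P; split => //; apply: (ig_ae _ iG).
  by apply: measurable_funX; exact: measurable_normc.
by apply: aeT_imp e => x _ ->.
Qed.

Definition ek (k : int) (x : R) : C := expi (x * k%:~R).

Lemma cmf_expi (c : R) : cmf (fun x => expi (x * c)).
Proof.
split; apply: measurable_funTS.
  apply: (@measurableT_comp _ _ _ _ _ _ (@cos R)).
    exact: continuous_measurable_fun (@continuous_cos R).
  by apply: measurable_funM => //; exact: measurable_cst.
apply: (@measurableT_comp _ _ _ _ _ _ (@sin R)).
  exact: continuous_measurable_fun (@continuous_sin R).
by apply: measurable_funM => //; exact: measurable_cst.
Qed.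

Lemma cmf_ek k : cmf (ek k).
Proof. exact: cmf_expi. Qed.

Lemma normc_ek k x : normc (ek k x) = 1.
Proof. exact: normc_expi. Qed.

Lemma fourierE F xi : fourier F xi = ((2 * pi)^-1)%:C * cint (fun x => ek (- xi) x * F x).
Proof.
by rewrite /fourier; congr (_ * cint _); apply/funext => x; rewrite /ek rmorphN mulrN.
Qed.

Lemma cig_ek k F : cig F -> cig (fun x => ek k x * F x).
Proof. by apply: (@cigM 1); [exact: cmf_ek|move=> x _; rewrite normc_ek]. Qed.

Lemma fourierD F G xi : cig F -> cig G -> fourier (fun x => F x + G x) xi = fourier F xi + fourier G xi.
Proof.
move=> iF iG; rewrite !fourierE -mulrDr -cintD; [|exact: cig_ek..].
by congr (_ * cint _); apply/funext => x; rewrite mulrDr.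
Qed.

Lemma fourierZ c F xi : cig F -> fourier (fun x => c * F x) xi = c * fourier F xi.
Proof.
move=> iF; rewrite !fourierE mulrCA; congr (_ * _); rewrite -cintZ; last exact: cig_ek.
by congr cint; apply/funext => x; rewrite mulrCA.
Qed.

Lemma fourierN F xi : cig F -> fourier (fun x => - F x) xi = - fourier F xi.
Proof.
move=> iF; rewrite -[RHS]mulN1r -(fourierZ (-1))//.
by apply: (f_equal (fourier^~ xi)); apply/funext => x; rewrite mulN1r.
Qed.

Lemma fourierB F G xi : cig F -> cig G -> fourier (fun x => F x - G x) xi = fourier F xi - fourier G xi.
Proof.
move=> iF iG; rewrite fourierD ?fourierN//.
by have := cigZ (-1) iG; under eq_fun do rewrite mulN1r.
Qed.

Lemma fourier_ae F G xi : cmf F -> cmf G -> aeT (fun x => F x = G x) -> fourier F xi = fourier G xi.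
Proof.
move=> mF mG e; rewrite !fourierE; congr (_ * _); apply: cint_ae.
- by apply: cmfM => //; exact: cmf_ek.
- by apply: cmfM => //; exact: cmf_ek.
- by apply: aeT_imp e => x _ ->.
Qed.

Lemma ekD k l x : ek (k + l) x = ek k x * ek l x.
Proof. by rewrite /ek intrD mulrDr expiD. Qed.

Lemma ek0 x : ek 0 x = 1.
Proof. by rewrite /ek mulr0 expi0. Qed.

Lemma expi_2pi (k : int) : expi (2 * pi * k%:~R : R) = 1.
Proof.
have h (n : nat) : expi (2 * pi * n%:R : R) = 1.
  elim: n => [|n ih]; first by rewrite mulr0 expi0.
  rewrite (_ : 2 * pi * n.+1%:R = 2 * pi * n%:R + pi *+ 2); last by rewrite -natr1; ring.
  by rewrite expiD ih mul1r /expi cos2pi sin2pi.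
case: k => n; first exact: h.
have e : expi (2 * pi * (Negz n)%:~R : R) * expi (2 * pi * n.+1%:R) = 1.
  by rewrite -expiD NegzE rmorphN /= mulrN addrC -pmulrn subrr expi0.
by rewrite h mulr1 in e.
Qed.

Lemma int_trig (f F : R -> R) : continuous f -> (forall x, is_derive x (1 : R) F (f x)) ->
  \int[mu]_(x in TT) f x = F (2 * pi) - F 0.
Proof.
move=> cf dF.
have cF : continuous F.
  by move=> x; apply: differentiable_continuous; apply/derivable1_diffP; have [] := dF x.
have cw : {within `[0, 2 * pi]%classic, continuous f} by exact: continuous_subspaceT.
rewrite /Rintegral /torus -(@integral_itv_bndoo _ _ _ _ true false); last first.
  apply/measurable_EFinP; apply: measurable_funTS; exact: continuous_measurable_fun.
rewrite (@continuous_FTC2 _ f F)//; first exact: pi2_gt0.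
  split; first by move=> x _; have [] := dF x.
    by apply: cvg_at_right_filter; exact: cF.
  by apply: cvg_at_left_filter; exact: cF.
by move=> x _; rewrite derive1E; have [_ ->] := dF x.
Qed.

Lemma cint_ek k : cint (ek k) = if k == 0 then (2 * pi)%:C else 0.
Proof.
case: eqVneq => [->|k0].
  rewrite (_ : ek 0 = fun=> 1); last by apply/funext => x; rewrite ek0.
  by apply: complexP; rewrite /= int_cst ?mulr1 ?mulr0.
have k1 : k%:~R != 0 :> R by rewrite intr_eq0.
have [e1 e2] : cos (2 * pi * k%:~R : R) = 1 /\ sin (2 * pi * k%:~R : R) = 0.
  by have := expi_2pi k => -[].
apply: complexP; rewrite /=.
  have d x : is_derive x (1 : R) (fun x => k%:~R^-1 * sin (x * k%:~R)) (cos (x * k%:~R)).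
    have := @is_derive_lin R k%:~R x; under eq_fun do rewrite mulrC.
    move=> d; have d' := is_deriveM (is_derive_cst (k%:~R^-1 : R) x 1) (is_derive1_comp (is_derive_sin _) d).
    by apply: is_derive_eq d' _; rewrite scaler0 addr0 /GRing.scale /= mulrCA mulVf ?mulr1.
  rewrite (int_trig _ d); first by rewrite e2 mul0r sin0 !mulr0 subrr.
  by move=> x; apply: continuous_comp; [exact: mulrr_continuous|exact: continuous_cos].
have d x : is_derive x (1 : R) (fun x => - k%:~R^-1 * cos (x * k%:~R)) (sin (x * k%:~R)).
  have := @is_derive_lin R k%:~R x; under eq_fun do rewrite mulrC.
  move=> d; have d' := is_deriveM (is_derive_cst (- k%:~R^-1 : R) x 1) (is_derive1_comp (is_derive_cos _) d).
  by apply: is_derive_eq d' _; rewrite scaler0 addr0 /GRing.scale /= mulNr mulNr mulrN opprK mulrCA mulVf ?mulr1.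
rewrite (int_trig _ d); first by rewrite e1 mul0r cos0 subrr.
by move=> x; apply: continuous_comp; [exact: mulrr_continuous|exact: continuous_sin].
Qed.

End Integration.

(** * Uniqueness of Fourier coefficients *)
Section Uniqueness.
Context {R : realType}.
Local Notation C := R[i].
Local Notation normc := Normc.normc.
Local Notation mu := (@lebesgue_measure R).
Local Notation TT := (@torus R).
Implicit Types (f g h p : R -> R) (F G H : R -> C).

(** Real trigonometric polynomials. The list of complex coefficients may repeat
    frequencies, which makes products and powers immediate. *)
Definition trig p := exists I : seq (C * int), forall x, (p x)%:C = \sum_(i <- I) i.1 * ek i.2 x.

Lemma trig_ext p q : p =1 q -> trig p -> trig q.
Proof. by move=> /funext ->. Qed.

Lemma trig_cst (c : R) : trig (fun=> c).
Proof. by exists [:: (c%:C, 0)] => x; rewrite big_seq1 ek0 mulr1. Qed.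

Lemma trigD p q : trig p -> trig q -> trig (fun x => p x + q x).
Proof.
move=> [I hI] [J hJ]; exists (I ++ J) => x; rewrite big_cat /= -hI -hJ.
by apply: complexP; rewrite /= ?addr0.
Qed.

Lemma trigM p q : trig p -> trig q -> trig (fun x => p x * q x).
Proof.
move=> [I hI] [J hJ]; exists [seq (i.1 * j.1, i.2 + j.2) | i <- I, j <- J] => x.
rewrite big_allpairs_dep /= (_ : (p x * q x)%:C = (p x)%:C * (q x)%:C); last first.
  by apply: complexP; rewrite /= ?mulr0 ?mul0r ?subr0 ?addr0.
rewrite hI hJ mulr_suml; apply: eq_bigr => i _; rewrite mulr_sumr; apply: eq_bigr => j _.
by rewrite /= ekD mulrACA.
Qed.

Lemma trigX p n : trig p -> trig (fun x => p x ^+ n).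
Proof.
move=> tp; elim: n => [|n ih]; first exact: trig_cst.
by under eq_fun do rewrite exprS; exact: trigM.
Qed.

Lemma trig_cos m : trig (fun x => cos (x - m)).
Proof.
exists ([:: (2^-1 * expi (- m), 1); (2^-1 * expi m, -1)] : seq (C * int)) => x.
rewrite !big_cons big_nil addr0 /ek /= -!mulrA -!expiD -mulrDr mulr1 mulrN1.
have -> : expi (- m + x) + expi (m - x) = (2 * cos (x - m))%:C :> C.
  rewrite (_ : m - x = - (x - m)); last by rewrite opprB.
  rewrite [- m + x]addrC /expi cosN sinN; apply: complexP => /=; last by rewrite subrr.
  by rewrite mulr_natl mulr2n.
by rewrite rmorphM rmorph_nat mulKf// pnatr_eq0.
Qed.

Lemma trig_mf p : trig p -> measurable_fun TT p.
Proof.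
move=> [I hI]; have [+ _] : cmf (fun x => \sum_(i <- I) i.1 * ek i.2 x).
  by apply: cmf_sum => i; apply: cmfM; [exact: cmf_cst|exact: cmf_ek].
by under eq_fun do rewrite -hI.
Qed.

Lemma trig_orth F p : cig F -> (forall k, fourier F k = 0) -> trig p ->
  cint (fun x => (p x)%:C * F x) = 0.
Proof.
move=> iF F0 [I hI].
have e k : cint (fun x => ek k x * F x) = 0.
  have := F0 (- k); rewrite fourierE opprK => /eqP; rewrite mulf_eq0 => /orP[|/eqP//].
  by move=> /eqP /(congr1 (@complex.Re R)) /= /eqP; rewrite invr_eq0 gt_eqF// pi2_gt0.
rewrite (_ : (fun x => _) = fun x => \sum_(i <- I) i.1 * (ek i.2 x * F x)); last first.
  by apply/funext => x; rewrite hI mulr_suml; apply: eq_bigr => i _; rewrite mulrA.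
rewrite cint_sum; last by move=> i; apply: cigZ; exact: cig_ek.
by rewrite big1// => i _; rewrite cintZ ?e ?mulr0//; exact: cig_ek.
Qed.

Lemma bernoulli (y : R) n : 0 <= y <= 1 -> 1 - n%:R * y <= (1 - y) ^+ n.
Proof.
move=> /andP[y0 y1]; elim: n => [|n ih]; first by rewrite mul0r subr0 expr0.
rewrite exprS; apply: (@le_trans _ _ ((1 - y) * (1 - n%:R * y))); last first.
  by rewrite ler_wpM2l// subr_ge0.
have : 0 <= n%:R * y * y by rewrite !mulr_ge0.
by rewrite -natr1; lra.
Qed.

Lemma bernoulli2 (y : R) n : 0 <= y -> 1 + n%:R * y <= (1 + y) ^+ n.
Proof.
move=> y0; elim: n => [|n ih]; first by rewrite mul0r addr0 expr0.
rewrite exprS; apply: (@le_trans _ _ ((1 + y) * (1 + n%:R * y))); last first.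
  by rewrite ler_wpM2l// addr_ge0.
have : 0 <= n%:R * y * y by rewrite !mulr_ge0.
by rewrite -natr1; lra.
Qed.

(** Polynomials on the unit interval that tend to 1 below 1/2 and to 0 above it, as
    in the proof of the Stone-Weierstrass theorem by Brosowski and Deutsch. *)
Definition qn (t : R) n : R := (1 - t ^+ n) ^+ (2 ^ n).

Lemma qn_ge0 t n : 0 <= t <= 1 -> 0 <= qn t n.
Proof. by move=> /andP[t0 t1]; rewrite exprn_ge0// subr_ge0 exprn_ile1. Qed.

Lemma qn_le1 t n : 0 <= t <= 1 -> qn t n <= 1.
Proof.
by move=> /andP[t0 t1]; rewrite exprn_ile1// ?subr_ge0 ?exprn_ile1// gerBl exprn_ge0.
Qed.

(** By Bernoulli, [qn t n >= 1 - (2 t) ^+ n]. *)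
Lemma qn_cvg1 t : 0 <= t < 2^-1 -> qn t n @[n --> \oo] --> (1 : R).
Proof.
move=> /andP[t0 t1]; have t01 : 0 <= t <= 1 by apply/andP; split; lra.
apply: (@squeeze_cvgr _ _ _ _ (fun n => 1 - (2 * t) ^+ n) (fun=> 1)).
- apply: nearW => n; rewrite qn_le1// andbT.
  have := @bernoulli (t ^+ n) (2 ^ n) _; rewrite natrX exprMn; apply.
  by rewrite exprn_ge0// exprn_ile1//; lra.
- rewrite -[X in _ --> X]subr0; apply: cvgB; first exact: cvg_cst.
  by apply: cvg_expr; rewrite ger0_norm; lra.
- exact: cvg_cst.
Qed.

(** Since (1 - y)^N (1 + y)^N is at most 1, Bernoulli gives
    [qn t n <= (2 t)^-1 ^+ n]. *)
Lemma qn_cvg0 t : 2^-1 < t <= 1 -> qn t n @[n --> \oo] --> (0 : R).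
Proof.
move=> /andP[t0 t1]; have t01 : 0 <= t <= 1 by apply/andP; split; lra.
have tt : 0 < 2 * t by lra.
apply: (@squeeze_cvgr _ _ _ _ (fun=> 0) (fun n => (2 * t)^-1 ^+ n)).
- apply: nearW => n; rewrite qn_ge0//=.
  have h := @bernoulli2 (t ^+ n) (2 ^ n) _.
  have y0 : 0 <= t ^+ n by rewrite exprn_ge0//; lra.
  have q0 := qn_ge0 n t01.
  rewrite exprVn -[X in _ <= X]mul1r ler_pdivlMr ?exprn_gt0//.
  apply: (@le_trans _ _ (qn t n * (1 + t ^+ n) ^+ (2 ^ n))).
    rewrite ler_wpM2l//; apply: le_trans (h y0).
    by rewrite natrX exprMn lerDr.
  rewrite /qn -exprMn exprn_ile1//.
    have y1 : t ^+ n <= 1 by rewrite exprn_ile1//; lra.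
    by apply: mulr_ge0; [rewrite subr_ge0|exact: addr_ge0].
  have : 0 <= t ^+ n * t ^+ n by rewrite mulr_ge0.
  by move: (t ^+ n) => y; lra.
- exact: cvg_cst.
- apply: cvg_expr; rewrite ger0_norm ?invr_ge0 ?ltW//.
  by rewrite invf_lt1//; lra.
Qed.

Lemma sin_half_gt0 (y : R) : 0 < y < 2 * pi -> 0 < sin (y / 2).
Proof.
by move=> /andP[y0 y1]; apply: sin_gt0_pi; rewrite divr_gt0//= ltr_pdivrMr// mulrC.
Qed.

Lemma cosB_prod (y b : R) : cos (y - b / 2) - cos (b / 2) = 2 * (sin (y / 2) * sin ((b - y) / 2)).
Proof.
have -> : cos (b / 2) = cos (y / 2 + (b - y) / 2) by congr cos; field.
have -> : y - b / 2 = y / 2 - (b - y) / 2 by field.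
by rewrite cosB cosD; ring.
Qed.

(** A trigonometric polynomial with values in the unit interval which, on the torus,
    is below 1/2 exactly to the left of [b]; the product formula [cosB_prod] shows
    the sign change. *)
Definition bump (b y : R) := 2^-1 - 8^-1 * (cos (y - b / 2) - cos (b / 2)).

Lemma bump_bnd b y : 0 <= bump b y <= 1.
Proof.
rewrite /bump; have := cos_geN1 (y - b / 2); have := cos_le1 (y - b / 2).
have := cos_geN1 (b / 2); have := cos_le1 (b / 2).
by move: (cos _) (cos _) => u v *; apply/andP; split; lra.
Qed.

Lemma bump_lt b y : 0 < y < b -> b < 2 * pi -> bump b y < 2^-1.
Proof.
move=> /andP[y0 yb] b2; rewrite /bump cosB_prod.
have s1 : 0 < sin (y / 2) by apply: sin_half_gt0; rewrite y0 (lt_trans yb).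
have s2 : 0 < sin ((b - y) / 2).
  by apply: sin_half_gt0; rewrite subr_gt0 yb/= (le_lt_trans _ b2)// gerBl ltW.
by have := mulr_gt0 s1 s2; lra.
Qed.

Lemma bump_gt b y : 0 < b < y -> y < 2 * pi -> 2^-1 < bump b y.
Proof.
move=> /andP[b0 yb] y2; rewrite /bump cosB_prod.
have s1 : 0 < sin (y / 2) by apply: sin_half_gt0; rewrite (lt_trans b0 yb) y2.
have s2 : 0 < sin ((y - b) / 2).
  by apply: sin_half_gt0; rewrite subr_gt0 yb/= (le_lt_trans _ y2)// gerBl ltW.
have -> : sin ((b - y) / 2) = - sin ((y - b) / 2) by rewrite -sinN; congr sin; rewrite -mulNr opprB.
by have := mulr_gt0 s1 s2; lra.
Qed.

Lemma trig_qn b n : trig (fun y => qn (bump b y) n).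
Proof.
have tN p : trig p -> trig (fun x => - p x).
  by move=> tp; apply: trig_ext (trigM (trig_cst (-1)) tp) => x; rewrite mulN1r.
apply: trigX; apply: trigD; first exact: trig_cst.
apply: (tN (fun x => bump b x ^+ n)); apply: trigX.
apply: trigD; first exact: trig_cst.
apply: (tN (fun y => 8^-1 * (cos (y - b / 2) - cos (b / 2)))); apply: trigM; first exact: trig_cst.
by apply: trigD; [exact: trig_cos|exact: trig_cst].
Qed.

(** The polynomials [qn] of [bump] converge boundedly to the indicator of the part of
    the torus to the left of [b], except at [b]. *)
Lemma int_lt0 f b : ig f -> (forall p, trig p -> \int[mu]_(x in TT) (p x * f x) = 0) ->
  0 < b < 2 * pi -> \int[mu]_(x in TT) ((if x < b then 1 else 0) * f x) = 0.
Proof.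
move=> iF F0 /andP[b0 b2].
pose q n x := qn (bump b x) n.
have mq n : measurable_fun TT (q n) by apply: trig_mf; exact: trig_qn.
have qb n x : `|q n x| <= 1 by rewrite ger0_norm; [rewrite qn_le1// bump_bnd|rewrite qn_ge0// bump_bnd].
have mi : measurable_fun TT (fun x : R => if x < b then 1 else 0 : R).
  apply: measurable_funTS; apply: measurable_fun_ifT => //.
  by apply: measurable_fun_ltr.
(* the exceptional set is the point [b], where [bump] equals 1/2 *)
have ae1 : {ae mu, forall x, TT x ->
    (EFin \o (fun x => q n x * f x)) x @[n --> \oo] --> (EFin \o (fun x => (if x < b then 1 else 0) * f x)) x}.
  exists [set b]; split; [exact: measurable_set1|exact: lebesgue_measure_set1|].
  move=> x /= /not_implyP[Tx nc]; apply: contrapT => xb; apply: nc.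
  apply: cvg_EFin; first exact: nearW.
  rewrite /comp /=; apply: cvgM; last exact: cvg_cst.
  move: Tx; rewrite /torus /= in_itv /= => /andP[x0 x2].
  have := bump_bnd b x => /andP[t0 t1].
  case: ltgtP xb => // h _.
    by apply: qn_cvg1; rewrite t0 bump_lt// x0.
  by apply: qn_cvg0; rewrite t1 andbT bump_gt// b0.
have [] := @dominated_convergence _ _ _ mu TT mtorus (fun n => EFin \o (fun x => q n x * f x))
   (EFin \o (fun x => (if x < b then 1 else 0) * f x)) (EFin \o (fun x => `|f x|)) _ _ ae1.
- by move=> n; apply/measurable_EFinP; apply: (measurable_funM (mq n)); exact: ig_mf.
- by apply/measurable_EFinP; apply: (measurable_funM mi); exact: ig_mf.
- exact: ig_abs.
- apply: aeW => x n Tx /=; rewrite lee_fin normrM ler_piMl//.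
move=> _ _ cv.
have z n : (\int[mu]_(x in TT) (EFin \o (fun x => q n x * f x)%R) x = 0)%E.
  have i : ig (fun x => q n x * f x) by apply: (igM (mq n) _ iF).
  have := F0 _ (trig_qn b n); rewrite /Rintegral => e.
  have fz := integrable_fin_num mtorus i.
  by rewrite -(fineK fz); congr EFin.
rewrite /Rintegral.
suff -> : (\int[mu]_(x in TT) ((if x < b then 1 else 0) * f x)%:E = 0)%E by [].
apply: (cvg_unique _ cv) => //.
by rewrite (_ : [sequence _]_n = fun=> 0%E); [exact: cvg_cst|apply/funext].
Qed.

Lemma int_le0 f x : ig f -> (forall p, trig p -> \int[mu]_(x in TT) (p x * f x) = 0) ->
  \int[mu]_(y in `]-oo, x]) ((f \_ TT) y) = 0.
Proof.
move=> iF F0.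
rewrite -Rintegral_mkcondr Rintegral_mkcondl.
have E : \int[mu]_(y in TT) (f \_ `]-oo, x]) y = \int[mu]_(y in TT) ((if y <= x then 1 else 0) * f y).
  apply: int_ext => y _; rewrite patchE mem_setE in_itv /=.
  by case: ifP => _; rewrite ?mul1r ?mul0r.
rewrite E.
have [x0|x0] := leP x 0.
  rewrite (@int_ext _ _ (fun=> 0)) ?int_cst ?mulr0// => y.
  by rewrite /torus /= in_itv/= => /andP[y0 _]; rewrite leNgt (le_lt_trans x0)// mul0r.
have [x2|x2] := leP (2 * pi) x.
  have := F0 _ (trig_cst 1) => <-; apply: int_ext => y.
  by rewrite /torus /= in_itv/= => /andP[_ y2]; rewrite (le_trans (ltW y2)).
rewrite -[RHS](@int_lt0 f x iF F0) ?x0//.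
have m1 : measurable_fun TT (fun y : R => if y <= x then 1 else 0 : R).
  by apply: measurable_funTS; apply: measurable_fun_ifT => //; apply: measurable_fun_ler.
have m2 : measurable_fun TT (fun y : R => if y < x then 1 else 0 : R).
  by apply: measurable_funTS; apply: measurable_fun_ifT => //; apply: measurable_fun_ltr.
apply: int_ae.
- by apply: measurable_funM => //; exact: ig_mf.
- by apply: measurable_funM => //; exact: ig_mf.
exists [set x]; split; [exact: measurable_set1|exact: lebesgue_measure_set1|].
move=> y /= /not_implyP[Ty nc]; apply: contrapT => xb; apply: nc.
by case: ltgtP xb.
Qed.

(** All primitives vanish, so the function vanishes at its Lebesgue points. *)
Lemma trig_ae0 f : ig f -> (forall p, trig p -> \int[mu]_(x in TT) (p x * f x) = 0) ->
  aeT (fun x => f x = 0).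
Proof.
move=> iF F0.
have iT : mu.-integrable [set: R] (EFin \o (f \_ TT)).
  rewrite -restrict_EFin; apply/integrable_restrict => //; first exact: mtorus.
  by rewrite setTI.
have iy y : mu.-integrable `]-oo, y] (EFin \o (f \_ TT)).
  by apply: integrableS iT => //.
have loc : locally_integrable [set: R] (f \_ TT) by apply: integrable_locally => //; exact: mtorus.
have := FTC1Ny iy loc.
rewrite (_ : (fun x => _) = fun=> 0 : R); last by apply/funext => x; exact: int_le0.
rewrite /aeT => h; apply: (@filterS _ _ (ae_filter_ringOfSetsType mu)) h => x [_ +] Tx.
by rewrite derive1_cst patchE mem_set.
Qed.

(** A function orthogonal to all exponentials is orthogonal to real trigonometric
    polynomials, hence so are its real and imaginary parts. *)
Theorem fourier_uniq F : cig F -> (forall k, fourier F k = 0) -> aeT (fun x => F x = 0).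
Proof.
move=> iF F0; have [iR iI] := iF.
have := @trig_ae0 _ iR _; have := @trig_ae0 _ iI _.
move=> hI hR; apply: (aeT_imp2 _ (hR _) (hI _)).
- by move=> x _ a b; apply: complexP.
- move=> p tp; have := trig_orth iF F0 tp => /(congr1 (@complex.Re R)) /= <-.
  by apply: int_ext => x _; rewrite cReM /= mul0r subr0.
- move=> p tp; have := trig_orth iF F0 tp => /(congr1 (@complex.Im R)) /= <-.
  by apply: int_ext => x _; rewrite cImM /= mul0r addr0.
Qed.

Corollary fourier_eq F G : cig F -> cig G -> (forall k, fourier F k = fourier G k) ->
  aeT (fun x => F x = G x).
Proof.
move=> iF iG e.
have iB : cig (fun x => F x - G x).
  by apply: cigD => //; have := cigZ (-1) iG; under eq_fun do rewrite mulN1r.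
have := @fourier_uniq _ iB _ => h; apply: aeT_imp (h _) => [x _|k].
  by move/eqP; rewrite subr_eq0 => /eqP.
by rewrite fourierB// e subrr.
Qed.

End Uniqueness.

(** * Absolutely convergent Fourier series *)
Section Synthesis.
Context {R : realType}.
Local Notation C := R[i].
Local Notation normc := Normc.normc.
Local Notation mu := (@lebesgue_measure R).
Local Notation TT := (@torus R).
Local Opaque nsum.
Implicit Types (F G H : R -> C) (c : int -> C).

(** By the inequality c <= w c^2 + 1/w and summability of the inverse weights. *)
Lemma hball_csmb g c A : 1 / 2 < g -> hball g c A -> csmb c.
Proof.
move=> g2 [A0 hA]; have h1 := nsum_iwt_lt g2.
have h2 : (nsum (fun k => wt g k * normc (c k) ^+ 2)%R < +oo)%E by apply: le_lt_trans hA _; rewrite ltry.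
apply: (csmb_le (nsum_ltD _ _ h2 h1)).
- by move=> k; rewrite mulr_ge0 ?sqr_ge0// wt_ge0.
- by move=> k; rewrite invr_ge0 wt_ge0.
- move=> k; have w0 := wt_gt0 g k; have n0 := normc_ge0 (c k).
  move: (wt g k) (normc (c k)) w0 n0 => w y w0 y0.
  rewrite -(ler_pM2l w0) mulrDr mulfV ?gt_eqF//.
  by have := sqr_ge0 (w * y - 1); have := mulr_ge0 (ltW w0) y0; lra.
Qed.

Definition synth c (x : R) : C := csum (fun k => c k * ek k x).
Definition psynth c (s : seq int) (x : R) : C := \sum_(k <- s) c k * ek k x.

Section L1.
Variable c : int -> C.
Hypothesis c1 : csmb c.

Lemma synth_csmb x : csmb (fun k => c k * ek k x).
Proof. by apply: (csmb_le c1) => k; rewrite Normc.normcM normc_ek mulr1. Qed.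

Lemma synth_apx (e : R) : 0 < e -> exists s, [/\ uniq s, (nsum (fun k => normc (off s c k)) <= e%:E)%E &
  forall x, normc (synth c x - psynth c s x) <= e].
Proof.
move=> e0; have [s us h] := csum_tail c1 e0; exists s; split => // x.
rewrite /synth (csum_split (synth_csmb x) us) addrC addKr; apply: csum_le.
apply: le_trans h; apply: le_nsum => k; rewrite /off; case: ifP => // _.
by rewrite Normc.normcM normc_ek mulr1.
Qed.

Lemma synth_bnd : exists B, forall x, normc (synth c x) <= B.
Proof.
have [B B0 hB] := nsum_finlt (fun k => normc_ge0 (c k)) c1; exists B => x.
apply: csum_le; rewrite -hB; apply: le_nsum => k.
by rewrite Normc.normcM normc_ek mulr1.
Qed.

Lemma cmf_psynth s : cmf (psynth c s).
Proof. by apply: cmf_sum => k; apply: cmfM; [exact: cmf_cst|exact: cmf_ek]. Qed.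

(** A uniform limit of trigonometric polynomials. *)
Lemma cmf_synth : cmf (synth c).
Proof.
have e0 n : 0 < n.+1%:R^-1 :> R by rewrite invr_gt0 ltr0n.
have /choice[s hs] : forall n : nat, exists s, forall x, normc (synth c x - psynth c s x) <= n.+1%:R^-1.
  by move=> n; have [s [_ _ h]] := synth_apx (e0 n); exists s.
have lim (f : C -> R) : (forall z w, `|f z - f w| <= normc (z - w)) ->
    (forall n, measurable_fun TT (fun x => f (psynth c (s n) x))) -> measurable_fun TT (fun x => f (synth c x)).
  move=> fl fm; apply: (measurable_fun_cvg fm) => x _.
  apply/cvgrPdist_le => e ep.
  have [N hN] : exists N : nat, N.+1%:R^-1 <= e.
    exists (Num.truncn e^-1); rewrite invf_ple ?posrE ?ltr0n// ltW//.
    by rewrite truncnS_gt.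
  exists N => // n /= nN; apply: le_trans (fl _ _) _; apply: le_trans (hs n x) _.
  by apply: le_trans hN; rewrite lef_pV2 ?posrE ?ltr0n// ler_nat ltnS.
split; apply: lim.
- by move=> z w; rewrite -cReN -cReD; exact: Re_le_normc.
- by move=> n; exact: (cmf_psynth _).1.
- by move=> z w; rewrite -cImN -cImD; exact: Im_le_normc.
- by move=> n; exact: (cmf_psynth _).2.
Qed.

Lemma inL2_synth : inL2 (synth c).
Proof.
have [B hB] := synth_bnd; apply: (@inL2_bnd _ B) => //; exact: cmf_synth.
Qed.

Lemma cig_synth : cig (synth c).
Proof. exact: inL2_cig inL2_synth. Qed.

(** Partial sums converge uniformly, so they may be integrated against an integrable
    function. *)
Lemma cint_synth H : cig H -> cint (fun x => synth c x * H x) = csum (fun k => c k * cint (fun x => ek k x * H x)).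
Proof.
move=> iH; pose A := \int[mu]_(x in TT) normc (H x).
have A0 : 0 <= A by apply: int_ge0 => x _; exact: normc_ge0.
have hk k : normc (cint (fun x => ek k x * H x)) <= 2 * A.
  apply: cint_le; [by apply: cmfM; [exact: cmf_ek|exact: cig_cmf]|exact: cig_normc|].
  by move=> x _; rewrite Normc.normcM normc_ek mul1r.
have nA : (nsum (fun k => 2 * A * normc (c k))%R < +oo)%E.
  have [r _ hr] := nsum_finlt (fun k => normc_ge0 (c k)) c1.
  by rewrite nsumZ ?mulr_ge0// ?hr -?EFinM ?ltry// => k; exact: normc_ge0.
have sk : csmb (fun k => c k * cint (fun x => ek k x * H x)).
  by apply: (csmb_le nA) => k; rewrite Normc.normcM mulrC ler_wpM2r ?normc_ge0.
have [B hB] := synth_bnd.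
have iS : cig (fun x => synth c x * H x) by apply: (@cigM _ B) => //; exact: cmf_synth.
suff key e : 0 < e -> normc (cint (fun x => synth c x * H x) - csum (fun k => c k * cint (fun x => ek k x * H x))) <= 4 * A * e.
  apply/eqP; rewrite -subr_eq0; apply/eqP; apply: Normc.eq0_normc.
  apply/eqP; rewrite eq_le normc_ge0 andbT; apply/ler_addgt0Pl => d d0; rewrite addr0.
  have A4 : 0 < 4 * A + 1 by rewrite ltr_wpDl// mulr_ge0.
  apply: le_trans (key (d / (4 * A + 1)) _) _; first by rewrite divr_gt0.
  by rewrite mulrCA ler_piMr ?(ltW d0)// ler_pdivrMr// mul1r lerDl.
move=> e0; have [s [us hs hx]] := synth_apx e0.
have iP : cig (fun x => psynth c s x * H x).
  rewrite (_ : (fun x => _) = fun x => \sum_(k <- s) c k * (ek k x * H x)); last first.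
    by apply/funext => x; rewrite mulr_suml; apply: eq_bigr => k _; rewrite mulrA.
  by apply: cig_sum => k; apply: cigZ; exact: cig_ek.
have eP : cint (fun x => psynth c s x * H x) = \sum_(k <- s) c k * cint (fun x => ek k x * H x).
  rewrite (_ : (fun x => _) = fun x => \sum_(k <- s) c k * (ek k x * H x)); last first.
    by apply/funext => x; rewrite mulr_suml; apply: eq_bigr => k _; rewrite mulrA.
  rewrite cint_sum; last by move=> k; apply: cigZ; exact: cig_ek.
  by apply: eq_bigr => k _; rewrite cintZ//; exact: cig_ek.
rewrite (csum_split sk us) -eP opprD addrA.
have -> : cint (fun x => synth c x * H x) - cint (fun x => psynth c s x * H x) =
    cint (fun x => (synth c x - psynth c s x) * H x).
  rewrite -cintN// -cintD//; last by have := cigZ (-1) iP; under eq_fun do rewrite mulN1r.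
  by congr cint; apply/funext => x; rewrite mulrBl.
apply: le_trans (normcB_le _ _) _.
rewrite (_ : 4 * A * e = 2 * (e * A) + 2 * A * e); last by ring.
apply: lerD.
  rewrite -intZ; last exact: cig_normc.
  apply: cint_le.
  - apply: cmfM; last exact: cig_cmf.
    by apply: cmfD; [exact: cmf_synth|apply: cmfN; exact: cmf_psynth].
  - by apply: igZ; exact: cig_normc.
  - by move=> x _; rewrite Normc.normcM ler_wpM2r ?normc_ge0.
apply: csum_le; apply: (@le_trans _ _ (nsum (fun k => 2 * A * normc (off s c k)))).
  apply: le_nsum => k; rewrite /off; case: ifP => _; first by rewrite Normc.normc0 mulr0.
  by rewrite Normc.normcM mulrC ler_wpM2r ?normc_ge0.
rewrite nsumZ ?mulr_ge0//; last by move=> k; exact: normc_ge0.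
by rewrite [X in (_ <= X)%E]EFinM lee_wpmul2l// lee_fin mulr_ge0.
Qed.

Lemma pi2VC : ((2 * pi)^-1)%:C * (2 * pi)%:C = 1 :> C.
Proof. by rewrite -rmorphM mulVf ?gt_eqF ?pi2_gt0. Qed.

Lemma fourier_synth xi : fourier (synth c) xi = c xi.
Proof.
rewrite fourierE (_ : (fun x => _) = fun x => synth c x * ek (- xi) x); last by apply/funext => x; rewrite mulrC.
have ie k : cig (ek k) by apply: inL2_cig; apply: (@inL2_bnd _ 1); [exact: cmf_ek|move=> x _; rewrite normc_ek].
rewrite cint_synth//.
have e k : cint (fun x => ek k x * ek (- xi) x) = if k == xi then (2 * pi)%:C else 0.
  rewrite -(subr_eq0 k) -cint_ek; congr cint; apply/funext => x; by rewrite -ekD.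
rewrite (@csum1 _ _ _ xi); last by move=> k /negbTE h; rewrite e h mulr0.
by rewrite e eqxx mulrCA pi2VC mulr1.
Qed.

End L1.

Lemma cint_conj F : cig F -> cint (fun x => conjc (F x)) = conjc (cint F).
Proof.
move=> [a b]; apply: complexP => /=; last rewrite -intN//.
  by apply: int_ext => x _; case: (F x).
by apply: int_ext => x _; case: (F x).
Qed.

Lemma cig_conj F : cig F -> cig (fun x => conjc (F x)).
Proof.
move=> [a b]; split; first by apply: ig_ext a => x _; case: (F x).
by apply: ig_ext (igN b) => x _; case: (F x).
Qed.

Lemma conjcM (x y : C) : conjc (x * y) = conjc x * conjc y.
Proof. by case: x y => [a b] [a' b']; apply: complexP => /=; ring. Qed.

Lemma conj_ek k (x : R) : conjc (ek (- k) x) = ek k x.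
Proof. by rewrite /ek /expi /= rmorphN mulrN cosN sinN opprK. Qed.

Lemma cint_ek_fourier F k : cint (fun x => ek (- k) x * F x) = (2 * pi)%:C * fourier F k.
Proof. by rewrite fourierE mulrA [X in X * _]mulrC pi2VC mul1r. Qed.

Lemma parseval c F : csmb c -> cig F ->
  cint (fun x => synth c x * conjc (F x)) = csum (fun k => (2 * pi)%:C * (c k * conjc (fourier F k))).
Proof.
move=> c1 iF; rewrite cint_synth//; last exact: cig_conj.
apply: eq_csum => k; rewrite mulrCA; congr (_ * _).
have -> : (fun x => ek k x * conjc (F x)) = fun x => conjc (ek (- k) x * F x).
  by apply/funext => x; rewrite conjcM conj_ek.
rewrite cint_conj; last exact: cig_ek.
by rewrite cint_ek_fourier conjcM; congr (_ * _); rewrite /= oppr0.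
Qed.

Lemma mul_conj (z : C) : complex.Re (z * conjc z) = normc z ^+ 2.
Proof. by rewrite sqr_normcE; case: z => a b /=; ring. Qed.

Lemma E2_synth c (B : R) : csmb c -> (nsum (fun k => normc (c k) ^+ 2)%R <= B%:E)%E ->
  E2 (synth c) <= 2 * pi * B.
Proof.
move=> c1 hB; have p0 : 0 <= 2 * pi :> R by rewrite ltW// pi2_gt0.
have -> : E2 (synth c) = complex.Re (cint (fun x => synth c x * conjc (synth c x))).
  by apply: int_ext => x _; rewrite mul_conj.
rewrite parseval//; last exact: cig_synth.
apply: le_trans (ler_norm _) _; apply: le_trans (Re_le_normc _) _; apply: csum_le.
apply: (@le_trans _ _ (nsum (fun k => 2 * pi * normc (c k) ^+ 2))).
  apply: le_nsum => k; rewrite fourier_synth// !Normc.normcM normcR ger0_norm//.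
  by rewrite ler_wpM2l// (_ : normc (conjc (c k)) = normc (c k)) -?expr2//; case: (c k) => a b /=; rewrite sqrrN.
rewrite nsumZ//; last by move=> k; rewrite sqr_ge0.
by rewrite [X in (_ <= X)%E]EFinM lee_wpmul2l// lee_fin.
Qed.

Lemma csmb_fin (s : seq int) c : csmb (fun k => if k \in s then c k else 0).
Proof.
have us := undup_uniq s.
rewrite /csmb (nsum_split (s := undup s)) ?undup_uniq//; last by move=> k; exact: normc_ge0.
rewrite (@eq_nsum _ _ (off _ _) (fun=> 0)); last first.
  by move=> k; rewrite /off mem_undup; case: ifP => // ->; rewrite Normc.normc0.
by rewrite nsum0 adde0 ltry.
Qed.

(** With [p] the partial Fourier sum, integrate the pointwise inequality
    |F|^2 >= 2 Re (p conj F) - |p|^2. *)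
Theorem bessel_ineq F : inL2 F -> (nsum (fun k => normc (fourier F k) ^+ 2)%R <= ((2 * pi)^-1 * E2 F)%:E)%E.
Proof.
move=> hF; have iF := inL2_cig hF; have /inL2P[mF jF] := hF.
apply: nsum_le_seq => s us; rewrite lee_fin.
pose c k := if k \in s then fourier F k else 0.
have c1 : csmb c by exact: csmb_fin.
have sum (f : int -> C) : (forall k, k \notin s -> f k = 0) -> csum f = \sum_(k <- s) f k.
  move=> f0; have -> : f = fun k => if k \in s then f k else 0.
    by apply/funext => k; case: ifPn => // /f0.
  rewrite (csum_split (csmb_fin s f) us) (_ : off _ _ = fun=> 0); last first.
    by apply/funext => k; rewrite /off; case: ifP => // ->.
  by rewrite csum0 addr0.
pose Q := \sum_(k <- s) normc (fourier F k) ^+ 2.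
have e1 G : (forall k, k \in s -> fourier G k = fourier F k) -> cig G ->
    \int[mu]_(x in TT) complex.Re (synth c x * conjc (G x)) = 2 * pi * Q.
  move=> eG iG; rewrite -cint_Re parseval// sum; last first.
    by move=> k /negbTE ks; rewrite /c ks mul0r mulr0.
  rewrite cRe_sum mulr_sumr; rewrite !big_seq; apply: eq_bigr => k ks.
  rewrite eG// /c ks cReM mul_conj; set y := complex.Im (_ * conjc _).
  by rewrite [complex.Im _]/= mul0r subr0.
have e2 : E2 (synth c) = 2 * pi * Q.
  rewrite -(e1 (synth c)); first by apply: int_ext => x _; rewrite mul_conj.
    by move=> k ks; rewrite fourier_synth// /c ks.
  exact: cig_synth.
have e3 := e1 F (fun _ _ => erefl) iF.
have /inL2P[mS jS] := inL2_synth c1.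
have [B hB] := synth_bnd c1.
have iX : ig (fun x => complex.Re (synth c x * conjc (F x))).
  by have [] : cig (fun x => synth c x * conjc (F x)) by apply: (@cigM _ B) => //; exact: cig_conj.
have : \int[mu]_(x in TT) (2 * complex.Re (synth c x * conjc (F x)) - normc (synth c x) ^+ 2) <= E2 F.
  apply: int_le => //; first by apply: igB => //; exact: igZ.
  move=> x _; rewrite !sqr_normcE; case: (synth c x) (F x) => a b [a' b'] /=.
  by have := addr_ge0 (sqr_ge0 (a - a')) (sqr_ge0 (b - b')); rewrite !sqrrB; lra.
rewrite intB//; last exact: igZ.
rewrite intZ// e3 [X in _ - X]e2 => h.
by rewrite ler_pdivlMl ?pi2_gt0// -/Q; apply: le_trans h; lra.
Qed.

(** Both sides have the same coefficients. *)
Lemma synth_ae F : cig F -> csmb (fourier F) -> aeT (fun x => F x = synth (fourier F) x).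
Proof.
move=> iF c1; apply: fourier_eq => //; first exact: cig_synth.
by move=> k; rewrite fourier_synth.
Qed.

Lemma E2_le F (B : R) : inL2 F -> csmb (fourier F) -> (nsum (fun k => normc (fourier F k) ^+ 2)%R <= B%:E)%E ->
  E2 F <= 2 * pi * B.
Proof.
move=> hF c1 hB; apply: le_trans (E2_synth c1 hB); rewrite le_eqVlt; apply/orP; left; apply/eqP.
have /inL2P[mF _] := hF.
apply: int_ae.
- by apply: measurable_funX; exact: measurable_normc.
- by apply: measurable_funX; apply: measurable_normc; exact: cmf_synth.
- by apply: aeT_imp (synth_ae (inL2_cig hF) c1) => x _ ->.
Qed.

End Synthesis.

(** * The scheme on functions *)
Section Algebra.
Context {R : realType}.
Local Notation C := R[i].
Local Notation normc := Normc.normc.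
Local Notation mu := (@lebesgue_measure R).
Local Notation TT := (@torus R).
Local Opaque nsum.
Implicit Types (F G H : R -> C) (c d : int -> C).

Lemma inL2_multiplier m F : (exists H, is_multiplier m F H) ->
  is_multiplier m F (multiplier m F).
Proof. by move=> [H hH]; apply: (xgetPex _ (ex_intro _ H hH)). Qed.

(** The absolutely convergent series with these coefficients is a representative. *)
Lemma multiplier_l1 m F : csmb (fun k => m k * fourier F k) -> is_multiplier m F (multiplier m F).
Proof.
move=> h; apply: inL2_multiplier; exists (synth (fun k => m k * fourier F k)).
by split; [exact: inL2_synth|move=> k; rewrite fourier_synth].
Qed.

Section Reg.
Variable g : R.
Hypothesis g2 : 1 / 2 < g.

(** The domain on which the scheme acts: the coefficients of the function form a
    sequence in the weighted space, with no quantitative bound. *)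
Definition hsfun F c := [/\ inL2 F, fourier F = c & exists A, hball g c A].

Lemma hsfun_ext F F' c c' : F = F' -> c =1 c' -> hsfun F c -> hsfun F' c'.
Proof. by move=> -> /funext ->. Qed.

Lemma hsfun_cig F c : hsfun F c -> cig F.
Proof. by move=> [/inL2_cig]. Qed.

Lemma hsfun_csmb F c : hsfun F c -> csmb c.
Proof. by move=> [_ _ [A hA]]; exact: hball_csmb hA. Qed.

Lemma hsfunD F G c d : hsfun F c -> hsfun G d -> hsfun (fun x => F x + G x) (fun k => c k + d k).
Proof.
move=> rF rG; have iF := hsfun_cig rF; have iG := hsfun_cig rG.
case: rF rG => hF eF [A hA] [hG eG [B hB]]; split; first exact: inL2D.
- by apply/funext => k; rewrite fourierD// eF eG.
- by exists (A + B); exact: hballD.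
Qed.

Lemma hsfunZ z F c : hsfun F c -> hsfun (fun x => z * F x) (fun k => z * c k).
Proof.
move=> rF; have iF := hsfun_cig rF; case: rF => hF eF [A hA]; split; first exact: inL2Z.
- by apply/funext => k; rewrite fourierZ// eF.
- exists ((normc z + 1) * A); apply: hball_dom hA; first by rewrite ltr_wpDl ?normc_ge0.
  by move=> k; rewrite Normc.normcM ler_wpM2r ?normc_ge0// lerDl.
Qed.

Lemma hsfunB F G c d : hsfun F c -> hsfun G d -> hsfun (fun x => F x - G x) (fun k => c k - d k).
Proof.
move=> rF rG; apply: hsfun_ext (hsfunD rF (hsfunZ (-1) rG)).
  by apply/funext => x; rewrite mulN1r.
by move=> k; rewrite mulN1r.
Qed.

Lemma hsfun_mult m F c : (forall k, normc (m k) <= 1) -> hsfun F c -> hsfun (multiplier m F) (fun k => m k * c k).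
Proof.
move=> m1 [hF eF [A hA]].
have hm : hball g (fun k => m k * c k) A.
  by apply: (hball_le hA) => // k; rewrite Normc.normcM ler_piMl ?normc_ge0.
have [|h1 h2] := @multiplier_l1 m F; first by rewrite eF; exact: hball_csmb hm.
by split => //; [apply/funext => k; rewrite h2 eF|exists A].
Qed.

(** One factor is replaced by its absolutely convergent series, which is integrated
    term by term against the other one. *)
Lemma hsfunM F G c d : hsfun F c -> hsfun G d -> hsfun (fun x => F x * G x) (theta 0 c d).
Proof.
move=> rF rG; have iF := hsfun_cig rF; have iG := hsfun_cig rG; have c1 := hsfun_csmb rF.
case: rF rG => hF eF [A hA] [hG eG [B hB]].
have ae : aeT (fun x => F x * G x = synth c x * G x).
  rewrite -eF in c1 *; by apply: aeT_imp (synth_ae iF c1) => x _ ->.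
have [M hM] := synth_bnd c1.
have mFG : cmf (fun x => F x * G x) by apply: cmfM; exact: cig_cmf.
have hSG : inL2 (fun x => synth c x * G x) by apply: (@inL2M _ M) => //; exact: cmf_synth.
split; first exact: inL2_ae hSG ae.
- apply/funext => xi.
  have /inL2P[mSG _] := hSG.
  rewrite (fourier_ae xi mFG mSG ae) fourierE.
  rewrite (_ : (fun x => _) = fun x => synth c x * (ek (- xi) x * G x)); last first.
    by apply/funext => x; rewrite mulrCA.
  rewrite cint_synth//; last exact: cig_ek.
  have e k : cint (fun x => ek k x * (ek (- xi) x * G x)) = (2 * pi)%:C * d (xi - k).
    by rewrite -eG -cint_ek_fourier; congr cint; apply/funext => x; rewrite mulrA -ekD opprB.
  rewrite /theta /conv2 -csumZ; last first.
    apply: (csmb_le (g := fun k => (2 * pi * B * normc (c k))%R)).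
      have [r _ hr] := nsum_finlt (fun k => normc_ge0 (c k)) c1.
      have p0 : 0 <= 2 * pi * B :> R.
        by rewrite mulr_ge0 ?(ltW (hball_gt0 hB))// ltW// pi2_gt0.
      by rewrite nsumZ ?hr -?EFinM ?ltry// => k; exact: normc_ge0.
    move=> k; rewrite e !Normc.normcM normcR ger0_norm ?(ltW pi2_gt0)//.
    rewrite mulrC ler_wpM2r ?normc_ge0// ler_wpM2l ?(ltW pi2_gt0)//.
    have g0 : 0 <= g by move: g2; lra.
    exact: (hball_term _ g0 hB).
  by apply: eq_csum => k; rewrite e phase2_0 mul1r mulrCA; congr (_ * _); rewrite mulrA pi2VC mul1r.
- by exists (kap g * A * B); exact: theta_hball.
Qed.

Lemma hsfun_sq F c : hsfun F c -> hsfun (fun x => F x ^+ 2) (theta 0 c c).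
Proof. by move=> rF; apply: hsfun_ext (hsfunM rF rF). Qed.

Lemma hsfun_cube F c : hsfun F c -> hsfun (fun x => F x ^+ 3) (conv3 (fun k l n => c k * c l * c n)).
Proof.
move=> rF; apply: hsfun_ext (hsfunM (hsfun_sq rF) rF).
  by apply/funext => x; rewrite !exprS expr0 mulr1 mulrA.
move=> xi; case: rF => _ _ [A hA]; rewrite /theta /conv3; apply: eq_conv2 => j n.
rewrite phase2_0 mul1r mulrC -(conv2Z g2); last exact: (maj2_theta _ hA hA).
by apply: eq_conv2 => k l; rewrite phase2_0 mul1r mulrC.
Qed.

Lemma cint_fourier0 F : ((2 * pi)^-1)%:C * cint F = fourier F 0.
Proof. by rewrite fourierE; congr (_ * cint _); apply/funext => x; rewrite oppr0 ek0 mul1r. Qed.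

(** The mean is the coefficient at frequency 0. *)
Lemma hsfun_proj F c : hsfun F c -> hsfun (proj_mean0 F) (pmean c).
Proof.
move=> rF; have iF := hsfun_cig rF; case: rF => hF eF [A hA].
pose z := ((2 * pi)^-1)%:C * cint F; have ez : z = c 0 by rewrite /z cint_fourier0 eF.
have hz : inL2 (fun=> - z).
  by apply: (@inL2_bnd _ (normc z)) => [|x _]; [exact: cmf_cst|rewrite normcN].
split.
- exact: (inL2D hF hz).
- apply/funext => k; rewrite (fourierD k iF (inL2_cig hz)) eF /pmean.
  have -> : fourier (fun=> - z) k = - z * (if k == 0 then 1 else 0).
    rewrite fourierE (_ : (fun x => _) = fun x => (- z) * ek (- k) x); last first.
      by apply/funext => x; rewrite mulrC.
    rewrite cintZ; last by apply: inL2_cig; apply: (@inL2_bnd _ 1); [exact: cmf_ek|move=> x _; rewrite normc_ek].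
    by rewrite cint_ek oppr_eq0; case: ifP => _; rewrite ?mulr0// mulrCA pi2VC.
  by case: eqVneq => [->|_]; rewrite ?mulr1 ?mulr0 ?addr0// ez subrr.
- by exists A; apply: (hball_le hA) => // k; rewrite /pmean; case: ifP; rewrite ?Normc.normc0 ?normc_ge0.
Qed.

Lemma hsfun_E tau F c : hsfun F c -> hsfun (exp_dx3 (- tau) F) (airy tau c).
Proof.
move=> rF; apply: hsfun_ext (hsfun_mult _ rF) => //; last by move=> k; rewrite normc_expi.
by move=> k; rewrite /airy; congr (expi _ * _); rewrite mulNr opprK.
Qed.

Lemma hsfun_D F c : hsfun F c -> hsfun (dx_inv F) (Dinv c).
Proof. by move=> rF; apply: hsfun_ext (hsfun_mult _ rF) => // k; exact: normc_iz_le1. Qed.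

Lemma DinvE c k : Dinv c k = iz k * c k.
Proof. by []. Qed.

Lemma airyE t c k : airy t c k = expi (t * k%:~R ^+ 3) * c k.
Proof. by []. Qed.

Lemma airy_Dinv tau c : airy tau (Dinv c) = Dinv (airy tau c).
Proof. by apply/funext => k; rewrite /airy /Dinv mulrCA. Qed.

(** The Airy symbols of the inputs, divided by that of the output, give the
    interaction phase. *)
Lemma theta_airyE t a b A B xi : hball g a A -> hball g b B ->
  theta 0 (airy t a) (airy t b) xi = expi (t * xi%:~R ^+ 3) * theta t a b xi.
Proof.
move=> ha hb'; rewrite /theta -(conv2_diag g2 (fun k => expi (t * k%:~R ^+ 3))); last first.
  exact: maj2_theta ha hb'.
apply: eq_conv2 => k l; rewrite phase2_0 mul1r.
have -> : airy t a k * airy t b l = expi (t * k%:~R ^+ 3) * expi (t * l%:~R ^+ 3) * (a k * b l).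
  by rewrite /airy; ring.
rewrite [RHS]mulrA -!expiD.
by congr (expi _ * _); rewrite /phase2 intrD; ring.
Qed.

Lemma conv3_airy t a A xi : hball g a A ->
  conv3 (fun k l n => airy t a k * airy t a l * airy t a n) xi =
  expi (t * xi%:~R ^+ 3) * conv3 (fun k l n => phase3 t k l n * (a k * a l * a n)) xi.
Proof.
move=> ha; rewrite -(conv3_diag g2 (fun k => expi (t * k%:~R ^+ 3))); last first.
  by apply: (maj3_mul ler01 _ ha ha ha) => k l n; rewrite normc_expi.
apply: eq_conv3 => k l n; rewrite /airy /phase3.
transitivity (expi (t * k%:~R ^+ 3) * expi (t * l%:~R ^+ 3) * expi (t * n%:~R ^+ 3) * (a k * a l * a n)); first by ring.
by rewrite [RHS]mulrA -!expiD; congr (expi _ * _); rewrite !intrD; ring.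
Qed.

(** Each of the nine terms is computed with the rules above and the Airy symbol is
    factored out; the differences of paired terms produce [quad], the first term
    of [cubic3] and [bdry]. The
    mass term uses that the integral of a square is 2 pi times a coefficient. *)
Lemma fourier_scheme tau F c : c 0 = 0 -> hsfun F c -> hsfun (ELRI1 tau F) (fstep tau c).
Proof.
move=> c0 rF; have [_ eF [A hA]] := rF.
have rE := hsfun_E tau rF; have rD := hsfun_D rF; have rED := hsfun_E tau rD.
have hd := hball_Dinv hA; have hEd := hball_airy tau hd.
have T2 := hsfunZ 6^-1 (hsfun_E tau (hsfun_sq rD)).
have T3 := hsfunZ 6^-1 (hsfun_sq rED).
have T4 := hsfunZ 18^-1 (hsfun_proj (hsfunM rED (hsfun_D (hsfun_sq rED)))).
have T5 := hsfunZ 18^-1 (hsfun_proj (hsfunM rED (hsfun_E tau (hsfun_D (hsfun_sq rD))))).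
have T6 := hsfunZ 54^-1 (hsfun_E tau (hsfun_D (hsfun_cube rD))).
have T7 := hsfunZ 54^-1 (hsfun_D (hsfun_cube rED)).
have T8 := hsfunZ ((tau / (12 * pi))%:C * cint (fun y => F y ^+ 2)) rED.
have T9 := hsfunZ (tau / 18)%:C (hsfun_D (hsfun_E tau (hsfun_cube rF))).
have T := hsfunB (hsfunD (hsfunB (hsfunD (hsfunB (hsfunD (hsfunD (hsfunB rE T2) T3) T4) T5) T6) T7) T8) T9.
apply: hsfun_ext T; first by [].
move=> xi /=.
have hth := theta_hball g2 0 hEd hEd.
have hth' := theta_hball g2 0 hd hd.
have hGG : exists B, hball g (quad tau c) B.
  have h1 := theta_hball g2 tau hd hd.
  have h2 := hball_dom (c := 1) (b := fun k => 6^-1 * (theta tau (Dinv c) (Dinv c) k - theta 0 (Dinv c) (Dinv c) k)) ltr01 _ (hballB h1 hth').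
  eexists; apply: hball_ext (h2 _) => k; first by rewrite (quad_E g2 tau k hA).
  by rewrite mul1r Normc.normcM ler_piMl ?normc_ge0// normc_inv_nat invf_le1 ?ler1n ?ltr0n.
have [B hB] := hGG.
have e23 : - (6^-1 * airy tau (theta 0 (Dinv c) (Dinv c)) xi) + 6^-1 * theta 0 (airy tau (Dinv c)) (airy tau (Dinv c)) xi
   = expi (tau * xi%:~R ^+ 3) * quad tau c xi.
  by rewrite (theta_airyE tau xi hd hd) (quad_E g2 tau xi hA) /airy; ring.
(* the two projected products differ by six times [Dinv (quad tau c)] *)
have e45 : 18^-1 * pmean (theta 0 (airy tau (Dinv c)) (Dinv (theta 0 (airy tau (Dinv c)) (airy tau (Dinv c))))) xi
   - 18^-1 * pmean (theta 0 (airy tau (Dinv c)) (airy tau (Dinv (theta 0 (Dinv c) (Dinv c))))) xi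
   = expi (tau * xi%:~R ^+ 3) * (3^-1 * pmean (theta tau (Dinv c) (Dinv (quad tau c))) xi).
  rewrite !pmean_diag.
  have -> : Dinv (theta 0 (airy tau (Dinv c)) (airy tau (Dinv c))) =
      (fun k => airy tau (Dinv (theta 0 (Dinv c) (Dinv c))) k + airy tau (fun k => 6 * Dinv (quad tau c) k) k).
    apply/funext => k; rewrite DinvE (theta_airyE tau k hd hd) /airy !DinvE (quad_E g2 tau k hA).
    by field.
  have h6 : hball g (fun k => 6 * Dinv (quad tau c) k) (6 * B).
    apply: hball_dom (hball_Dinv hB) => // k; rewrite Normc.normcM.
    by rewrite (_ : normc 6 = 6) // (_ : 6 = (6%:R)%:C) ?normcR ?ger0_norm// rmorph_nat.
  rewrite (thetaDr g2 0 xi (hball_airy tau (hball_Dinv hth')) (hball_airy tau h6) hEd).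
  rewrite (theta_airyE tau xi hd h6).
  have -> : theta tau (Dinv c) (fun k => 6 * Dinv (quad tau c) k) xi = 6 * theta tau (Dinv c) (Dinv (quad tau c)) xi.
    rewrite /theta -(conv2Z g2); last exact: maj2_theta hd (hball_Dinv hB).
    by apply: eq_conv2 => k l; ring.
  by field.
have m1 : maj3 g (fun k l n => phase3 tau k l n * (Dinv c k * Dinv c l * Dinv c n)).
  by apply: (maj3_mul ler01 _ hd hd hd) => k l n; rewrite normc_expi.
have m2 : maj3 g (fun k l n => 1 * (Dinv c k * Dinv c l * Dinv c n)).
  by apply: (maj3_mul ler01 _ hd hd hd) => k l n; rewrite Normc.normc1.
(* the two cubes differ by the phase difference of [bdry] *)
have e67 : 54^-1 * airy tau (Dinv (conv3 (fun k l n => Dinv c k * Dinv c l * Dinv c n))) xi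
   - 54^-1 * Dinv (conv3 (fun k l n => airy tau (Dinv c) k * airy tau (Dinv c) l * airy tau (Dinv c) n)) xi
   = expi (tau * xi%:~R ^+ 3) * (- (54^-1 * bdry tau c xi)).
  have -> : bdry tau c xi = iz xi * (conv3 (fun k l n => phase3 tau k l n * (Dinv c k * Dinv c l * Dinv c n)) xi
      - conv3 (fun k l n => Dinv c k * Dinv c l * Dinv c n) xi).
    have -> : conv3 (fun k l n => Dinv c k * Dinv c l * Dinv c n) xi = conv3 (fun k l n => 1 * (Dinv c k * Dinv c l * Dinv c n)) xi.
      by apply: eq_conv3 => k l n; rewrite mul1r.
    rewrite -(conv3B g2 xi m1 m2) -(conv3_diag g2 iz); last first.
      apply: (maj3_dom (c := 1) ltr01 _ (maj3D m1 (maj3_dom (c := 1) (f' := fun k l n => -1 * (Dinv c k * Dinv c l * Dinv c n)) ltr01 _ m2))).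
        by move=> k l n; rewrite mul1r !mulN1r mul1r.
      by move=> k l n; rewrite !mul1r mulN1r normcN.
    by apply: eq_conv3 => k l n; move: (Dinv c k * Dinv c l * Dinv c n) (iz _) (phase3 _ _ _ _) => y z e; ring.
  rewrite (airyE tau (Dinv (conv3 _)) xi) !(DinvE (conv3 _) xi) (conv3_airy tau xi hd).
  by move: (conv3 _ _) (conv3 _ _) => y z; ring.
have e8 : (tau / (12 * pi))%:C * cint (fun y => F y ^+ 2) * airy tau (Dinv c) xi
   = expi (tau * xi%:~R ^+ 3) * ((tau / 6)%:C * theta 0 c c 0 * Dinv c xi).
  have [_ /(congr1 (fun f => f 0)) + _] := hsfun_sq rF.
  rewrite -cint_fourier0 => <-.
  have -> : (tau / 6)%:C = (tau / (12 * pi))%:C * (2 * pi)%:C :> C.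
    rewrite -rmorphM; congr (_%:C); have : pi != 0 :> R by rewrite gt_eqF ?pi_gt0.
    by move: (pi : R) => p p0; field.
  rewrite airyE -[cint _ in LHS]mul1r -pi2VC.
  move: (2 * pi)%:C ((2 * pi)^-1)%:C (tau / (12 * pi))%:C => y z r; ring.
have e9 : (tau / 18)%:C * Dinv (airy tau (conv3 (fun k l n => c k * c l * c n))) xi
   = expi (tau * xi%:~R ^+ 3) * ((tau / 18)%:C * Dinv (cube c) xi).
  by rewrite -airy_Dinv /airy /cube; ring.
have -> : fstep tau c xi = airy tau c xi + expi (tau * xi%:~R ^+ 3) * quad tau c xi
    + expi (tau * xi%:~R ^+ 3) * (3^-1 * pmean (theta tau (Dinv c) (Dinv (quad tau c))) xi)
    + expi (tau * xi%:~R ^+ 3) * (- (54^-1 * bdry tau c xi))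
    + expi (tau * xi%:~R ^+ 3) * ((tau / 6)%:C * theta 0 c c 0 * Dinv c xi)
    - expi (tau * xi%:~R ^+ 3) * ((tau / 18)%:C * Dinv (cube c) xi).
  by rewrite /fstep /airy /tstep /cubic3; ring.
by rewrite -e23 -e45 -e67 -e8 -e9; ring.
Qed.

End Reg.
End Algebra.

(** * The solution, the iterates and the error *)
Section Assembly.
Context {R : realType}.
Local Notation C := R[i].
Local Notation normc := Normc.normc.
Local Notation mu := (@lebesgue_measure R).
Local Notation TT := (@torus R).
Local Opaque nsum.
Implicit Types (F G H : R -> C) (c d : int -> C).

Lemma sqr_bessel s k : normc (bessel s k) ^+ 2 = wt s k :> R.
Proof.
rewrite /bessel normcR ger0_norm ?powR_ge0// -powR_mulrn ?powR_ge0//.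
by rewrite -powRrM divfK ?pnatr_eq0.
Qed.

Lemma multiplier_hball s A F : 0 < A -> is_multiplier (bessel s) F (multiplier (bessel s) F) ->
  E2 (multiplier (bessel s) F) <= A ^+ 2 -> hball s (fourier F) A.
Proof.
move=> A0 [h1 h2] hE; split => //; have := bessel_ineq h1.
rewrite (eq_nsum (g := fun k => wt s k * normc (fourier F k) ^+ 2)); last first.
  by move=> k; rewrite h2 Normc.normcM exprMn sqr_bessel.
move=> h; apply: le_trans h _; rewrite lee_fin; apply: le_trans hE.
rewrite ler_piMl ?E2_ge0// invf_le1 ?pi2_gt0//.
by have := @pi_ge2 R; lra.
Qed.

Lemma inHs_hball s F : inHs s F -> exists A, hball s (fourier F) A.
Proof.
move=> [_ /inL2_multiplier h]; exists (Num.sqrt (E2 (multiplier (bessel s) F)) + 1).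
have q0 := sqrtr_ge0 (E2 (multiplier (bessel s) F)).
have q1 : 0 < Num.sqrt (E2 (multiplier (bessel s) F)) + 1 by apply: ltr_wpDl.
apply: multiplier_hball => //.
rewrite -[leLHS]sqr_sqrtr ?E2_ge0// lerXn2r ?nnegrE ?lerDl// addr_ge0//.
Qed.

(** A finite norm means that the Bessel potential is square integrable; Bessel's
    inequality then bounds the coefficients, with a constant at most 1. *)
Lemma Hnorm_hball s F A : 0 < A -> (Hnorm s F <= A%:E)%E -> hball s (fourier F) A.
Proof.
move=> A0; rewrite /Hnorm; case: asboolP => // -[_ /inL2_multiplier h].
have [/inL2P[_ /L2normE ->] _] := h; rewrite lee_fin => hA.
apply: multiplier_hball => //.
by rewrite -[leLHS]sqr_sqrtr ?E2_ge0// lerXn2r ?nnegrE ?sqrtr_ge0// ltW.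
Qed.

(** The spare derivative makes the coefficients of the Bessel potential summable, so
    that it is an absolutely convergent series whose norm is given by Parseval. *)
Lemma hball_Hnorm s F A B : 0 <= A -> inL2 F -> hball (s + 1) (fourier F) B -> hball s (fourier F) A ->
  (Hnorm s F <= (Num.sqrt (2 * pi) * A)%:E)%E.
Proof.
move=> A0 hF [B0 hB] [_ hA].
have c1 : csmb (fun k => bessel s k * fourier F k).
  apply: (@hball_csmb _ 1 _ B); first by lra.
  split => //; rewrite (eq_nsum (g := fun k => wt (s + 1) k * normc (fourier F k) ^+ 2))//.
  move=> k; rewrite Normc.normcM exprMn sqr_bessel wtS mulrA [wt 1 k * _]mulrC.
  by congr (_ * _ * _); rewrite /wt powRr1// ltW// jb_gt0.
have h := multiplier_l1 c1.
rewrite /Hnorm; case: asboolP => [_|nh]; last first.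
  by exfalso; apply: nh; split => //; exists (multiplier (bessel s) F).
have [h1 h2] := h; have /inL2P[_ /L2normE ->] := h1.
rewrite lee_fin -[A]ger0_norm// -sqrtr_sqr -sqrtrM; last by rewrite ltW// pi2_gt0.
rewrite ler_wsqrtr//; have e : fourier (multiplier (bessel s) F) = fun k => bessel s k * fourier F k.
  by apply/funext.
apply: E2_le => //; first by rewrite e.
rewrite e (eq_nsum (g := fun k => wt s k * normc (fourier F k) ^+ 2))//.
by move=> k; rewrite Normc.normcM exprMn sqr_bessel.
Qed.

(** The test functions whose integrals are the real and imaginary parts of a Fourier
    coefficient; the family is closed under differentiation. *)
Definition trigtest (a p q : R) (x : R) := p * cos (- (x * a)) + q * sin (- (x * a)).

Lemma trigtest_derive (a p q x : R) : is_derive x (1 : R) (trigtest a p q) (trigtest a (- (a * q)) (a * p) x).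
Proof.
have d : is_derive x (1 : R) (fun x => - (x * a)) (- a).
  have := @is_derive_lin R (- a) x; rewrite (_ : (fun s => _) = fun x => - (x * a))//.
  by apply/funext => y; rewrite mulNr mulrC.
have d1 := is_deriveM (is_derive_cst p x 1) (is_derive1_comp (is_derive_cos _) d).
have d2 := is_deriveM (is_derive_cst q x 1) (is_derive1_comp (is_derive_sin _) d).
apply: is_derive_eq (is_deriveD d1 d2) _.
by rewrite /trigtest !scaler0 !addr0 /GRing.scale /=; ring.
Qed.

Lemma trigtest_derive1 a p q : derive1 (trigtest a p q) = trigtest a (- (a * q)) (a * p).
Proof. by apply/funext => x; rewrite derive1E; have [_ ->] := trigtest_derive a p q x. Qed.

Lemma trigtest_derive1n a p q n : exists p' q', derive1n n (trigtest a p q) = trigtest a p' q'.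
Proof.
elim: n => [|n [p' [q' ih]]]; first by exists p, q.
by rewrite derive1nS ih trigtest_derive1; do 2 eexists.
Qed.

Lemma trigtest_test (k : int) p q : test_function (trigtest k%:~R p q).
Proof.
split=> [n x|x].
  by have [p' [q' ->]] := trigtest_derive1n k%:~R p q n; have [] := trigtest_derive k%:~R p' q' x.
have : expi (- ((x + 2 * pi) * k%:~R)) = expi (- (x * k%:~R)) :> C.
  rewrite (_ : - _ = - (x * k%:~R) + 2 * pi * (- k)%:~R); last by rewrite rmorphN /=; ring.
  by rewrite expiD expi_2pi mulr1.
by rewrite /trigtest /expi => -[-> ->].
Qed.

Lemma trigtest_derive3 a p q : derive1n 3 (trigtest a p q) = trigtest a (a ^+ 3 * q) (- (a ^+ 3 * p)).
Proof. by rewrite /derive1n /= !trigtest_derive1; congr trigtest; ring. Qed.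

Lemma fourier_trigtest (f : R -> R) xi : fourier (toC f) xi =
  ((2 * pi)^-1)%:C * ((\int[mu]_(x in TT) (f x * trigtest xi%:~R 1 0 x)) +i*
     (\int[mu]_(x in TT) (f x * trigtest xi%:~R 0 1 x))).
Proof.
rewrite /fourier /cint; congr (_ * (_ +i* _)); apply: int_ext => x _;
  rewrite /toC /trigtest /expi /= ?mulr0 ?mul0r ?mul1r ?subr0 ?addr0 ?add0r ?addr0 mulrC//.
Qed.

Lemma trigtest_mf a p q : measurable_fun TT (trigtest a p q).
Proof.
apply: measurable_funTS; apply: continuous_measurable_fun => x.
by apply: differentiable_continuous; apply/derivable1_diffP; have [] := trigtest_derive a p q x.
Qed.

Lemma trigtest_bnd a p q x : `|trigtest a p q x| <= `|p| + `|q|.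
Proof.
apply: (le_trans (ler_normD _ _)); rewrite !normrM lerD// ler_piMr//.
  by rewrite ler_norml cos_geN1 cos_le1.
by rewrite ler_norml sin_geN1 sin_le1.
Qed.

Lemma int_trigtest (f : R -> R) a p q : ig f -> \int[mu]_(x in TT) (f x * trigtest a p q x) =
  p * \int[mu]_(x in TT) (f x * trigtest a 1 0 x) + q * \int[mu]_(x in TT) (f x * trigtest a 0 1 x).
Proof.
move=> iF.
have i p' q' : ig (fun x => f x * trigtest a p' q' x).
  have : ig (fun x => trigtest a p' q' x * f x).
    by apply: (igM (B := `|p'| + `|q'|)) => //; [exact: trigtest_mf|move=> x _; exact: trigtest_bnd].
  by apply: ig_ext => x _; rewrite mulrC.
rewrite -!intZ// -intD; [|exact: igZ..].
by apply: int_ext => x _; rewrite /trigtest; ring.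
Qed.

Lemma toC_ig (f : R -> R) : inL2 (toC f) -> ig f.
Proof. by move=> /inL2_cig[]. Qed.

Section Solution.
Variables (T g M : R) (u0 : R -> R) (u : R -> R -> R).
Hypothesis g2 : 1 / 2 < g.
Hypothesis T0 : 0 < T.
Hypothesis hu0 : inHs (g + 1) (toC u0).
Hypothesis mean0 : fourier (toC u0) 0 = 0.
Hypothesis hu : KdV_solution T (g + 1) u0 u.
Hypothesis hM : LinfHs T (g + 1) u = M%:E.

Local Notation U := (fun t => fourier (toC (u t))).

Let g3 : 1 / 2 < g + 1.
Proof. by move: g2; lra. Qed.

Lemma sol_hsfun t : 0 <= t <= T -> hsfun (g + 1) (toC (u t)) (U t).
Proof.
move=> tI; have [[h _] _ _] := hu; have h' := h t tI.
by have [h1 _] := h'; split => //; exact: inHs_hball.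
Qed.

(** The weak formulation tested against a cosine and a sine. *)
Lemma sol_cder t xi : 0 < t < T ->
  cder (fun s => U s xi) t (ii (xi%:~R ^+ 3) * U t xi + 2^-1 * zz xi * theta 0 (U t) (U t) xi).
Proof.
move=> tI; have tI' : 0 <= t <= T by case/andP: tI => *; rewrite !ltW.
have rU := sol_hsfun tI'; have [hU _ _] := rU.
have [_ _ hD] := hu.
have rU2 := hsfun_sq g3 rU.
have i1 := toC_ig hU.
have i2 : ig (fun x => u t x ^+ 2).
  have [] := inL2_cig (let: And3 h _ _ := rU2 in h).
  by move=> h _; apply: ig_ext h => x _; rewrite /toC expr2 cReM /= mul0r subr0.
have e2 : theta 0 (U t) (U t) xi = fourier (toC (fun x => u t x ^+ 2)) xi.
  have [_ <- _] := rU2; congr (fourier _ xi); apply/funext => x.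
  by rewrite /toC rmorphXn.
have D1 := hD _ t (trigtest_test xi 1 0) tI.
have D2 := hD _ t (trigtest_test xi 0 1) tI.
set a : R := xi%:~R in D1 D2 *.
rewrite trigtest_derive3 trigtest_derive1 (int_trigtest a (a ^+ 3 * 0) (- (a ^+ 3 * 1)) i1) (int_trigtest a (- (a * 0)) (a * 1) i2) in D1.
rewrite trigtest_derive3 trigtest_derive1 (int_trigtest a (a ^+ 3 * 1) (- (a ^+ 3 * 0)) i1) (int_trigtest a (- (a * 1)) (a * 0) i2) in D2.
have D : cder (fun r => (\int[mu]_(x in TT) (u r x * trigtest xi%:~R 1 0 x)) +i*
     (\int[mu]_(x in TT) (u r x * trigtest xi%:~R 0 1 x))) t (_ +i* _) := conj D1 D2.
apply: cder_ext (cderZ ((2 * pi)^-1)%:C D) => [s|]; first by rewrite fourier_trigtest.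
rewrite e2 !fourier_trigtest.
have -> : 2^-1 * zz xi = ii (2^-1 * xi%:~R) :> C.
  by apply: complexP; rewrite /zz /ii ?cReM ?cImM /=; field.
move: (Rintegral _ _ _) (Rintegral _ _ _) (Rintegral _ _ _) (Rintegral _ _ _) ((2 * pi)^-1) => y1 y2 y3 y4 p.
by apply: complexP; rewrite /ii /=; ring.
Qed.

(** Continuity in time, read on the coefficients. *)
Lemma Hnorm_near t e : 0 <= t <= T -> 0 < e -> exists2 d, 0 < d & forall r, 0 <= r <= T -> `|t - r| < d ->
  hball (g + 1) (fun k => U r k - U t k) e.
Proof.
move=> tI e0; have [[hI hc] _ _] := hu.
have nb : nbhs (0 : \bar R)%E [set y | (y < e%:E)%E].
  by apply: open_nbhs_nbhs; split; [exact: open_ereal_lt_ereal|rewrite /= lte_fin].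
have : \forall r \near within `[0, T]%classic (nbhs t),
    (Hnorm (g + 1) (fun x => toC (u r) x - toC (u t) x)%R < e%:E)%E := hc t tI _ nb.
rewrite near_withinE => -[d /= d0 h]; exists d => // r rI rd.
have hlt : (Hnorm (g + 1) (fun x => toC (u r) x - toC (u t) x)%R <= e%:E)%E.
  by apply: ltW; apply: h => //=; rewrite in_itv.
apply: hball_ext (Hnorm_hball e0 hlt) => k.
by rewrite fourierB//; apply: hsfun_cig (sol_hsfun _).
Qed.

Lemma sol_ccont xi : ccont (fun s => U s xi) 0 T.
Proof.
have key t e : 0 <= t <= T -> 0 < e -> exists2 d, 0 < d & forall r, 0 <= r <= T -> `|t - r| < d ->
    normc (U r xi - U t xi) <= e.
  move=> tI e0; have [d d0 h] := Hnorm_near tI e0; exists d => // r rI rd.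
  by apply: (hball_term _ _ (h r rI rd)); move: g2; lra.
have lim (f : C -> R) : (forall z w, `|f z - f w| <= normc (z - w)) ->
    {within `[0, T], continuous (fun s => f (U s xi))}.
  move=> fl; apply/subspace_continuousP => t /= tI; apply/cvgrPdist_le => e e0.
  move: tI; rewrite in_itv /= => tI; have [d d0 h] := key t e tI e0.
  rewrite near_withinE; exists d => // r /= rd; rewrite in_itv /= => rI.
  apply: le_trans (fl _ _) _; rewrite -opprB normcN; exact: h.
split; apply: lim => z w.
  by rewrite -cReN -cReD; exact: Re_le_normc.
by rewrite -cImN -cImD; exact: Im_le_normc.
Qed.

Lemma sol_init xi : U 0 xi = fourier (toC u0) xi.
Proof.
have [_ h _] := hu; have [hI _] := hu0.
have I0 : 0 <= (0 : R) <= T by apply/andP; split; [exact: lexx|exact: ltW].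
apply: fourier_ae.
- exact: cig_cmf (hsfun_cig (sol_hsfun I0)).
- exact: cig_cmf (inL2_cig hI).
- by apply: aeT_imp (h : aeT (fun x => u 0 x = u0 x)) => x _ e; rewrite /toC e.
Qed.

(** The equation is a total derivative, so the mean is constant in time. *)
Lemma sol_mean0 t : 0 <= t <= T -> U t 0 = 0.
Proof.
move=> /andP[t0 tT]; have [->|tn] := eqVneq t 0; first by rewrite sol_init.
have tp : 0 < t by rewrite lt_neqAle eq_sym tn.
apply: Normc.eq0_normc; apply/eqP; rewrite eq_le normc_ge0 andbT.
apply/ler_addgt0Pl => e e0; rewrite addr0.
have et : 0 < e / t by rewrite divr_gt0.
have : hball 1 (fun k : int => U t 0 - U 0 0) (e / t * (t - 0)).
  apply: (@vector_mvt _ 1 (fun s (k : int) => U s 0) (fun _ _ => 0)) => //.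
  - move=> s _ /andP[s0 st]; have sI : 0 < s < T by rewrite s0 (lt_le_trans st).
    apply: cder_ext (sol_cder 0 sI) => //.
    by apply: complexP; rewrite /zz /ii ?cReD ?cImD ?cReM ?cImM /= expr0n /=; ring.
  - by move=> _; apply: ccont_sub (sol_ccont 0).
  - by move=> s _; exact: hball0.
move=> /(hball_term 0 ler01); rewrite subr0 divfK// sol_init mean0 subr0.
by [].
Qed.

(** The essential supremum bounds the norm at almost every time, hence at some time
    close to [t]; continuity transfers the bound to [t] with a margin. *)
Lemma sol_bound t : 0 <= t <= T -> hball (g + 1) (U t) (`|M| + 2).
Proof.
move=> tI; have [d d0 hd] := Hnorm_near tI (@ltr01 R).
have M1 : 0 < `|M| + 1 by rewrite ltr_wpDl.
suff [r rI [rd rM]] : exists2 r, 0 <= r <= T & `|t - r| < d /\ (Hnorm (g + 1) (toC (u r)) <= M%:E)%E.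
  have h1 : hball (g + 1) (U r) (`|M| + 1).
    by apply: Hnorm_hball => //; apply: le_trans rM _; rewrite lee_fin (le_trans (ler_norm _))// lerDl.
  have := hballB h1 (hd r rI rd); rewrite -addrA (_ : 1 + 1 = 2)//; apply: hball_ext => k.
  by rewrite opprB addrCA subrr addr0.
apply: contrapT => nr.
have /ess_supP [N [mN N0 sub]] : (LinfHs T (g + 1) u <= M%:E)%E by rewrite hM.
pose a := Num.max 0 (t - d); pose b := Num.min T (t + d).
have ab : a < b.
  case/andP: tI => t0 tT; rewrite /a /b lt_min !gt_max T0 /=.
  by apply/and3P; split; lra.
have abN : `]a, b[%classic `<=` N `&` `]0, T[%classic.
  move=> r /=; rewrite in_itv /= /a /b gt_max lt_min => /andP[/andP[r0 r1] /andP[r2 r3]].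
  split; last by rewrite in_itv /= r0.
  apply: sub => /= hr; apply: nr; exists r; first by rewrite !ltW.
  by split => //; rewrite ltr_distl; lra.
pose D : set R := N `&` `]0, T[%classic; pose J : set R := `]a, b[%classic.
have : (mu J <= mu D)%E.
  have mD : measurable (D : set (measurableTypeR R)) by apply: measurableI => //; exact: measurable_itv.
  have mJ : measurable (J : set (measurableTypeR R)) by exact: measurable_itv.
  by apply: le_measure; rewrite ?inE.
rewrite [X in (_ <= X)%E](N0 : mu D = 0%E) lebesgue_measure_itv /= lte_fin ab.
by rewrite -EFinB lee_fin; lra.
Qed.

End Solution.

(** At output frequency 0 the phases are trivial and the other terms carry an inverse
    derivative or a projection. *)
Lemma fstep_mean0 tau c : c 0 = 0 -> fstep tau c 0 = 0.
Proof.
move=> c0; rewrite /fstep /airy /tstep /cubic3 /pmean eqxx c0.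
have -> : quad tau c 0 = 0.
  rewrite /quad -[RHS](csum0 int); apply: eq_csum => k.
  rewrite /phase2 (_ : k + (0 - k) = 0); last by rewrite sub0r subrr.
  by rewrite !mul0r !mulr0 oppr0 expi0 subrr mulr0 mul0r.
have -> : bdry tau c 0 = 0.
  rewrite /bdry /conv3 /conv2 -[RHS](csum0 int); apply: eq_csum => j.
  rewrite -[RHS](csum0 int); apply: eq_csum => k.
  by rewrite (_ : k + (j - k) + (0 - j) = 0) ?mul0r//; ring.
have D0 a : Dinv a 0 = 0 :> C by rewrite /Dinv /iz eqxx mul0r.
by rewrite !D0; ring.
Qed.

Section Iterates.
Variables (g : R) (u0 : R -> R).
Hypothesis g2 : 1 / 2 < g.
Hypothesis hu0 : inHs (g + 1) (toC u0).
Hypothesis mean0 : fourier (toC u0) 0 = 0.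

Let g3 : 1 / 2 < g + 1.
Proof. by move: g2; lra. Qed.

Local Notation un tau n := (iter n (ELRI1 tau) (toC u0)).

(** The regularity of the iterates is qualitative: it only ensures that the next step
    is computed by [fstep]. *)
Lemma iter_hsfun tau n : hsfun (g + 1) (un tau n) (fourier (un tau n)) /\ fourier (un tau n) 0 = 0.
Proof.
elim: n => [|n [ih1 ih2]] /=.
  by split => //; split => //; [case: hu0|exact: inHs_hball].
have h := fourier_scheme g3 tau ih2 ih1.
have e : fourier (ELRI1 tau (un tau n)) = fstep tau (fourier (un tau n)) by case: h.
by split; [rewrite e|rewrite e fstep_mean0].
Qed.

Lemma iter_fstep tau n : fourier (un tau n.+1) =1 fstep tau (fourier (un tau n)).
Proof.
by have [h1 h2] := iter_hsfun tau n; have [_ e _] := fourier_scheme g3 tau h2 h1; move=> xi; rewrite -e.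
Qed.

End Iterates.
End Assembly.

End FourierAnalysis.

Theorem theorem2p3 (R : realType) (gamma : R) (hgamma : 1 / 2 < gamma)
    (T : R) (hT : 0 < T) (M : R) :
  exists tau0 C : R, 0 < tau0 /\ 0 < C /\
    forall (u0 : R -> R) (u : R -> R -> R),
      inHs (gamma + 1) (toC u0) ->
      fourier (toC u0) 0 = 0 ->
      KdV_solution T (gamma + 1) u0 u ->
      LinfHs T (gamma + 1) u = M%:E ->
      forall (tau : R) (n : nat),
        0 < tau <= tau0 ->
        n%:R * tau <= T ->
        (Hnorm gamma (fun x => toC (u (n%:R * tau)) x
                               - iter n (ELRI1 tau) (toC u0) x)%R
           <= (C * tau)%:E)%E.
Proof.
have M0 : 0 < `|M| + 2 by apply: ltr_wpDl.
have [tau0 [K [t0 K0 conv]]] := fourier_convergence hgamma hT M0.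
have q0 : 0 < Num.sqrt (2 * pi) :> R by rewrite sqrtr_gt0 pi2_gt0.
(* the factor converts the norm of the coefficients into the norm on the torus *)
exists tau0, (Num.sqrt (2 * pi) * K); do 2 (split; first by rewrite ?mulr_gt0//).
move=> u0 u hu0 mean0 hu hM tau n tt nT.
have tp : 0 < tau by case/andP: tt.
have nI : 0 <= n%:R * tau <= T by rewrite nT mulr_ge0// ltW.
have rU := sol_hsfun hu nI.
have [rW _] := iter_hsfun hgamma hu0 mean0 tau n.
have [hF _ [B hB]] := hsfunB rU rW.
have e : fourier (fun x => toC (u (n%:R * tau)) x - iter n (ELRI1 tau) (toC u0) x) =
    fun k => fourier (toC (u (n%:R * tau))) k - fourier (iter n (ELRI1 tau) (toC u0)) k.
  by have [] := hsfunB rU rW.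
rewrite -mulrA; apply: hball_Hnorm hF _ _.
- by rewrite mulr_ge0// ltW.
- by rewrite e; exact: hB.
- rewrite e; apply: (conv (fun t => fourier (toC (u t))) (fun n => fourier (iter n (ELRI1 tau) (toC u0))) tau) => //.
  + by move=> t tI; apply: (sol_mean0 hgamma hT hu0 mean0 hu).
  + by move=> t tI; apply: (sol_bound hT hu hM).
  + by move=> xi; apply: (sol_ccont hgamma hu).
  + by move=> t xi tI; apply: (sol_cder hgamma hu).
  + by move=> xi; rewrite (sol_init hT hu0 hu).
  + by move=> k _ _; apply: (iter_fstep hgamma hu0 mean0).
Qed.
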